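(* Let $n\ge1$ and $k\in\{1,\ldots,n\}$. For all $u\in S(\mathbb{R}^n_{k,+})$, $$\rho_1(u)\;\ge\;\inf_{v\in\tilde E}\|u-v\|_2^2,$$ where $\|\cdot\|_2$ is the norm of $L^2(\mathbb{R}^n_{k,+})$. Equality holds if and only if $u$ is of the form $$u(x)=\Bigg(\prod_{i=n-k+1}^{n}x_i\Bigg)e^{-B|x|^2}\Bigg(\sum_{i=1}^{n-k}b_ix_i+b\Bigg),\qquad b_1,\ldots,b_{n-k},b\in\mathbb{R},\ B>0.$$
   Context: $\mathbb{R}^n_{k,+}:=\mathbb{R}^{n-k}\times(0,\infty)^k$. $S(\mathbb{R}^n_{k,+})$ is the completion of $C_c^\infty(\mathbb{R}^n_{k,+})$ (smooth functions with compact support in the open orthant) under the norm $\left(\int_{\mathbb{R}^n_{k,+}}|\nabla u|^2dx\right)^{1/2}+\left(\int_{\mathbb{R}^n_{k,+}}|x|^2|u|^2dx\right)^{1/2}$. Functions are real-valued. The Heisenberg deficit is $$\rho_1(u)=\left(\int_{\mathbb{R}^n_{k,+}}|\nabla u(x)|^2dx\right)^{1/2}\left(\int_{\mathbb{R}^n_{k,+}}|x|^2|u(x)|^2dx\right)^{1/2}-\frac{n+2k}{2}\int_{\mathbb{R}^n_{k,+}}|u(x)|^2dx,$$ and $\tilde E=\left\{\left(\prod_{i=n-k+1}^{n}x_i\right)\alpha e^{-\beta|x|^2}:\alpha\in\mathbb{R},\ \beta>0\right\}$. *)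

(* Defs.v *)
From HB Require Import structures.
From mathcomp Require Import all_boot all_order all_algebra.
From mathcomp Require Import all_classical all_reals all_analysis.
Set Implicit Arguments.
Unset Strict Implicit.
Unset Printing Implicit Defensive.
Import Order.TTheory GRing.Theory Num.Theory numFieldNormedType.Exports.
Local Open Scope classical_set_scope.
Local Open Scope ring_scope.

(* R^n is 'rV[R]_n.  The norm `|x| of the library is the max norm, so that
   it gives the topology and the derivatives, but Euclidean lengths are written
   with [sqnorm] below. *)

(* The Borel sigma-algebra of R^n, generated by the coordinates (as the library
   does for tuples). *)
Section measurable_rV.
Context (R : realType) (n : nat).

Definition coord_rV (i : 'I_n) (x : 'rV[R]_n) : measurableTypeR R := x ord0 i.

Let rV_set0 : g_sigma_preimage coord_rV set0.
Proof. exact: sigma_algebra0. Qed.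

Let rV_setC A : g_sigma_preimage coord_rV A -> g_sigma_preimage coord_rV (~` A).
Proof. exact: sigma_algebraC. Qed.

Let rV_bigcup (F : _^nat) : (forall i, g_sigma_preimage coord_rV (F i)) ->
  g_sigma_preimage coord_rV (\bigcup_i (F i)).
Proof. exact: sigma_algebra_bigcup. Qed.

HB.instance Definition _ := @isMeasurable.Build default_measure_display
  'rV[R]_n (g_sigma_preimage coord_rV) rV_set0 rV_setC rV_bigcup.

Lemma measurable_coord_rV (i : 'I_n) :
  measurable_fun [set: 'rV[R]_n] (coord_rV i).
Proof.
move=> _ Y mY; rewrite setTI; apply: sub_sigma_algebra => /=.
rewrite -bigcup_seq/=; exists i => /=; first by rewrite mem_index_enum.
by exists Y => //; rewrite setTI.
Qed.

Lemma measurable_fun_rVP d (T : measurableType d) (f : T -> 'rV[R]_n) :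
  (forall i, measurable_fun [set: T] (coord_rV i \o f)) ->
  measurable_fun [set: T] f.
Proof.
move=> mf; have : g_sigma_preimage (fun i => coord_rV i \o f) `<=` measurable.
  apply: smallest_sub; first exact: sigma_algebra_measurable.
  move=> A; rewrite -bigcup_seq/= => -[i _ [B mB <-]].
  exact: mf.
rewrite g_sigma_preimage_comp => prefS _ A mA.
by apply: prefS; exists A.
Qed.

End measurable_rV.

(* Lebesgue measure on R^n, by recursion: R^(n+1) is identified with R * R^n. *)
Section lebesgue_rV.
Context (R : realType).

Definition cons_rV (n : nat) (p : measurableTypeR R * 'rV[R]_n) : 'rV[R]_n.+1 :=
  row_mx (p.1 : R)%:M p.2.

Definition uncons_rV (n : nat) (x : 'rV[R]_n.+1) : measurableTypeR R * 'rV[R]_n :=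
  (x ord0 ord0, \row_i x ord0 (lift ord0 i)).

Lemma cons_rV0 n p : (@cons_rV n p) ord0 ord0 = p.1.
Proof.
rewrite /cons_rV (_ : ord0 = lshift n (ord0 : 'I_1)); last exact/val_inj.
by rewrite (@row_mxEl _ 1 1 n) mxE eqxx.
Qed.

Lemma cons_rVS n p i : (@cons_rV n p) ord0 (lift ord0 i) = p.2 ord0 i.
Proof.
rewrite /cons_rV (_ : lift ord0 i = rshift 1 i); last exact/val_inj.
by rewrite (@row_mxEr _ 1 1 n).
Qed.

Lemma cons_rVK n : cancel (@cons_rV n) (@uncons_rV n).
Proof.
move=> [a v]; rewrite /uncons_rV cons_rV0; congr pair.
by apply/rowP => i; rewrite mxE cons_rVS.
Qed.

Lemma uncons_rVK n : cancel (@uncons_rV n) (@cons_rV n).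
Proof.
move=> x; apply/rowP => i; case: (unliftP ord0 i) => [j ->|->].
  by rewrite cons_rVS mxE.
by rewrite cons_rV0.
Qed.

Lemma measurable_cons_rV n : measurable_fun setT (@cons_rV n).
Proof.
apply: measurable_fun_rVP => i; case: (unliftP ord0 i) => [j ->|->].
  rewrite (_ : _ \o _ = coord_rV j \o snd).
    by apply: measurableT_comp => //; exact: measurable_coord_rV.
  by apply/funext => p /=; rewrite /coord_rV cons_rVS.
rewrite (_ : _ \o _ = fst) //.
by apply/funext => p /=; rewrite /coord_rV cons_rV0.
Qed.

Lemma measurable_uncons_rV n : measurable_fun setT (@uncons_rV n).
Proof.
apply/measurable_fun_pair; first exact: (@measurable_coord_rV R n.+1 ord0).
apply: measurable_fun_rVP => i.
rewrite (_ : _ \o _ = coord_rV (lift ord0 i)).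
  exact: measurable_coord_rV.
by apply/funext => x /=; rewrite /coord_rV mxE.
Qed.

Section cons_measure.
Context (n : nat) (m : {sigma_finite_measure set 'rV[R]_n -> \bar R}).

Definition cons_measure : set 'rV[R]_n.+1 -> \bar R :=
  pushforward (lebesgue_measure \x m)%E (@cons_rV n).

Let cons_measure0 : cons_measure set0 = 0%E.
Proof. by rewrite /cons_measure /pushforward preimage_set0 measure0. Qed.

Let cons_measure_ge0 A : (0 <= cons_measure A)%E.
Proof. by rewrite /cons_measure /pushforward; apply: measure_ge0. Qed.

Let cons_measure_sigma_additive : semi_sigma_additive cons_measure.
Proof.
move=> F mF tF mUF; rewrite /cons_measure /pushforward preimage_bigcup.
have mcons A : measurable A -> measurable (@cons_rV n @^-1` A).
  by move=> mA; rewrite -[X in measurable X]setTI; exact: measurable_cons_rV.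
apply: measure_semi_sigma_additive.
- by move=> k; exact: mcons.
- apply/trivIsetP => /= i j _ _ ij; rewrite -preimage_setI.
  by move/trivIsetP : tF => /(_ _ _ _ _ ij) ->//; rewrite preimage_set0.
- by rewrite -preimage_bigcup; exact: mcons.
Qed.

HB.instance Definition _ := isMeasure.Build _ _ _ cons_measure
  cons_measure0 cons_measure_ge0 cons_measure_sigma_additive.

Let cons_measure_sigma_finite : sigma_finite setT cons_measure.
Proof.
have /sigma_finiteP[F [TF ndF Foo]] := sigma_finiteT (@lebesgue_measure R).
have /sigma_finiteP[G [TG ndG Goo]] := sigma_finiteT m.
exists (fun k => @uncons_rV n @^-1` (F k `*` G k)).
  rewrite -preimage_bigcup; apply/esym; rewrite -subTset => x _ /=.
  have [i _ Fi] : (\bigcup_i F i) (uncons_rV x).1 by rewrite -TF.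
  have [j _ Gj] : (\bigcup_i G i) (uncons_rV x).2 by rewrite -TG.
  exists (maxn i j) => //; split.
    by move: Fi; exact/subsetPset/ndF/leq_maxl.
  by move: Gj; exact/subsetPset/ndG/leq_maxr.
move=> k; have [mF Fkoo] := Foo k; have [mG Gkoo] := Goo k; split.
  rewrite -[X in measurable X]setTI; apply: measurable_uncons_rV => //.
  exact: measurableX.
rewrite /cons_measure /pushforward -comp_preimage (_ : _ \o _ = id); last first.
  by apply/funext => p /=; rewrite cons_rVK.
by rewrite preimage_id product_measure1E// lte_mul_pinfty// ge0_fin_numE.
Qed.

HB.instance Definition _ := Measure_isSigmaFinite.Build _ _ _ cons_measure
  cons_measure_sigma_finite.

End cons_measure.

Fixpoint lebesgue_rV (n : nat) : {sigma_finite_measure set 'rV[R]_n -> \bar R} :=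
  if n is n'.+1 then cons_measure (lebesgue_rV n')
  else dirac (0 : 'rV[R]_0).

Lemma lebesgue_rV_box n (A : 'I_n -> set (measurableTypeR R)) :
  (forall i, measurable (A i)) ->
  lebesgue_rV n [set x | forall i, A i (x ord0 i)] =
    (\prod_(i < n) lebesgue_measure (A i))%E.
Proof.
elim: n A => [|n IH] A mA.
  by rewrite big_ord0 /= diracE mem_set //= => -[].
have mB : measurable [set x : 'rV[R]_n | forall i, A (lift ord0 i) (x ord0 i)].
  rewrite (_ : [set x | _] =
    \bigcap_(i in [set: 'I_n]) (coord_rV i @^-1` A (lift ord0 i))).
    apply: fin_bigcap_measurable => // i _; rewrite -[X in measurable X]setTI.
    by apply: measurable_coord_rV => //; exact: mA.
  by apply/seteqP; split=> x /= Ax i; [move=> _; exact: Ax | exact: Ax].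
rewrite big_ord_recl -(IH (fun i => A (lift ord0 i))); last by move=> i; exact: mA.
transitivity ((@lebesgue_measure R \x lebesgue_rV n)%E (A ord0 `*`
  [set x : 'rV[R]_n | forall i, A (lift ord0 i) (x ord0 i)])); last first.
  by rewrite product_measure1E//; exact: mA.
rewrite /= /cons_measure /pushforward; congr ((_ \x _)%E _).
apply/seteqP; split=> -[a v] /= Aav.
  split=> /= [|i]; first by have := Aav ord0; rewrite cons_rV0.
  by have := Aav (lift ord0 i); rewrite cons_rVS.
by move=> i; case: (unliftP ord0 i) => [j ->|->];
  rewrite ?cons_rVS ?cons_rV0; [exact: Aav.2 | exact: Aav.1].
Qed.

End lebesgue_rV.

Section heisenberg.
Context (R : realType) (n : nat).
Implicit Types (x : 'rV[R]_n) (u : 'rV[R]_n -> R) (k : nat).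

Local Notation mu := (lebesgue_rV R n).

Definition sqnorm x : R := \sum_i x ord0 i ^+ 2.

(* Coordinates are numbered from 0, so that the last k of them are the i with
   n - k <= i < n. *)
Definition orthant k : set 'rV[R]_n :=
  [set x | forall i : 'I_n, (n - k <= i)%N -> 0 < x ord0 i].

Definition last_prod k x : R := \prod_(i < n | (n - k <= i)%N) x ord0 i.

Definition partial (i : 'I_n) u x : R := 'D_(delta_mx ord0 i) u x.

Definition grad u x : 'rV[R]_n := \row_i partial i u x.

Fixpoint of_class_C (m : nat) u : Prop :=
  if m is m'.+1 then
    continuous u /\
    forall i : 'I_n, (forall x, derivable u x (delta_mx ord0 i)) /\
                     of_class_C m' (partial i u)
  else continuous u.

(* A test function on an open set is extended by 0 to R^n. *)
Definition test_function (Omega : set 'rV[R]_n) u : Prop :=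
  (forall m, of_class_C m u) /\
  exists K : set 'rV[R]_n,
    [/\ compact K, K `<=` Omega & forall x, ~ K x -> u x = 0].

Local Open Scope ereal_scope.

Definition int_sq k u : \bar R := \int[mu]_(x in orthant k) (u x ^+ 2)%:E.

Definition int_weight_sq k u : \bar R :=
  \int[mu]_(x in orthant k) (sqnorm x * u x ^+ 2)%:E.

Definition int_sqnorm k (G : 'rV[R]_n -> 'rV[R]_n) : \bar R :=
  \int[mu]_(x in orthant k) (sqnorm (G x))%:E.

Definition S_norm k u (G : 'rV[R]_n -> 'rV[R]_n) : \bar R :=
  sqrte (int_sqnorm k G) + sqrte (int_weight_sq k u).

(* The completion of the test functions under [S_norm], realized as the closure
   of the pairs (phi, grad phi) in the complete space of all pairs (u, G) with
   finite [S_norm]: [in_S k u Du] says that u belongs to the completion and that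
   Du is its gradient, which u determines almost everywhere. *)
Definition in_S k u (Du : 'rV[R]_n -> 'rV[R]_n) : Prop :=
  [/\ measurable_fun (orthant k) u,
      measurable_fun (orthant k) Du &
      exists phi : nat -> 'rV[R]_n -> R,
        (forall j, test_function (orthant k) (phi j)) /\
        S_norm k (phi j \- u)%R (grad (phi j) \- Du)%R @[j --> \oo] --> 0].

Definition rho1 k u (Du : 'rV[R]_n -> 'rV[R]_n) : \bar R :=
  sqrte (int_sqnorm k Du) * sqrte (int_weight_sq k u)
  - ((n + 2 * k)%:R / 2)%:E * int_sq k u.

Definition Etilde k : set ('rV[R]_n -> R) :=
  [set v | exists alpha beta : R, (0 < beta)%R /\
     v = (fun x => last_prod k x * (alpha * expR (- (beta * sqnorm x))))%R].

End heisenberg.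

Arguments lebesgue_rV {R} n.

(* Main.v *)
(* With [A = ||grad u||^2], [X = || |x| u ||^2] and [c > 0], the operator
   [- Laplacian + c^2 |x|^2] with Dirichlet conditions on the faces of the
   orthant is a sum of one-dimensional oscillators.  A line contributes the
   eigenvalues c, 3c, 5c, ..., a half-line 3c, 7c, ...  Hence the ground state is
   [prod x_i * exp (- c |x|^2 / 2)] with eigenvalue [c (n + 2k)], the next level
   is [2c] higher and spanned by the [x_i * ground state] with [x_i] free, and all
   the rest is at least [4c] higher.  If [m0] is the coefficient of [u] on the
   ground state and [M] its mass on the first level, then
     [A + c^2 X - c (n + 2k) |u|^2 >= 4c (|u|^2 - m0^2 - M) + 2c M],
   and the choice [c = sqrt (A / X)] turns the left-hand side into [2c rho_1 u]:
   so [rho_1 u >= |u|^2 - m0^2 + (|u|^2 - m0^2 - M)], where [|u|^2 - m0^2] is the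
   squared distance from [u] to a multiple of the ground state.  Equality
   forces [u] to live on the first two levels.  Conversely such a [u] satisfies
   [rho_1 u <= M], while the first level for [c] is orthogonal to all Gaussians
   [prod x_i * exp (- b |x|^2)], so that [M] bounds the distance from below.

   No completeness of the eigenfunctions is needed.  In one dimension the gap
   comes from the factorization [(d/dx + p)^* (d/dx + p)] and a commutation of
   the factors; the gap on [R^(n+1)] follows from those on [R] and [R^n] by
   Bessel-type inequalities for the commuting projections on the two factors. *)
Require Import Defs.
From mathcomp Require Import all_boot all_order all_algebra.
From mathcomp Require Import all_classical all_reals all_analysis.
From mathcomp Require Import measurable_realfun.
From mathcomp Require Import ring lra.
Set Implicit Arguments.
Unset Strict Implicit.
Unset Printing Implicit Defensive.
Import Order.TTheory GRing.Theory Num.Theory numFieldNormedType.Exports.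
Local Open Scope classical_set_scope.
Local Open Scope ring_scope.

(** * Integration on a compact interval *)

(** Two obstacles shape the proof. The norm of the completion has no term in |u|^2, and its weight
    |x|^2 degenerates at the origin, so L2 convergence of the approximating test functions has to be
    recovered: the spectral gap at c = 1 bounds |f|^2 by the energy, and the origin lies outside the
    orthant. Moreover a limit has only a weak gradient. The gap is therefore proved for test
    functions and passed to the limit, while the energy identity behind the converse of the equality
    case is obtained by pairing u with test functions, which carry all the second derivatives. The
    constant 4c has two origins. On a half-line, exchanging the factors produces the extra potential
    2/x^2, and the exchanged operator starts at 4c. On a line the exchange only adds 2c, and the
    commutation is used twice. The balancing scale exists only if A and X are positive; otherwise
    the gap at all scales forces u = 0. *)

Definition contin (R : realType) (a b : R) (f : R -> R) : Prop :=
  {in `[a, b], continuous f}.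

Section interval_integral.
Context (R : realType).
Implicit Types (a b x : R) (f g h p : R -> R).

Lemma cont_in_within a b f : contin a b f ->
  {within `[a, b], continuous f}.
Proof. by move=> cf; apply: continuous_in_subspaceT => x /set_mem /cf. Qed.

Lemma cont_in_integrable a b f : contin a b f ->
  (@lebesgue_measure R).-integrable `[a, b] (EFin \o f).
Proof.
move=> cf; apply: continuous_compact_integrable; first exact: segment_compact.
exact: cont_in_within.
Qed.

Lemma is_derive_cont f x df : is_derive x 1 f df -> {for x, continuous f}.
Proof. by case=> df1 _; apply/differentiable_continuous/derivable1_diffP. Qed.

Lemma Rintegral_derive a b F f : a < b ->
  {in `[a, b], forall x, is_derive x 1 F (f x)} ->
  contin a b f ->
  \int[lebesgue_measure]_(x in `[a, b]) f x = F b - F a.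
Proof.
move=> ab dF cf.
have cF x : x \in `[a, b] -> {for x, continuous F}.
  by move=> /dF; exact: is_derive_cont.
have aab : a \in `[a, b] by rewrite in_itv/= lexx ltW.
have bab : b \in `[a, b] by rewrite in_itv/= lexx ltW.
rewrite /Rintegral (@continuous_FTC2 _ f F)//.
- exact: cont_in_within.
- split.
  + by move=> x /subset_itv_oo_cc /dF [].
  + exact/cvg_at_right_filter/cF.
  + exact/cvg_at_left_filter/cF.
- by move=> x /subset_itv_oo_cc /dF []; rewrite derive1E.
Qed.

(** The derivative has to be two-sided even at [a] and [b]. To this end [f] is extended by its end
    values to a continuous function on the line, which is integrated from [a - 1]. *)
Lemma ex_antiderivative a b f : a < b -> contin a b f ->
  exists F, F b = 0 /\ {in `[a, b], forall x, is_derive x 1 F (f x)}.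
Proof.
move=> ab cf.
pose clamp x := Num.max a (Num.min b x).
have cl_in x : clamp x \in `[a, b].
  by rewrite in_itv/= /clamp le_max lexx /= ge_max (ltW ab) ge_min lexx.
have clE x : x \in `[a, b] -> clamp x = x.
  rewrite in_itv/= => /andP[ax xb].
  by rewrite /clamp (min_idPr xb) (max_idPr ax).
have ccl : continuous clamp.
  move=> x; apply: (@continuous_max R R (cst a) (fun y => Num.min b y)).
    exact: cst_continuous.
  apply: (@continuous_min R R (cst b) id); first exact: cst_continuous.
  exact.
pose k := f \o clamp.
have ck : continuous k.
  by move=> x; apply: continuous_comp; [exact: ccl|exact: cf].
pose F x := \int[lebesgue_measure]_(t in `[a - 1, x]) k t.
exists (fun x => F x - F b); split; first by rewrite subrr.
move=> x xab; have /andP[ax xb] : (a <= x) && (x <= b) by rewrite in_itv/= in xab.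
have [dF F'] : derivable F x 1 /\ derive1 F x = k x.
  apply: (@continuous_FTC1_closed _ k (a - 1) x (b + 1)).
  - lra.
  - by apply: cont_in_integrable => y _; exact: ck.
  - lra.
  - exact: ck.
rewrite -(clE _ xab) -[f _]/(k x) -F' derive1E.
rewrite -[X in is_derive _ _ _ X]subr0 clE//.
by apply: is_deriveB; exact: DeriveDef.
Qed.

End interval_integral.

Section derive_rules.
Context (R : realType).
Implicit Types (f g : R -> R) (x df dg : R).

Lemma derN f x df : is_derive x 1 f df -> is_derive x 1 (fun y => - f y) (- df).
Proof. by move=> hf; exact: is_deriveN. Qed.

Lemma derD f g x df dg : is_derive x 1 f df -> is_derive x 1 g dg ->
  is_derive x 1 (fun y => f y + g y) (df + dg).
Proof. by move=> hf hg; exact: is_deriveD. Qed.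

Lemma derM f g x df dg : is_derive x 1 f df -> is_derive x 1 g dg ->
  is_derive x 1 (fun y => f y * g y) (df * g x + f x * dg).
Proof.
move=> hf hg; apply: (is_derive_eq (is_deriveM hf hg)).
by rewrite /GRing.scale/= addrC mulrC.
Qed.

Lemma derZ k f x df : is_derive x 1 f df ->
  is_derive x 1 (fun y => k * f y) (k * df).
Proof. by move=> hf; exact: is_deriveZ. Qed.

Lemma derV f x df : f x != 0 -> is_derive x 1 f df ->
  is_derive x 1 (fun y => (f y)^-1) (- df / f x ^+ 2).
Proof.
move=> f0 hf; apply: (is_derive_eq (is_deriveV f0 hf)).
by rewrite /GRing.scale/=; field.
Qed.

End derive_rules.

Section continuous_in.
Context (R : realType) (a b : R).
Implicit Types (f g h p : R -> R).
Local Notation C f := (contin a b f).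
Local Notation I f := (\int[lebesgue_measure]_(x in `[a, b]) f x).

Lemma contin_cst (k : R) : C (fun=> k).
Proof. by move=> x _; exact: cst_continuous. Qed.

Lemma contin_id : C (fun x => x). Proof. by move=> x _; exact. Qed.

Lemma continD f g : C f -> C g -> C (fun x => f x + g x).
Proof. by move=> cf cg x xab; apply: continuousD; [exact: cf|exact: cg]. Qed.

Lemma continM f g : C f -> C g -> C (fun x => f x * g x).
Proof. by move=> cf cg x xab; apply: continuousM; [exact: cf|exact: cg]. Qed.

Lemma continN f : C f -> C (fun x => - f x).
Proof. by move=> cf x xab; apply: continuousN; exact: cf. Qed.

Lemma continX f n : C f -> C (fun x => f x ^+ n).
Proof.
move=> cf x xab; apply: (@continuous_comp _ _ _ f (fun y => y ^+ n)).
  exact: cf.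
exact: exprn_continuous.
Qed.

Lemma continV f : C f -> {in `[a, b], forall x : R, f x != 0} ->
  C (fun x => (f x)^-1).
Proof. by move=> cf f0 x xab; apply: continuousV; [exact: f0|exact: cf]. Qed.

Lemma contin_derive f f' : {in `[a, b], forall x : R, is_derive x 1 f (f' x)} -> C f.
Proof. by move=> df x /df; exact: is_derive_cont. Qed.

Lemma IntD f g : C f -> C g -> I (fun x => f x + g x) = I f + I g.
Proof. by move=> cf cg; rewrite RintegralD//; exact: cont_in_integrable. Qed.

Lemma IntB f g : C f -> C g -> I (fun x => f x - g x) = I f - I g.
Proof. by move=> cf cg; rewrite RintegralB//; exact: cont_in_integrable. Qed.

Lemma IntZ k f : C f -> I (fun x => k * f x) = k * I f.
Proof. by move=> cf; rewrite RintegralZl//; exact: cont_in_integrable. Qed.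

Lemma Int_sq_ge0 f : 0 <= I (fun x => f x ^+ 2).
Proof. by apply: Rintegral_ge0 => x _; exact: sqr_ge0. Qed.

Lemma eq_Int f g : {in `[a, b], f =1 g} -> I f = I g.
Proof. by move=> fg; apply: eq_Rintegral => x; rewrite inE => /fg. Qed.

End continuous_in.

(** Follows the syntax of the integrand down to constants, the variable and the [contin] hypotheses
    of the context. *)
Ltac contin := lazymatch goal with
  | |- contin _ _ (fun x => x) => exact: contin_id
  | |- @contin ?R ?a ?b (fun x => @GRing.add _ (@?f x) (@?g x)) =>
      refine (@continD R a b f g _ _); contin
  | |- @contin ?R ?a ?b (fun x => @GRing.mul _ (@?f x) (@?g x)) =>
      refine (@continM R a b f g _ _); contin
  | |- @contin ?R ?a ?b (fun x => @GRing.opp _ (@?f x)) =>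
      refine (@continN R a b f _); contin
  | |- @contin ?R ?a ?b (fun x => @GRing.exp _ (@?f x) ?n) =>
      refine (@continX R a b f n _); contin
  | |- @contin ?R ?a ?b (fun _ => ?k) => exact (@contin_cst R a b k)
  | H : @contin _ ?a ?b ?h |- @contin _ ?a ?b ?h => exact H
  | H : @contin _ ?a ?b ?h |- @contin _ ?a ?b (fun x => ?h x) => exact H
  | H : @contin _ ?a ?b (fun x => ?h x) |- @contin _ ?a ?b ?h => exact H
  end.

(** * Spectral gaps on an interval by factorization and commutation *)

Section spectral_gap_interval.
Context (R : realType) (a b : R) (ab : a < b).
Implicit Types (f g h p : R -> R).
Local Notation C f := (contin a b f).
Local Notation I f := (\int[lebesgue_measure]_(x in `[a, b]) f x).
Local Notation D f f' := {in `[a, b], forall x : R, is_derive x 1 f (f' x)}.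

Variables (g p : R -> R).
Hypotheses (g_gt0 : {in `[a, b], forall x, 0 < g x}).
Hypotheses (dg : D g (fun x => - (p x * g x))) (cp : C p).

Let cg : C g. Proof. exact: contin_derive dg. Qed.

Let aab : a \in `[a, b]. Proof. by rewrite in_itv/= lexx ltW. Qed.
Let bab : b \in `[a, b]. Proof. by rewrite in_itv/= lexx ltW. Qed.

(* The adjoint of [d/dx + p] is onto the orthogonal complement of the
   ground state [g]: [h] is [1/g] times an antiderivative of [f0 * g]. *)
Lemma adjoint_solution f0 : C f0 -> I (fun x => f0 x * g x) = 0 ->
  exists h h' : R -> R, [/\ D h h', C h', h a = 0, h b = 0 &
    {in `[a, b], forall x, - h' x + p x * h x = f0 x}].
Proof.
move=> cf0 f0g.
have cfg : C (fun x => f0 x * g x) by contin.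
have [F [Fb dF]] := ex_antiderivative ab cfg.
have Fa : F a = 0.
  have := Rintegral_derive ab dF cfg; rewrite f0g Fb => /eqP.
  by rewrite sub0r eq_sym oppr_eq0 => /eqP.
have cF : C F by exact: contin_derive dF.
pose h x := - F x / g x.
pose h' x := - f0 x + p x * h x.
have cgV : C (fun x => (g x)^-1).
  by move=> x xab; apply: continuousV; [rewrite gt_eqF// g_gt0|exact: cg].
exists h, h'; split.
- move=> x xab; have g0 : g x != 0 by rewrite gt_eqF// g_gt0.
  apply: (is_derive_eq (derM (derN (dF _ xab)) (derV g0 (dg xab)))).
  by rewrite /h' /h; field.
- by rewrite /h' /h; contin.
- by rewrite /h Fa oppr0 mul0r.
- by rewrite /h Fb oppr0 mul0r.
- by move=> x _; rewrite /h'; ring.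
Qed.

Lemma adjoint_pairing f f' h h' : D f f' -> C f' -> D h h' -> C h' ->
  h a = 0 -> h b = 0 ->
  I (fun x => (- h' x + p x * h x) * f x) = I (fun x => h x * (f' x + p x * f x)).
Proof.
move=> df cf' dh ch' ha hb.
have cf := contin_derive df; have ch := contin_derive dh.
apply/eqP; rewrite -subr_eq0 -IntB; [|by contin..].
rewrite (@eq_Int _ _ _ _ (fun x => - (h x * f' x + f x * h' x))).
  rewrite (@Rintegral_derive _ _ _ (fun x => - (h x * f x)))//; [|move=> x xab|by contin].
    by rewrite ha hb !mul0r subrr.
  apply: (is_derive_eq (derN (derM (dh _ xab) (df _ xab)))).
  by rewrite addrC (mulrC (h' x)).
by move=> x _; ring.
Qed.

Lemma norm_gt0 : 0 < I (fun x => g x ^+ 2).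
Proof.
have cg2 : C (fun x => g x ^+ 2) by contin.
have [F [_ dF]] := ex_antiderivative ab cg2.
rewrite (Rintegral_derive ab dF cg2).
have dFo x : x \in `]a, b[ -> is_derive x 1 F (g x ^+ 2).
  by move=> /subset_itv_oo_cc /dF.
have [c cab ->] := MVT ab dFo (cont_in_within (contin_derive dF)).
by rewrite mulr_gt0 ?subr_gt0// exprn_gt0// g_gt0// (subset_itv_oo_cc cab).
Qed.

Section first_gap.
Variables (K : R).
Hypothesis HK : forall h h', D h h' -> C h' -> h a = 0 -> h b = 0 ->
  K * I (fun x => h x ^+ 2) <= I (fun x => (- h' x + p x * h x) ^+ 2).
Hypothesis K_ge0 : 0 <= K.

Variables (f f' : R -> R) (df : D f f') (cf' : C f').

Let cf : C f. Proof. exact: contin_derive df. Qed.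

(** Let A = d/dx + p, with adjoint -d/dx + p, and let f0 be the part of [f] orthogonal to [g]. Then
    [h] is a preimage of f0 under the adjoint, and moving A across the pairing gives <h, A f> = <f0,
    f> = |f0|^2. Both gap estimates below are run on this [h]. *)
Lemma adjoint_split : exists h h' : R -> R, [/\ D h h', C h' & h a = 0] /\ [/\ h b = 0,
  {in `[a, b], forall x, - h' x + p x * h x =
     f x - I (fun x => f x * g x) / I (fun x => g x ^+ 2) * g x},
  I (fun x => (- h' x + p x * h x) ^+ 2) =
  I (fun x => f x ^+ 2) - I (fun x => f x * g x) ^+ 2 / I (fun x => g x ^+ 2) &
  I (fun x => h x * (f' x + p x * f x)) =
  I (fun x => (- h' x + p x * h x) ^+ 2)].
Proof.
have gam0 := norm_gt0; set al := _ / _; pose f0 x := f x - al * g x.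
have cf0 : C f0 by rewrite /f0; contin.
have f0g : I (fun x => f0 x * g x) = 0.
  rewrite (@eq_Int _ _ _ _ (fun x => f x * g x - al * g x ^+ 2)).
    rewrite IntB; [|by contin..]; rewrite IntZ; [|by contin].
    by rewrite /al -mulrA mulVf ?gt_eqF// mulr1 subrr.
  by move=> x _; rewrite /f0; ring.
have [h [h' [dh ch' ha hb hf0]]] := adjoint_solution cf0 f0g.
exists h, h'; split=> //.
have f0f : I (fun x => f0 x * f x) = I (fun x => f0 x ^+ 2).
  rewrite (@eq_Int _ _ _ (fun x => f0 x * f x)
    (fun x => f0 x ^+ 2 + al * (f0 x * g x))).
    rewrite IntD; [|by contin..]; rewrite IntZ; [|by contin]; rewrite f0g; ring.
  by move=> x _; rewrite /f0; ring.
have hf0E : I (fun x => (- h' x + p x * h x) ^+ 2) = I (fun x => f0 x ^+ 2).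
  by apply: eq_Int => x /hf0 ->.
split=> //.
  rewrite hf0E -f0f.
  rewrite (@eq_Int _ _ _ (fun x => f0 x * f x)
    (fun x => f x ^+ 2 - al * (f x * g x))).
    rewrite IntB; [|by contin..]; rewrite IntZ; [|by contin].
    by rewrite /al; field; rewrite gt_eqF.
  by move=> x _; rewrite /f0; ring.
rewrite hf0E -f0f -(adjoint_pairing df cf' dh ch' ha hb).
by apply: eq_Int => x /hf0 ->.
Qed.

(** With A = d/dx + p and f0 the part of [f] orthogonal to [g], expanding 0 <= |A f - K h|^2 gives
    |A f|^2 >= 2 K |f0|^2 - K^2 |h|^2, and [HK] replaces K |h|^2 by |f0|^2. Thus a lower bound for
    the exchanged product of the factors is inherited by the original product off the ground
    state. *)
Lemma first_gap_interval :
  K * (I (fun x => f x ^+ 2) - I (fun x => f x * g x) ^+ 2 / I (fun x => g x ^+ 2))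
  <= I (fun x => (f' x + p x * f x) ^+ 2).
Proof.
have [h [h' [[dh ch' ha] [hb _ E1 E2]]]] := adjoint_split.
have ch := contin_derive dh.
rewrite -E1; have HKh := HK dh ch' ha hb.
have := Int_sq_ge0 a b (fun x => f' x + p x * f x - K * h x).
rewrite (@eq_Int _ _ _ _ (fun x => (f' x + p x * f x) ^+ 2
   - 2 * K * (h x * (f' x + p x * f x)) + K ^+ 2 * h x ^+ 2)); last first.
  by move=> x _; ring.
rewrite IntD; [|by contin..]; rewrite IntB; [|by contin..].
rewrite !IntZ; [|by contin..]; rewrite E2.
have := ler_wpM2l K_ge0 HKh.
by rewrite mulrA -expr2; lra.
Qed.

End first_gap.

End spectral_gap_interval.

Section gaussian_weights.
Context (R : realType) (c : R).
Implicit Types (x : R).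

Definition gauss x : R := expR (- (c / 2 * x ^+ 2)).

Lemma gauss_gt0 x : 0 < gauss x. Proof. exact: expR_gt0. Qed.

Lemma is_derive_gauss x : is_derive x 1 gauss (- (c * x * gauss x)).
Proof.
have d1 : is_derive x 1 (fun y : R => - (c / 2 * y ^+ 2)) (- (c * x)).
  apply: (is_derive_eq (derN (derZ (c / 2) (derM (is_derive_id x 1)
    (is_derive_id x 1))))).
  by field.
have d2 := is_derive_expR (- (c / 2 * x ^+ 2)).
apply: (is_derive_eq (@is_derive1_comp _ expR (fun y => - (c / 2 * y ^+ 2)) _ _ _ d2 d1)).
by rewrite /gauss /GRing.scale/=; ring.
Qed.

Lemma continuous_gauss : continuous gauss.
Proof. by move=> x; exact: is_derive_cont (is_derive_gauss x). Qed.

(** The first odd eigenfunction of the oscillator on the line; on the half-line it is the Dirichlet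
    ground state. *)
Definition dirichlet_gauss x : R := x * gauss x.

Lemma is_derive_dirichlet_gauss x : x != 0 ->
  is_derive x 1 dirichlet_gauss (- ((c * x - x^-1) * dirichlet_gauss x)).
Proof.
move=> x0; apply: (is_derive_eq (derM (is_derive_id x 1) (is_derive_gauss x))).
by rewrite /dirichlet_gauss; field.
Qed.

End gaussian_weights.

Section gaps_interval.
Context (R : realType) (c a b : R) (ab : a < b) (c_gt0 : 0 < c).
Implicit Types (f g h p : R -> R).
Local Notation C f := (contin a b f).
Local Notation I f := (\int[lebesgue_measure]_(x in `[a, b]) f x).
Local Notation D f f' := {in `[a, b], forall x : R, is_derive x 1 f (f' x)}.

(** Here p = c x - 1/x. In the original order the factors give -d^2/dx^2 + c^2 x^2 - 3c, in the
    opposite order -d^2/dx^2 + c^2 x^2 + 2/x^2 - c, which is bounded below by 4c. Since [0 < a], the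
    singular coefficients are continuous on the interval. *)
Lemma dirichlet_gap_interval f f' : 0 < a -> D f f' -> C f' ->
  f a = 0 -> f b = 0 ->
  4 * c * (I (fun x => f x ^+ 2) - I (fun x => f x * dirichlet_gauss c x) ^+ 2
     / I (fun x => dirichlet_gauss c x ^+ 2))
  <= I (fun x => f' x ^+ 2 + c ^+ 2 * (x * f x) ^+ 2 - 3 * c * f x ^+ 2).
Proof.
move=> a0 df cf' fa fb.
have x0 : {in `[a, b], forall x : R, x != 0}.
  by move=> x; rewrite in_itv/= => /andP[ax _]; rewrite gt_eqF// (lt_le_trans a0).
have cV : C (fun x : R => x^-1).
  by apply: continV; [contin|exact: x0].
have cV2 : C (fun x : R => x ^- 2).
  apply: (@continV _ _ _ (fun x => x ^+ 2)); first by contin.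
  by move=> x /x0 x0'; rewrite expf_neq0.
pose p x := c * x - x^-1.
have cp : C p by rewrite /p; contin.
have dV : D (fun x : R => x^-1) (fun x : R => - (x ^- 2)).
  move=> x xab; apply: (is_derive_eq (derV (x0 _ xab) (is_derive_id x 1))).
  by rewrite mulNr mul1r.
have cf := contin_derive df.
have gp : {in `[a, b], forall x : R, 0 < dirichlet_gauss c x}.
  move=> x; rewrite in_itv/= => /andP[ax _].
  by rewrite mulr_gt0 ?gauss_gt0// (lt_le_trans a0).
have dg : D (dirichlet_gauss c) (fun x => - (p x * dirichlet_gauss c x)).
  by move=> x /x0; exact: is_derive_dirichlet_gauss.
have HK h h' : D h h' -> C h' -> h a = 0 -> h b = 0 ->
  4 * c * I (fun x => h x ^+ 2) <= I (fun x => (- h' x + p x * h x) ^+ 2).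
  move=> dh ch' ha hb; have ch := contin_derive dh.
  rewrite -IntZ; [|by contin].
  rewrite -subr_ge0 -IntB; [|by contin..].
  (* The exchanged operator has the ground state x^2 exp(- c x^2 / 2), which the first-order
     operator in [q] annihilates. Subtracting 4c from the exchanged form leaves q^2 up to the
     derivative of [r], whose boundary values vanish with [h]. *)
  pose q x := h' x + (c * x - 2 * x^-1) * h x.
  have cq : C q by rewrite /q; contin.
  pose r x := - (2 * c * x - 3 * x^-1) * h x ^+ 2.
  pose r' x := - (2 * c + 3 * x ^- 2) * h x ^+ 2
               - (2 * c * x - 3 * x^-1) * (2 * h x * h' x).
  have cr' : C r'.
    by rewrite /r'; contin.
  have dr : D r r'.
    move=> x xab.
    have d1 := derD (derZ (2 * c) (is_derive_id x 1)) (derN (derZ 3 (dV _ xab))).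
    apply: (is_derive_eq (derM (derN d1) (derM (dh _ xab) (dh _ xab)))).
    by rewrite /r'; field; rewrite x0.
  rewrite (@eq_Int _ _ _ _ (fun x => q x ^+ 2 + r' x)); last first.
    move=> x xab; rewrite /q /r' /p; field; exact: x0.
  rewrite IntD; [|by contin..].
  rewrite (Rintegral_derive ab dr cr') /r ha hb.
  by rewrite expr0n/= !mulr0 subr0 addr0 Int_sq_ge0.
have c4 : 0 <= 4 * c by rewrite mulr_ge0// ltW.
apply: le_trans (first_gap_interval ab gp dg cp HK c4 df cf') _.
(* Undoes the factorization: the cross term 2 p f f' is absorbed in the derivative of p f^2, which
   integrates to 0. *)
pose r x := (c * x - x^-1) * f x ^+ 2.
pose r' x := (c + x ^- 2) * f x ^+ 2 + (c * x - x^-1) * (2 * f x * f' x).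
have cr' : C r' by rewrite /r'; contin.
have dr : D r r'.
  move=> x xab.
  have d1 := derD (derZ c (is_derive_id x 1)) (derN (dV _ xab)).
  apply: (is_derive_eq (derM d1 (derM (df _ xab) (df _ xab)))).
  by rewrite /r'; field; rewrite x0.
rewrite (@eq_Int _ _ _ (fun x => (f' x + p x * f x) ^+ 2)
  (fun x => f' x ^+ 2 + c ^+ 2 * (x * f x) ^+ 2 - 3 * c * f x ^+ 2 + r' x)).
  rewrite IntD; [|by contin..].
  by rewrite (Rintegral_derive ab dr cr') /r fa fb expr0n/= !mulr0 subr0 addr0.
by move=> x xab; rewrite /p /r'; field; exact: x0.
Qed.

End gaps_interval.

Section free_gap_interval.
Context (R : realType) (c b : R) (b_gt0 : 0 < b) (c_gt0 : 0 < c).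
Implicit Types (f g h p : R -> R).
Let a := - b.
Local Notation C f := (contin a b f).
Local Notation I f := (\int[lebesgue_measure]_(x in `[a, b]) f x).
Local Notation D f f' := {in `[a, b], forall x : R, is_derive x 1 f (f' x)}.
Local Notation g := (gauss c).

Let ab : a < b. Proof. by rewrite /a gtrN. Qed.

Let cg : C g. Proof. by move=> x _; exact: continuous_gauss. Qed.

Let dg : D g (fun x => - (c * x * g x)).
Proof. by move=> x _; exact: is_derive_gauss. Qed.

(** For p = c x the commutator of d/dx + p and its adjoint is the constant 2c. *)
Let adjoint_commutation h h' : D h h' -> C h' -> h a = 0 -> h b = 0 ->
  I (fun x => (- h' x + c * x * h x) ^+ 2) =
  I (fun x => (h' x + c * x * h x) ^+ 2) + 2 * c * I (fun x => h x ^+ 2).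
Proof.
move=> dh ch' ha hb; have ch := contin_derive dh.
pose r x := - (2 * c * x * h x ^+ 2).
pose r' x := - (2 * c * h x ^+ 2 + 2 * c * x * (2 * h x * h' x)).
have cr' : C r' by rewrite /r'; contin.
have dr : D r r'.
  move=> x xab; have d1 := derM (derZ (2 * c) (is_derive_id x 1))
                              (derM (dh _ xab) (dh _ xab)).
  by apply: (is_derive_eq (derN d1)); rewrite /r'; ring.
rewrite -IntZ; [|by contin]; rewrite -IntD; [|by contin..].
rewrite [LHS](@eq_Int _ _ _ _ (fun x => (h' x + c * x * h x) ^+ 2
   + 2 * c * h x ^+ 2 + r' x)); last by move=> x _; rewrite /r'; ring.
rewrite [LHS]IntD; [|by contin..].
by rewrite (Rintegral_derive ab dr cr') /r ha hb expr0n/= !mulr0 !oppr0 !addr0.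
Qed.

Let HK h h' : D h h' -> C h' -> h a = 0 -> h b = 0 ->
  2 * c * I (fun x => h x ^+ 2) <= I (fun x => (- h' x + c * x * h x) ^+ 2).
Proof.
by move=> dh ch' ha hb; rewrite adjoint_commutation// lerDr Int_sq_ge0.
Qed.

(** Let A = d/dx + c x, and let [h] be the preimage of f0 = f - al g under the adjoint of A. The
    first gap, with K = 2c, is applied to [h] instead of [f]: with the commutation it bounds |h|^2
    by |f0|^2 / (4c), up to the component of [h] on [g], which is governed by the component of [f]
    on x g. *)
Lemma free_gap_interval f f' : D f f' -> C f' -> f a = 0 -> f b = 0 ->
  4 * c * (I (fun x => f x ^+ 2) - I (fun x => f x * g x) ^+ 2
     / I (fun x => g x ^+ 2))
  - 4 * c ^+ 2 * I (fun x => f x * (x * g x)) ^+ 2 / I (fun x => g x ^+ 2)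
  <= I (fun x => f' x ^+ 2 + c ^+ 2 * (x * f x) ^+ 2 - c * f x ^+ 2).
Proof.
move=> df cf' fa fb; have cf := contin_derive df.
have c2 : 0 <= 2 * c by rewrite mulr_ge0// ltW.
have cp : C (fun x : R => c * x) by contin.
have g0 : {in `[a, b], forall x : R, 0 < g x} by move=> x _; exact: gauss_gt0.
have [h [h' [[dh ch' ha] [hb hf0 E1 E2]]]] := adjoint_split ab g0 dg cp df cf'.
have ch := contin_derive dh.
rewrite -E1.
have := first_gap_interval ab g0 dg cp HK c2 dh ch'.
move: hf0 E1; set al := _ / _ => hf0 E1.
set gam := I (fun x => g x ^+ 2).
have gam0 : 0 < gam.
  apply: (norm_gt0 ab g0 dg).
set th := I (fun x => f x * (x * g x)).
(* A maps x g to g, so that <h, g> = <f0, x g>; the term in [al] drops out because x g^2 is odd and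
   the interval is symmetric. *)
have hg : I (fun x => h x * g x) = th.
  have e1 : I (fun x => x * g x ^+ 2) = 0.
    rewrite (@Rintegral_derive _ _ _ (fun x => - (2 * c)^-1 * g x ^+ 2))//.
    - by rewrite /gauss /a sqrrN subrr.
    - move=> x xab; have d1 := derM (dg xab) (dg xab).
      by apply: (is_derive_eq (derZ (- (2 * c)^-1) d1)); field; rewrite gt_eqF.
    - by contin.
  have e2 : I (fun x => x * (g x * (f x - al * g x)) - h x * g x) = 0.
    rewrite (@Rintegral_derive _ _ _ (fun x => - (x * (h x * g x))))//.
    - by rewrite ha hb !mul0r !mulr0 subrr.
    - move=> x xab.
      have d1 := derM (is_derive_id x 1) (derM (dh _ xab) (dg xab)).
      apply: (is_derive_eq (derN d1)).
      by rewrite -(hf0 _ xab); ring.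
    - by contin.
  move: e2; rewrite IntB; [|by contin..] => /eqP; rewrite subr_eq0 => /eqP <-.
  rewrite (@eq_Int _ _ _ _ (fun x => f x * (x * g x) - al * (x * g x ^+ 2))).
    rewrite IntB; [|by contin..]; rewrite IntZ; [|by contin].
    by rewrite e1 mulr0 subr0.
  by move=> x _; ring.
(* The adjoint of A maps g to 2c x g. *)
have Afg : I (fun x => (f' x + c * x * f x) * g x) = 2 * c * th.
  rewrite /th -IntZ; [|by contin]; apply/eqP; rewrite -subr_eq0 -IntB; [|by contin..].
  rewrite (@Rintegral_derive _ _ _ (fun x => f x * g x))//.
  - by rewrite fa fb !mul0r subrr.
  - move=> x xab; apply: (is_derive_eq (derM (df _ xab) (dg xab))).
    by ring.
  - by contin.
have Af : I (fun x => (f' x + c * x * f x) ^+ 2) =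
    I (fun x => f' x ^+ 2 + c ^+ 2 * (x * f x) ^+ 2 - c * f x ^+ 2).
  apply/eqP; rewrite -subr_eq0 -IntB; [|by contin..].
  rewrite (@Rintegral_derive _ _ _ (fun x => c * (x * f x ^+ 2)))//.
  - by rewrite fa fb expr0n/= !mulr0 subrr.
  - move=> x xab.
    apply: (is_derive_eq (derZ c (derM (is_derive_id x 1)
      (derM (df _ xab) (df _ xab))))).
    by ring.
  - by contin.
rewrite hg -Af => h1.
have := adjoint_commutation dh ch' ha hb.
set q := th / gam.
(* The coefficients come from the whole line, where this combination vanishes if [f] is on the level
   2c above the ground (A f = 2c h and q g = h) or on the level 4c above it (A f = 4c h and q = 0).
   Hence nothing is lost on these two levels. *)
have := Int_sq_ge0 a b (fun x => f' x + c * x * f x - 4 * c * h x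
  + 2 * c * q * g x).
rewrite (@eq_Int _ _ _ _ (fun x => (f' x + c * x * f x) ^+ 2
   + 16 * c ^+ 2 * h x ^+ 2 + 4 * c ^+ 2 * q ^+ 2 * g x ^+ 2
   - 8 * c * (h x * (f' x + c * x * f x))
   + 4 * c * q * ((f' x + c * x * f x) * g x)
   - 16 * c ^+ 2 * q * (h x * g x))); last by move=> x _; ring.
rewrite IntB; [|by contin..].
rewrite IntD; [|by contin..].
rewrite IntB; [|by contin..].
do 2 (rewrite IntD; [|by contin..]).
rewrite !IntZ; [|by contin..].
rewrite hg Afg E2 -/gam; move: h1.
have -> : th ^+ 2 / gam = q * th by rewrite /q; ring.
have -> : 4 * c ^+ 2 * th ^+ 2 / gam = 4 * c ^+ 2 * (q * th) by rewrite /q; ring.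
have -> : 4 * c ^+ 2 * q ^+ 2 * gam = 4 * c ^+ 2 * (q * th).
  by rewrite /q; field; rewrite gt_eqF.
move=> h1 h2 h3.
have := ler_wpM2l c2 h1.
move: h2; rewrite h3 => h2 h4.
by lra.
Qed.

End free_gap_interval.

(** * Square-integrable functions and Bessel's identity *)

Section square_integrable.
Context d (T : measurableType d) (R : realType) (mu : {measure set T -> \bar R}).
Implicit Types (f g h : T -> R).

Definition L2 f : Prop := measurable_fun setT f /\
  mu.-integrable setT (EFin \o (fun x => f x ^+ 2)).

Definition ip f g : R := \int[mu]_x (f x * g x).

Lemma integrable_le f g : measurable_fun setT f ->
  mu.-integrable setT (EFin \o g) -> (forall x, `|f x| <= g x) ->
  mu.-integrable setT (EFin \o f).
Proof.
move=> mf ig fg; apply: le_integrable ig => //.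
  exact/measurable_EFinP.
by move=> x _ /=; rewrite lee_fin (le_trans (fg x))// ler_norm.
Qed.

Lemma integrable_addR f g : mu.-integrable setT (EFin \o f) ->
  mu.-integrable setT (EFin \o g) ->
  mu.-integrable setT (EFin \o (fun x => f x + g x)).
Proof.
move=> mf mg; rewrite (_ : EFin \o _ = (EFin \o f) \+ (EFin \o g))%E//.
exact: integrableD.
Qed.

Lemma integrable_scaleR k f : mu.-integrable setT (EFin \o f) ->
  mu.-integrable setT (EFin \o (fun x => k * f x)).
Proof.
move=> mf.
rewrite (_ : EFin \o _ = (fun x => k%:E * (EFin \o f) x))%E//.
exact: integrableZl.
Qed.

Lemma integrable_meas f : mu.-integrable setT (EFin \o f) ->
  measurable_fun setT f.
Proof. by move=> /measurable_int /measurable_EFinP. Qed.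

Lemma L2_integrableM f g : L2 f -> L2 g ->
  mu.-integrable setT (EFin \o (fun x => f x * g x)).
Proof.
move=> [mf if2] [mg ig2].
apply: (@integrable_le _ (fun x => f x ^+ 2 + g x ^+ 2)).
- exact: measurable_funM.
- exact: integrable_addR.
- move=> x; rewrite normrM -[f x ^+ 2]real_normK ?num_real//.
  rewrite -[g x ^+ 2]real_normK ?num_real//.
  have := sqr_ge0 (`|f x| - `|g x|).
  by have := normr_ge0 (f x); have := normr_ge0 (g x); nra.
Qed.

Lemma L2_cst0 : L2 (fun=> 0).
Proof.
split; first exact: measurable_cst.
by under eq_fun do rewrite expr0n/=; exact: integrable0.
Qed.

Lemma L2D f g : L2 f -> L2 g -> L2 (fun x => f x + g x).
Proof.
move=> Lf Lg; have [mf if2] := Lf; have [mg ig2] := Lg.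
split; first exact: measurable_funD.
rewrite (_ : (fun x => _) =
  (fun x => (f x ^+ 2 + g x ^+ 2) + 2 * (f x * g x))); last first.
  by apply/funext => x; ring.
apply: integrable_addR; first exact: integrable_addR.
by apply: integrable_scaleR; exact: L2_integrableM.
Qed.

Lemma L2Z k f : L2 f -> L2 (fun x => k * f x).
Proof.
move=> [mf if2]; split; first exact: measurable_funM.
rewrite (_ : (fun x => _) = (fun x => k ^+ 2 * f x ^+ 2)).
  exact: integrable_scaleR.
by apply/funext => x; rewrite exprMn.
Qed.

Lemma L2B f g : L2 f -> L2 g -> L2 (fun x => f x - g x).
Proof.
move=> Lf Lg; rewrite (_ : (fun x => _) = (fun x => f x + (-1) * g x)).
  exact/L2D/L2Z.
by apply/funext => x; rewrite mulN1r.
Qed.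

Lemma L2_sum (I : Type) (r : seq I) (P : pred I) (F : I -> T -> R) :
  (forall i, L2 (F i)) -> L2 (fun x => \sum_(i <- r | P i) F i x).
Proof.
move=> LF; elim: r => [|i r IH].
  by under eq_fun do rewrite big_nil; exact: L2_cst0.
under eq_fun do rewrite big_cons; case: (P i) => //.
exact: L2D.
Qed.

Lemma ipC f g : ip f g = ip g f.
Proof. by rewrite /ip; under eq_Rintegral do rewrite mulrC. Qed.

Lemma ipDl f g h : L2 f -> L2 g -> L2 h ->
  ip (fun x => f x + g x) h = ip f h + ip g h.
Proof.
move=> Lf Lg Lh; rewrite /ip -RintegralD//; [|exact: L2_integrableM..].
by under eq_Rintegral do rewrite mulrDl.
Qed.

Lemma ipZl k f h : L2 f -> L2 h -> ip (fun x => k * f x) h = k * ip f h.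
Proof.
move=> Lf Lh; rewrite /ip -RintegralZl//; last exact: L2_integrableM.
by under eq_Rintegral do rewrite -mulrA.
Qed.

Lemma ipBl f g h : L2 f -> L2 g -> L2 h ->
  ip (fun x => f x - g x) h = ip f h - ip g h.
Proof.
move=> Lf Lg Lh; rewrite /ip -RintegralB//; [|exact: L2_integrableM..].
by under eq_Rintegral do rewrite mulrBl.
Qed.

Lemma ipDr f g h : L2 f -> L2 g -> L2 h ->
  ip h (fun x => f x + g x) = ip h f + ip h g.
Proof. by move=> *; rewrite ipC ipDl// ipC (ipC g). Qed.

Lemma ipBr f g h : L2 f -> L2 g -> L2 h ->
  ip h (fun x => f x - g x) = ip h f - ip h g.
Proof. by move=> *; rewrite ipC ipBl// ipC (ipC g). Qed.

Lemma ipZr k f h : L2 f -> L2 h -> ip h (fun x => k * f x) = k * ip h f.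
Proof. by move=> *; rewrite ipC ipZl// ipC. Qed.

Lemma ip0l g : ip (fun=> 0) g = 0.
Proof.
rewrite /ip; under eq_Rintegral do rewrite mul0r.
by rewrite Rintegral_cst ?mul0r.
Qed.

Lemma ip_suml (I : Type) (r : seq I) (F : I -> T -> R) h :
  (forall i, L2 (F i)) -> L2 h ->
  ip (fun x => \sum_(i <- r) F i x) h = \sum_(i <- r) ip (F i) h.
Proof.
move=> LF Lh; elim: r => [|i r IH].
  by rewrite big_nil; under eq_fun do rewrite big_nil; exact: ip0l.
rewrite big_cons; under eq_fun do rewrite big_cons.
by rewrite ipDl// ?IH//; exact: L2_sum.
Qed.

Lemma ip_sq f : ip f f = \int[mu]_x (f x ^+ 2).
Proof. by apply: eq_Rintegral => x _. Qed.

Lemma ip_ge0 f : 0 <= ip f f.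
Proof. by rewrite ip_sq; apply: Rintegral_ge0 => x _; exact: sqr_ge0. Qed.

Lemma ip_sqB f g : L2 f -> L2 g ->
  ip (fun x => f x - g x) (fun x => f x - g x) = ip f f - 2 * ip f g + ip g g.
Proof.
move=> Lf Lg; have LB := L2B Lf Lg.
by rewrite ipBl// !ipBr// (ipC g f); ring.
Qed.

Lemma ip_CauchySchwarz f g : L2 f -> L2 g ->
  ip f g ^+ 2 <= ip f f * ip g g.
Proof.
move=> Lf Lg.
have H t : 0 <= ip f f - 2 * (t * ip f g) + t ^+ 2 * ip g g.
  have Lt : L2 (fun x => t * g x) by exact: L2Z.
  have := ip_ge0 (fun x => f x - t * g x).
  rewrite ip_sqB// ipZr// ipZr// ipZl// => ?.
  by rewrite expr2 -mulrA.
have g0 := ip_ge0 g; have f0 := ip_ge0 f.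
have [gg0|gg0] := eqVneq (ip g g) 0.
  rewrite gg0 mulr0; have [->|fg0] := eqVneq (ip f g) 0; first by rewrite expr0n.
  (* If |g| = 0 the quadratic is affine in t, and this t gives it the value -1. *)
  have := H ((ip f f + 1) / (2 * ip f g)); rewrite gg0 mulr0 addr0.
  rewrite (_ : _ * _ = ip f f + 1); last by field.
  by rewrite opprD addrA subrr sub0r oppr_ge0 ler10.
have := H (ip f g / ip g g).
rewrite (_ : _ + _ = ip f f - ip f g ^+ 2 / ip g g); last by field.
by rewrite subr_ge0 ler_pdivrMr// lt_neqAle eq_sym gg0.
Qed.

Section bessel.
Variables (I : finType) (e : I -> T -> R).
Hypothesis Le : forall i, L2 (e i).

(* Either unit vectors or zero functions, so that a single index set serves
   the half-line directions, which have no first excited level. *)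
Definition orthosystem : Prop :=
  (forall i j, i != j -> ip (e i) (e j) = 0) /\
  (forall i, ip (e i) (e i) = 1 \/ e i = (fun=> 0)).

Hypothesis He : orthosystem.

Lemma orthosystem_coef f i j :
  ip f (e i) * ip (e i) (e j) = if i == j then ip f (e i) else 0.
Proof.
have [He1 He2] := He; case: eqVneq => [<-|ij]; last by rewrite He1// mulr0.
by case: (He2 i) => [->|->]; [rewrite mulr1|rewrite ipC ip0l mul0r].
Qed.

Let proj f x := \sum_i ip f (e i) * e i x.

Let Lproj f : L2 (proj f).
Proof. by apply: L2_sum => i; exact: L2Z. Qed.

Lemma ip_proj f j : ip (proj f) (e j) = ip f (e j).
Proof.
rewrite /proj ip_suml//; last by move=> i; exact: L2Z.
under eq_bigr do rewrite ipZl// orthosystem_coef.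
by rewrite -big_mkcond/= big_pred1_eq.
Qed.

Lemma bessel_id f : L2 f ->
  ip (fun x => f x - proj f x) (fun x => f x - proj f x) =
  ip f f - \sum_i ip f (e i) ^+ 2.
Proof.
move=> Lf; rewrite ip_sqB//.
have H g : L2 g -> ip (proj f) g = \sum_i ip f (e i) * ip g (e i).
  move=> Lg; rewrite /proj ip_suml//; last by move=> i; exact: L2Z.
  by apply: eq_bigr => i _; rewrite ipZl// (ipC g).
have S : \sum_i ip f (e i) * ip f (e i) = \sum_i ip f (e i) ^+ 2.
  by apply: eq_bigr => i _; rewrite expr2.
have E1 : ip f (proj f) = \sum_i ip f (e i) ^+ 2 by rewrite ipC H// S.
have E2 : ip (proj f) (proj f) = \sum_i ip f (e i) ^+ 2.
  by rewrite H// -S; apply: eq_bigr => i _; rewrite ip_proj.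
by rewrite E1 E2; ring.
Qed.

Lemma bessel f : L2 f -> \sum_i ip f (e i) ^+ 2 <= ip f f.
Proof. by move=> Lf; rewrite -subr_ge0 -bessel_id// ip_ge0. Qed.

End bessel.

End square_integrable.

Section linear_combinations.
Context d (T : measurableType d) (R : realType) (mu : {measure set T -> \bar R}).

Lemma integrable_sumR (I : Type) (r : seq I) (F : I -> T -> R) :
  (forall i, mu.-integrable setT (EFin \o F i)) ->
  mu.-integrable setT (EFin \o (fun x => \sum_(i <- r) F i x)).
Proof.
move=> iF; elim: r => [|i r IH].
  by under eq_fun do rewrite big_nil; exact: integrable0.
by under eq_fun do rewrite big_cons; exact: integrable_addR.
Qed.

Lemma Rintegral_sumR (I : Type) (r : seq I) (F : I -> T -> R) :
  (forall i, mu.-integrable setT (EFin \o F i)) ->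
  \int[mu]_x (\sum_(i <- r) F i x) = \sum_(i <- r) \int[mu]_x F i x.
Proof.
move=> iF; elim: r => [|i r IH].
  rewrite big_nil; under eq_Rintegral do rewrite big_nil.
  by rewrite Rintegral_cst ?mul0r.
rewrite big_cons; under eq_Rintegral do rewrite big_cons.
by rewrite RintegralD// ?IH//; exact: integrable_sumR.
Qed.

(** Serves to integrate a gap inequality valid in every slice; the pairs are the coefficients and
    the integrands of its terms. *)
Lemma Rintegral_lincomb_ge0 (r : seq (R * (T -> R))) :
  foldr (fun p P => mu.-integrable setT (EFin \o p.2) /\ P) True r ->
  (forall x, 0 <= \sum_(p <- r) p.1 * p.2 x) ->
  0 <= \sum_(p <- r) p.1 * \int[mu]_x p.2 x.
Proof.
move=> ir h; have [_ <-] : mu.-integrable setT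
    (EFin \o (fun x => \sum_(p <- r) p.1 * p.2 x)) /\
    \int[mu]_x (\sum_(p <- r) p.1 * p.2 x) = \sum_(p <- r) p.1 * \int[mu]_x p.2 x.
  elim: r ir {h} => [|p r IH] /=.
    under eq_fun do rewrite big_nil; split; first exact: integrable0.
    by rewrite big_nil Rintegral_cst ?mul0r.
  move=> [ip /IH[ir Er]].
  have ip' := integrable_scaleR p.1 ip.
  under eq_fun do rewrite big_cons; split; first exact: integrable_addR.
  by rewrite big_cons RintegralD// Er RintegralZl.
by apply: Rintegral_ge0 => x _; exact: h.
Qed.

End linear_combinations.

Section almost_everywhere.
Context d (T : measurableType d) (R : realType) (mu : {measure set T -> \bar R}).

Lemma ip_eq0_ae (f : T -> R) : L2 mu f -> ip mu f f = 0 ->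
  {ae mu, forall x, f x = 0}.
Proof.
move=> [mf iff]; rewrite ip_sq => h.
have h0 : (\int[mu]_x (f x ^+ 2)%:E = 0)%E.
  rewrite -[LHS]fineK; first by rewrite -/(Rintegral _ _ _) h.
  exact: integrable_fin_num.
have : (\int[mu]_x `|(f x ^+ 2)%:E| = 0)%E.
  by under eq_integral do rewrite gee0_abs ?lee_fin ?sqr_ge0//.
move/(ae_eq_integral_abs mu measurableT (measurable_int _ iff)).
by apply: filterS => x /= /(_ I) [] /eqP; rewrite sqrf_eq0 => /eqP.
Qed.

Lemma ae_eq_ip (f g h : T -> R) : measurable_fun setT f -> measurable_fun setT g ->
  measurable_fun setT h -> {ae mu, forall x, f x = g x} -> ip mu f h = ip mu g h.
Proof.
move=> mf mg mh fg; congr fine; apply: ae_eq_integral => //.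
- by apply/measurable_EFinP; exact: measurable_funM.
- by apply/measurable_EFinP; exact: measurable_funM.
- by move: fg; apply: filterS => x fgx _ /=; rewrite fgx.
Qed.

End almost_everywhere.

(** * Gaussian levels on the line and the half-line *)

Section exhaustion.
Context d (T : measurableType d) (R : realType) (mu : {measure set T -> \bar R}).

(** Dominated convergence, with |F| as the dominating function. The sets only have to exhaust the
    points where [F] is nonzero, so that intervals inside the half-line suffice for functions
    supported there. *)
Lemma cvg_Rintegral_exhaustion (F : T -> R) (A : (set T)^nat) :
  mu.-integrable setT (EFin \o F) -> (forall n, measurable (A n)) ->
  (forall x, F x != 0 -> \forall n \near \oo, A n x) ->
  \int[mu]_(x in A n) F x @[n --> \oo] --> \int[mu]_x F x.
Proof.
move=> iF mA FA.
have mF := integrable_meas iF.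
have [|||||_ _ h] := @dominated_convergence _ _ _ mu setT measurableT
    (fun n => EFin \o (F \_ (A n))) (EFin \o F) (EFin \o (fun x => `|F x|)).
- move=> n; apply/measurable_EFinP; apply/measurable_restrict => //.
  by rewrite setTI; exact: measurable_funTS.
- exact/measurable_EFinP.
- apply: aeW => x _; apply: cvg_near_cst.
  have [F0|/FA] := eqVneq (F x) 0.
    by apply: nearW => n /=; rewrite patchE F0; case: ifP.
  by apply: filterS => n An /=; rewrite patchE mem_set.
- exact: integrable_norm.
- apply: aeW => x n _ /=; rewrite lee_fin patchE; case: ifP => // _.
  by rewrite normr0.
have fF : (\int[mu]_x (EFin \o F) x)%E = (\int[mu]_x F x)%:E.
  by rewrite /Rintegral fineK//; exact: integrable_fin_num.
rewrite fF in h.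
rewrite (_ : (fun n => _) = fine \o (fun n => \int[mu]_x (EFin \o F \_ (A n)) x)%E).
  exact: fine_cvg h.
by apply/funext => n /=; rewrite Rintegral_mkcond.
Qed.

End exhaustion.

(** * Gaussian moments on the line *)

Section gaussian_integrals.
Context (R : realType).
Local Notation leb := (@lebesgue_measure R).
Implicit Types (c x : R).

Lemma gauss_add c c' x : gauss c x * gauss c' x = gauss (c + c') x.
Proof. by rewrite /gauss -expRD; congr expR; field. Qed.

Lemma gauss_le1 c x : 0 <= c -> gauss c x <= 1.
Proof.
move=> c0; rewrite /gauss -expR0 ler_expR oppr_le0.
by rewrite mulr_ge0 ?sqr_ge0// divr_ge0.
Qed.

Lemma measurable_gauss c : measurable_fun setT (gauss c).
Proof. by apply: continuous_measurable_fun; exact: continuous_gauss. Qed.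

Lemma integrable_gauss c : 0 < c -> leb.-integrable setT (EFin \o gauss c).
Proof.
(* The standard deviation for which the normal density is proportional to [gauss c]. *)
move=> c0; pose s := (Num.sqrt c)^-1.
have s0 : s != 0 by rewrite invr_eq0 gt_eqF// sqrtr_gt0.
have := @integrable_normal_pdf R 0 s; rewrite normal_pdfE// => h.
rewrite (_ : gauss c = fun x => (normal_peak s)^-1 * (normal_peak s * normal_fun 0 s x)).
  exact: integrable_scaleR.
apply/funext => x; rewrite mulrA mulVf ?mul1r; last by rewrite gt_eqF// normal_peak_gt0.
rewrite /gauss /normal_fun subr0 /s exprVn sqr_sqrtr ?ltW//; congr expR.
by rewrite -mulr_natr; field; rewrite gt_eqF.
Qed.

(** With y = c x^2 / 4, the bound y <= exp y lets half of the Gaussian absorb the factor x^2. *)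
Lemma sq_gauss_le c x : 0 < c -> x ^+ 2 * gauss c x <= 4 / c * gauss (c / 2) x.
Proof.
move=> c0; rewrite [X in gauss X](_ : c = c / 2 + c / 2); last by field.
rewrite -gauss_add mulrA ler_wpM2r//; first exact/ltW/gauss_gt0.
rewrite /gauss expRN (_ : c / 2 / 2 = c / 4); last by field.
have := expR_ge1Dx (c / 4 * x ^+ 2); set E := expR _ => hE.
have E0 : 0 < E by exact: expR_gt0.
rewrite ler_pdivrMr// (_ : x ^+ 2 = 4 / c * (c / 4 * x ^+ 2)).
  by rewrite ler_wpM2l ?divr_ge0 ?ltW//; lra.
by field; rewrite gt_eqF.
Qed.

Lemma integrable_sq_gauss c : 0 < c ->
  leb.-integrable setT (EFin \o (fun x => x ^+ 2 * gauss c x)).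
Proof.
move=> c0; apply: (@integrable_le _ _ _ leb _ (fun x => 4 / c * gauss (c / 2) x)).
- by apply: measurable_funM; [exact: measurable_funX|exact: measurable_gauss].
- by apply/integrable_scaleR/integrable_gauss; rewrite divr_gt0.
- move=> x; rewrite ger0_norm; first exact: sq_gauss_le.
  by rewrite mulr_ge0 ?sqr_ge0// ltW// gauss_gt0.
Qed.

Lemma integrable_id_gauss c : 0 < c ->
  leb.-integrable setT (EFin \o (fun x => x * gauss c x)).
Proof.
move=> c0; apply: (@integrable_le _ _ _ leb _ (fun x => gauss c x + x ^+ 2 * gauss c x)).
- by apply: measurable_funM => //; exact: measurable_gauss.
- by apply: integrable_addR; [exact: integrable_gauss|exact: integrable_sq_gauss].
- move=> x; rewrite normrM (gtr0_norm (gauss_gt0 _ _)).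
  rewrite -[X in _ <= X + _]mul1r -mulrDl ler_wpM2r ?(ltW (gauss_gt0 _ _))//.
  by rewrite -real_normK ?num_real//; have := sqr_ge0 (`|x| - 1); nra.
Qed.

Let exh : forall x : R, \forall n \near \oo, x \in `[- n.+1%:R, n.+1%:R].
Proof.
move=> x; near=> n; rewrite in_itv/= -ler_norml.
rewrite (@le_trans _ _ n%:R) ?ler_nat//.
by near: n; exact: nbhs_infty_ger.
Unshelve. all: by end_near. Qed.

Let cvg_sym F : leb.-integrable setT (EFin \o F) ->
  \int[leb]_(x in `[- n.+1%:R, n.+1%:R]) F x @[n --> \oo] --> \int[leb]_x F x.
Proof.
move=> iF.
by apply: cvg_Rintegral_exhaustion => // x _; have := exh x; apply: filterS.
Qed.

Lemma integral_id_gauss c : 0 < c -> \int[leb]_x (x * gauss c x) = 0.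
Proof.
move=> c0; have := cvg_sym (integrable_id_gauss c0).
rewrite (_ : (fun n => _) = cst 0); last first.
  apply/funext => n.
  rewrite (@Rintegral_derive _ _ _ (fun x => - c^-1 * gauss c x)).
  - by rewrite /gauss sqrrN subrr.
  - by rewrite gtrN.
  - move=> x _; apply: (is_derive_eq (derZ _ (is_derive_gauss c x))).
    by field; rewrite gt_eqF.
  - have cg : contin (- n.+1%:R) n.+1%:R (gauss c).
      by move=> x _; exact: continuous_gauss.
    by contin.
by move=> /(cvg_lim (@Rhausdorff R)) <-; rewrite lim_cst.
Qed.

(** The derivative of x exp(- c x^2 / 2) is (1 - c x^2) exp(- c x^2 / 2). The boundary terms at n +
    1 and - (n + 1) are at most (8 / c) / (n + 1) in total, by [sq_gauss_le]. *)
Lemma integral_sq_gauss c : 0 < c ->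
  c * \int[leb]_x (x ^+ 2 * gauss c x) = \int[leb]_x gauss c x.
Proof.
move=> c0.
have i1 := integrable_gauss c0; have i2 := integrable_sq_gauss c0.
have i3 := integrable_scaleR (- c) i2.
have := cvg_sym (integrable_addR i1 i3).
rewrite RintegralD// RintegralZl//.
rewrite (_ : (fun n => _) = (fun n : nat => 2 * (n.+1%:R * gauss c n.+1%:R))); last first.
  apply/funext => n.
  rewrite (@Rintegral_derive _ _ _ (fun x => x * gauss c x)).
  - by rewrite /gauss sqrrN; ring.
  - by rewrite gtrN.
  - move=> x _; apply: (is_derive_eq (derM (is_derive_id x 1) (is_derive_gauss c x))).
    by ring.
  - have cg : contin (- n.+1%:R) n.+1%:R (gauss c).
      by move=> x _; exact: continuous_gauss.
    by contin.
move=> h1.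
have h2 : (2 * (n.+1%:R * gauss c n.+1%:R) : R) @[n --> \oo] --> (0 : R).
  apply: (@squeeze_cvgr _ _ _ _ (fun=> 0) (fun n => 8 / c * harmonic n)).
  - apply: nearW => n; rewrite !mulr_ge0//=; last exact/ltW/gauss_gt0.
    have n0 : 0 < n.+1%:R :> R by [].
    have c20 : 0 <= c / 2 by rewrite divr_ge0// ltW.
    have e1 := gauss_le1 n.+1%:R c20.
    have e2 : n.+1%:R ^+ 2 * gauss c n.+1%:R <= 4 / c.
      rewrite (le_trans (sq_gauss_le n.+1%:R c0))// ler_piMr//.
      by rewrite divr_ge0// ltW.
    rewrite /harmonic/= (_ : 2 * _ = 2 * (n.+1%:R ^+ 2 * gauss c n.+1%:R) / n.+1%:R).
      rewrite ler_wpM2r// (_ : 8 / c = 2 * (4 / c)) ?ler_wpM2l//.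
      by rewrite mulrA -natrM.
    by field; rewrite gt_eqF.
  - exact: cvg_cst.
  - rewrite -[X in _ --> X](mulr0 (8 / c)); apply: cvgMl_tmp; exact: cvg_harmonic.
move: h1 => /cvg_lim h1; move: h2 => /cvg_lim h2.
have := h1 (@Rhausdorff R); rewrite h2; last exact: Rhausdorff.
by move=> /eqP; rewrite eq_sym mulNr subr_eq0 => /eqP.
Qed.

End gaussian_integrals.

Section compact_support_1D.
Context (R : realType).
Local Notation leb := (@lebesgue_measure R).
Implicit Types (a b x : R) (f g : R -> R).

Lemma Rintegral_support f a b : (forall x, f x != 0 -> x \in `[a, b]) ->
  \int[leb]_x f x = \int[leb]_(x in `[a, b]) f x.
Proof.
move=> fab; rewrite [RHS]Rintegral_mkcond; apply: eq_Rintegral => x _.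
rewrite patchE; case: ifPn => // /negP xab; apply/eqP/negPn/negP => /fab xab'.
by apply: xab; rewrite inE.
Qed.

Lemma integrable_support f a b : continuous f ->
  (forall x, f x != 0 -> x \in `[a, b]) -> leb.-integrable setT (EFin \o f).
Proof.
move=> cf fab.
rewrite (_ : EFin \o f = (EFin \o f) \_ `[a, b]).
  have [|+ _] := @integrable_mkcond _ _ _ leb `[a, b]%classic (EFin \o f) => //.
  by apply; apply: (@cont_in_integrable _ a b f) => x _; exact: cf.
apply/funext => x; rewrite patchE; case: ifPn => //= /negP xab.
congr EFin; apply/eqP/negPn/negP => /fab xab'.
by apply: xab; rewrite inE.
Qed.

Lemma L2_support f a b : continuous f ->
  (forall x, f x != 0 -> x \in `[a, b]) -> L2 leb f.
Proof.
move=> cf fab; split; first exact: continuous_measurable_fun.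
apply: (@integrable_support _ a b).
  by move=> x; apply: continuousM; exact: cf.
by move=> x; rewrite sqrf_eq0; exact: fab.
Qed.

End compact_support_1D.

Section levels.
Context (R : realType) (c : R).
Hypothesis c_gt0 : 0 < c.
Local Notation leb := (@lebesgue_measure R).
Implicit Types (b : bool) (x : R) (f g : R -> R).

(* [b] tells a half-line (Dirichlet at 0) from a line.  The levels are
   normalized in L2 of the (half-)line; the second Dirichlet level lies 4c above
   the ground level, hence outside the first-level window 2c, and is replaced
   by 0. *)
Definition ground (k : R) b x : R :=
  if b then (if 0 < x then dirichlet_gauss k x else 0) else gauss k x.

Definition level0 b x : R :=
  ground c b x / Num.sqrt (ip leb (ground c b) (ground c b)).

Definition level1 b x : R :=
  if b then 0 else Num.sqrt (2 * c) * (x * level0 false x).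

Definition level (i : bool) b : R -> R := if i then level1 b else level0 b.

Lemma L2_gauss k : 0 < k -> L2 leb (gauss k).
Proof.
move=> k0; split; first exact: measurable_gauss.
rewrite (_ : (fun x => _) = gauss (k + k)).
  by apply: integrable_gauss; rewrite addr_gt0.
by apply/funext => x; rewrite -gauss_add.
Qed.

Lemma L2_id_gauss k : 0 < k -> L2 leb (fun x => x * gauss k x).
Proof.
move=> k0; split.
  by apply: measurable_funM => //; exact: measurable_gauss.
rewrite (_ : (fun x => _) = (fun x => x ^+ 2 * gauss (k + k) x)).
  by apply: integrable_sq_gauss; rewrite addr_gt0.
by apply/funext => x; rewrite -gauss_add; ring.
Qed.

Lemma L2_ground k b : 0 < k -> L2 leb (ground k b).
Proof.
move=> k0; case: b; last exact: L2_gauss.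
have [mg ig] := L2_id_gauss k0.
rewrite (_ : ground k true = (fun x => x * gauss k x) \_ [set x | 0 < x]); last first.
  apply/funext => x; rewrite /ground patchE; case: ifPn => x0.
    by rewrite mem_set.
  by rewrite memNset//; apply/negP.
have m0 : measurable [set x : R | 0 < x].
  by rewrite (_ : [set x | _] = `]0, +oo[%classic)// set_itvE.
have mp : measurable_fun setT ((fun x => x * gauss k x) \_ [set x | 0 < x]).
  by apply/measurable_restrict => //; rewrite setTI; exact: measurable_funTS.
split=> //; apply: (@integrable_le _ _ _ leb _ (fun x => (x * gauss k x) ^+ 2)).
- exact: measurable_funX.
- exact: ig.
- move=> x; rewrite patchE; case: ifP => _; rewrite ger0_norm ?sqr_ge0//.
  by rewrite expr0n sqr_ge0.
Qed.

Lemma ground_gt0 k b x : 0 < x -> 0 < ground k b x.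
Proof.
move=> x0; case: b; rewrite /ground ?gauss_gt0// x0.
by rewrite mulr_gt0// gauss_gt0.
Qed.

(** A vanishing norm would make the function zero almost everywhere, although it is positive on
    [1, 2]. *)
Lemma ip_ground_gt0 k b : 0 < k -> 0 < ip leb (ground k b) (ground k b).
Proof.
move=> k0; rewrite lt_neqAle ip_ge0 andbT; apply/eqP => /esym h.
have [A [mA A0 hA]] := ip_eq0_ae (L2_ground b k0) h.
have : (leb `[1%R, 2%R]%classic <= leb A)%E.
  apply: le_measure; rewrite ?inE// => x; rewrite /= in_itv/= => /andP[x1 _].
  by apply: hA => /=; apply/eqP; rewrite gt_eqF// ground_gt0// (lt_le_trans _ x1).
rewrite A0 lebesgue_measure_itv/= lte_fin ltr1n leNgt -EFinD lte_fin.
by rewrite subr_gt0 ltr1n.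
Qed.

Let nrm b := ip leb (ground c b) (ground c b).

Let nrm_gt0 b : 0 < nrm b. Proof. exact: ip_ground_gt0. Qed.

Lemma level0E b : level0 b = fun x => (Num.sqrt (nrm b))^-1 * ground c b x.
Proof. by apply/funext => x; rewrite /level0 mulrC. Qed.

Lemma level1E : level1 false =
  fun x => Num.sqrt (2 * c) / Num.sqrt (nrm false) * (x * gauss c x).
Proof. by apply/funext => x; rewrite /level1 level0E/=; ring. Qed.

Lemma L2_level i b : L2 leb (level i b).
Proof.
case: i => /=; last by rewrite level0E; apply/L2Z/L2_ground.
case: b; first exact: L2_cst0.
by rewrite level1E; apply/L2Z/L2_id_gauss.
Qed.

Let sqrV b : (Num.sqrt (nrm b))^-1 ^+ 2 = (nrm b)^-1.
Proof. by rewrite exprVn sqr_sqrtr// ltW. Qed.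

(** An odd function against an even one. The scale [k] is independent of [c] because the distance is
    taken to Gaussians of every scale. *)
Lemma level1_ground k b : 0 < k -> ip leb (level1 b) (ground k b) = 0.
Proof.
move=> k0; case: b; first by rewrite ip0l.
rewrite level1E ipZl; [|exact: L2_id_gauss|exact: L2_ground].
rewrite [ip _ _ _](_ : _ = \int[leb]_x (x * gauss (c + k) x)).
  by rewrite integral_id_gauss ?mulr0// addr_gt0.
by apply: eq_Rintegral => x _; rewrite /= -gauss_add mulrA.
Qed.

(** The first level on the line has unit norm by the second moment of [gauss (2 * c)], which is 1 /
    (2c) times its mass; this is the origin of the factor sqrt (2c) in [level1]. *)
Lemma level_orthosystem b : orthosystem leb (fun i => level i b).
Proof.
have o10 : ip leb (level1 b) (level0 b) = 0.
  rewrite level0E ipZr; [|exact: L2_ground|exact: (L2_level true)].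
  by rewrite level1_ground// mulr0.
split; first by case=> -[]//= _; rewrite ipC.
case=> /=.
  case: b {o10}; [by right|left]; rewrite level1E.
  have L := L2_id_gauss c_gt0.
  rewrite ipZl; [|exact: L|exact: L2Z]; rewrite ipZr//.
  have c2 : 0 < 2 * c by rewrite mulr_gt0.
  set w := ip _ _ _.
  have e1 : \int[leb]_x gauss (2 * c) x = nrm false.
    by apply: eq_Rintegral => x _; rewrite /ground gauss_add mulr_natl mulr2n.
  have e2 : \int[leb]_x (x ^+ 2 * gauss (2 * c) x) = w.
    apply: eq_Rintegral => x _; rewrite (_ : 2 * c = c + c); last by ring.
    by rewrite -gauss_add; ring.
  have := integral_sq_gauss c2; rewrite e1 e2 => h.
  rewrite mulrA -expr2 exprMn sqrV sqr_sqrtr ?ltW// mulrAC h divff//.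
  by rewrite gt_eqF.
left; rewrite level0E.
rewrite ipZl; [|exact: L2_ground|exact/L2Z/L2_ground].
rewrite ipZr; [|exact: L2_ground|exact: L2_ground].
by rewrite mulrA -expr2 sqrV mulVf// gt_eqF.
Qed.

Section gap.
Variables (b : bool) (f f' : R -> R) (e N : R).
Hypotheses (df : forall x, is_derive x 1 f (f' x)) (cf' : continuous f').
Hypotheses (e_gt0 : 0 < e).
Hypothesis supp_f : forall x, f x != 0 -> `|x| <= N /\ (b -> e <= x).
Hypothesis supp_f' : forall x, f' x != 0 -> `|x| <= N /\ (b -> e <= x).

(** On the half-line the left end 1 / (n + 1) stays positive, away from the singularity of 1/x. *)
Let lo n : R := if b then harmonic n else - n.+1%:R.
Let up n : R := n.+1%:R.

Let exh : \forall n \near \oo, e > harmonic n /\ N < n.+1%:R.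
Proof.
near=> n; split.
  near: n; have := @cvg_harmonic R => /cvgr_lt; exact.
rewrite (@le_lt_trans _ _ n%:R) ?ltr_nat//.
by near: n; exact: nbhs_infty_ger.
Unshelve. all: by end_near. Qed.

Let lo_up n : (0 < n)%N -> lo n < up n.
Proof.
move=> n0; rewrite /lo /up; case: ifP => _; last by rewrite gtrN.
by rewrite /harmonic/= (@lt_trans _ _ 1)// ?invf_lt1// ltr1n ltnS.
Qed.

Let supp_in n g : e > harmonic n -> N < n.+1%:R ->
  (forall x, g x != 0 -> `|x| <= N /\ (b -> e <= x)) ->
  forall x, g x != 0 -> x \in `[lo n, up n].
Proof.
move=> en Nn hg x /hg[]; rewrite ler_norml => /andP[x1 x2] ex.
rewrite in_itv/= /lo /up (le_trans x2 (ltW Nn)) andbT.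
case: b ex => [/(_ isT)|_]; first exact/le_trans/ltW.
by rewrite (le_trans _ x1)// lerN2 ltW.
Qed.

Let ends0 n : e > harmonic n -> N < n.+1%:R -> f (lo n) = 0 /\ f (up n) = 0.
Proof.
move=> en Nn; split; apply/eqP/negPn/negP => /supp_f[].
  rewrite ler_norml => /andP[x1 x2] ex; move: x1 x2 ex; rewrite /lo.
  case: b => [_ _ /(_ isT)|]; first by rewrite leNgt en.
  by rewrite lerN2 leNgt Nn.
by rewrite ler_norml => /andP[_]; rewrite leNgt /up Nn.
Qed.

Let cf : continuous f. Proof. by move=> x; exact: is_derive_cont (df x). Qed.

Let gn n := \int[leb]_(x in `[lo n, up n]) (ground c b x ^+ 2).

Let cvg_gn : gn n @[n --> \oo] --> nrm b.
Proof.
rewrite /nrm ip_sq; apply: cvg_Rintegral_exhaustion => //.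
  by have [] := L2_ground b c_gt0.
move=> x; rewrite sqrf_eq0 => gx.
have x0 : b -> 0 < x.
  by move: gx; rewrite /ground; case: b => [|//]; case: ifP => //; rewrite eqxx.
have hx : \forall n \near \oo, b -> harmonic n <= x.
  move: x0; case: (b) => [/(_ isT) x0|_]; last by apply: nearW.
  have := @cvg_harmonic R => /cvgr_le /(_ _ x0).
  by apply: filterS.
near=> n; rewrite /= in_itv/=; apply/andP; split; last first.
  rewrite /up (@le_trans _ _ n%:R) ?ler_nat//.
  by near: n; exact: nbhs_infty_ger.
rewrite /lo; case: ifP => [hb|_].
  by move: hb; near: n.
rewrite -[_ *- _]/(- _) lerNl (@le_trans _ _ n%:R) ?ler_nat//.
by near: n; exact: nbhs_infty_ger.
Unshelve. all: by end_near. Qed.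

(** For large n the interval contains the support of [f], so the interval estimates apply and every
    integral involving [f] has its final value. Only the mass [gn n] of the squared Gaussian still
    depends on n, and it converges to the full norm. *)
Lemma spectral_gap_1D :
  4 * c * ip leb f f - 4 * c * ip leb f (level0 b) ^+ 2
    - 2 * c * ip leb f (level1 b) ^+ 2 <=
  ip leb f' f' + c ^+ 2 * ip leb (fun x => x * f x) (fun x => x * f x)
    - c * (1 + 2 * b%:R) * ip leb f f.
Proof.
have Lf : L2 leb f.
  apply: (@L2_support _ _ (- N) N) => // x /supp_f[+ _].
  by rewrite ler_norml in_itv.
have Lf' : L2 leb f'.
  apply: (@L2_support _ _ (- N) N) => // x /supp_f'[+ _].
  by rewrite ler_norml in_itv.
have Lxf : L2 leb (fun x => x * f x).
  apply: (@L2_support _ _ (- N) N).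
    by move=> x; apply: continuousM; [exact|exact: cf].
  by move=> x; rewrite mulf_eq0 negb_or => /andP[_] /supp_f[+ _]; rewrite ler_norml in_itv.
(* The value 0 agrees with the zero function that stands for the first level on the half-line. *)
pose th := if b then 0 else ip leb f (fun x => x * gauss c x).
pose al := ip leb f (ground c b).
have El0 : ip leb f (level0 b) ^+ 2 = al ^+ 2 / nrm b.
  rewrite level0E ipZr//; last exact: L2_ground.
  by rewrite exprMn sqrV mulrC.
have El1 : ip leb f (level1 b) ^+ 2 = 2 * c * th ^+ 2 / nrm b.
  rewrite /th; case: (b) nrm_gt0 => nrm0.
    by rewrite ipC ip0l expr0n/= mulr0 mul0r.
  rewrite level1E ipZr//; last exact: L2_id_gauss.
  by rewrite !exprMn sqrV sqr_sqrtr ?mulr_ge0 ?ltW//; ring.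
rewrite El0 El1.
set X := (X in _ <= X).
have key : \forall n \near \oo, 4 * c * (ip leb f f - al ^+ 2 / gn n)
    - 4 * c ^+ 2 * th ^+ 2 / gn n <= X.
  near=> n.
  have [en Nn] : e > harmonic n /\ N < n.+1%:R by near: n; exact: exh.
  have n0 : (0 < n)%N by near: n; exact: nbhs_infty_gt.
  have [flo fup] := ends0 en Nn.
  have supp := supp_in en Nn.
  have EI g : (forall x, f x = 0 -> f' x = 0 -> g x = 0) ->
      \int[leb]_x g x = \int[leb]_(x in `[lo n, up n]) g x.
    move=> hg; apply: Rintegral_support => x gx.
    have [fx|/(supp _ supp_f)//] := eqVneq (f x) 0.
    have [fx'|/(supp _ supp_f')//] := eqVneq (f' x) 0.
    by rewrite hg// eqxx in gx.
  have EX : X = \int[leb]_(x in `[lo n, up n])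
      (f' x ^+ 2 + c ^+ 2 * (x * f x) ^+ 2 - c * (1 + 2 * b%:R) * f x ^+ 2).
    have [_ i1] := Lf'; have [_ i2] := Lxf; have [_ i3] := Lf.
    rewrite -EI; last first.
      by move=> x -> ->; rewrite !mulr0 !expr0n/= !mulr0 addr0 subr0.
    rewrite RintegralB//; last first.
    - exact: integrable_scaleR.
    - by apply: integrable_addR => //; exact: integrable_scaleR.
    rewrite RintegralD//; last exact: integrable_scaleR.
    by rewrite !RintegralZl// /X !ip_sq.
  have df' : {in `[lo n, up n], forall x, is_derive x 1 f (f' x)}.
    by move=> x _; exact: df.
  have cf'' : contin (lo n) (up n) f' by move=> x _; exact: cf'.
  have E1 : ip leb f f = \int[leb]_(x in `[lo n, up n]) (f x ^+ 2).
    by rewrite ip_sq EI// => x -> _; rewrite expr0n.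
  have E2 : al = \int[leb]_(x in `[lo n, up n]) (f x * ground c b x).
    by rewrite /al /ip EI// => x -> _; rewrite mul0r.
  rewrite EX E1.
  case: (boolP b) => hb.
    have lo0 : 0 < lo n by rewrite /lo hb harmonic_gt0.
    have := dirichlet_gap_interval (lo_up n0) c_gt0 lo0 df' cf'' flo fup.
    have EG : {in `[lo n, up n], dirichlet_gauss c =1 ground c b}.
      move=> x; rewrite in_itv/= => /andP[lx _].
      by rewrite /ground hb (lt_le_trans lo0 lx).
    rewrite (@eq_Int _ _ _ (fun x => f x * dirichlet_gauss c x)
      (fun x => f x * ground c b x)); last by move=> x /EG ->.
    rewrite (@eq_Int _ _ _ (fun x => dirichlet_gauss c x ^+ 2)
      (fun x => ground c b x ^+ 2)); last by move=> x /EG ->.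
    rewrite -E2 -/(gn n) /th hb expr0n/= mulr0 mul0r subr0.
    rewrite (_ : c * (1 + 2 * 1) = 3 * c); last by ring.
    by [].
  have Eup : 0 < up n by rewrite /up.
  have Elo : lo n = - up n by rewrite /lo (negbTE hb).
  have := @free_gap_interval _ c (up n) Eup c_gt0 f f'.
  rewrite -Elo => /(_ df' cf'' flo fup).
  have Eg : ground c b = gauss c by rewrite /ground (negbTE hb).
  rewrite -Eg -E2 -/(gn n) /th (negbTE hb) mulr0 addr0 mulr1.
  by rewrite [ip leb f (fun x => x * _)]EI; last by move=> x -> _; rewrite mul0r.
have cvgV : (gn n)^-1 @[n --> \oo] --> (nrm b)^-1.
  by apply: cvgV => //; rewrite gt_eqF.
have h : (4 * c * (ip leb f f - al ^+ 2 / gn n) - 4 * c ^+ 2 * th ^+ 2 / gn n)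
   @[n --> \oo] --> 4 * c * (ip leb f f - al ^+ 2 / nrm b) - 4 * c ^+ 2 * th ^+ 2 / nrm b.
  apply: cvgB; last exact: cvgMl_tmp.
  by apply: cvgMl_tmp; apply: cvgB; [exact: cvg_cst|exact: cvgMl_tmp].
apply: le_trans (ler_cvg_to h (@cvg_cst _ X _ \oo _) key).
by rewrite le_eqVlt; apply/orP; left; apply/eqP; ring.
Unshelve. all: by end_near. Qed.

End gap.

End levels.

(** * Slicing a product space *)

Section real_fubini.
Context d1 d2 (T1 : measurableType d1) (T2 : measurableType d2) (R : realType).
Variable m1 : {sigma_finite_measure set T1 -> \bar R}.
Variable m2 : {sigma_finite_measure set T2 -> \bar R}.
Implicit Types F : T1 * T2 -> R.
Local Notation m12 := (m1 \x m2)%E.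

(** Section integrals are finite only almost everywhere; [fine] replaces the infinite values by 0,
    which does not change the integral. *)
Lemma integrable_fine d (T : measurableType d) (m : {measure set T -> \bar R})
    (G : T -> \bar R) : m.-integrable setT G ->
  m.-integrable setT (EFin \o (fine \o G)) /\
  \int[m]_x fine (G x) = fine (\int[m]_x G x)%E.
Proof.
move=> iG; have mG := measurable_int _ iG.
have ifG : m.-integrable setT (EFin \o (fine \o G)).
  apply: le_integrable iG => //; first exact/measurable_EFinP/measurableT_comp.
  by move=> x _ /=; case: (G x) => [r| |] /=; rewrite ?lexx// normr0 leey.
split=> //; congr fine; apply: ae_eq_integral => //.
  exact: measurable_int ifG.
have := integrable_ae measurableT iG.
by apply: filterS => x /= h xT; rewrite fineK// h.
Qed.

(** Integrability is not assumed, so the positive and negative parts are treated separately by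
    Tonelli. *)
Lemma measurable_section1 F : measurable_fun setT F ->
  measurable_fun setT (fun x => \int[m2]_y F (x, y)).
Proof.
move=> mF; apply: measurableT_comp => //.
have mE : measurable_fun setT (EFin \o F) by exact/measurable_EFinP.
rewrite (_ : (fun x => _) = (fun x => \int[m2]_y ((EFin \o F)^\+ (x, y))) \-
    (fun x => \int[m2]_y ((EFin \o F)^\- (x, y))))%E.
  by apply: emeasurable_funB; apply: measurable_fun_fubini_tonelli_F => //;
    [exact: measurable_funepos|exact: measurable_funeneg].
apply/funext => x; rewrite [LHS]integralE /=.
by congr (_ - _)%E; apply: eq_integral => y _; rewrite ?funeposE ?funenegE.
Qed.

Lemma measurable_section2 F : measurable_fun setT F ->
  measurable_fun setT (fun y => \int[m1]_x F (x, y)).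
Proof.
move=> mF; apply: measurableT_comp => //.
have mE : measurable_fun setT (EFin \o F) by exact/measurable_EFinP.
rewrite (_ : (fun y => _) = (fun y => \int[m1]_x ((EFin \o F)^\+ (x, y))) \-
    (fun y => \int[m1]_x ((EFin \o F)^\- (x, y))))%E.
  by apply: emeasurable_funB; apply: measurable_fun_fubini_tonelli_G => //;
    [exact: measurable_funepos|exact: measurable_funeneg].
apply/funext => x; rewrite [LHS]integralE /=.
by congr (_ - _)%E; apply: eq_integral => y _; rewrite ?funeposE ?funenegE.
Qed.

Lemma integrable_fubini_G (f : T1 * T2 -> \bar R) : m12.-integrable setT f ->
  m2.-integrable setT (fun y => \int[m1]_x f (x, y))%E.
Proof.
move=> fi; have mf := measurable_int _ fi.
apply/integrableP; split; first exact: (measurable_fubini_G fi).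
apply: le_lt_trans ((integrable21ltyP m1 m2 mf).1 fi).
have mG : measurable_fun setT (fun y => \int[m1]_x `|f (x, y)|)%E.
  apply: (measurable_fun_fubini_tonelli_G (abse \o f)) => //=.
  exact: measurableT_comp.
apply: ge0_le_integral => //.
- by apply: measurableT_comp => //; exact: (measurable_fubini_G fi).
- move=> y _; apply: le_abse_integral => //.
  exact: measurableT_comp.
Qed.

Lemma integrable_section1 F : m12.-integrable setT (EFin \o F) ->
  m1.-integrable setT (EFin \o (fun x => \int[m2]_y F (x, y))).
Proof. by move=> iF; have [] := integrable_fine (integrable_fubini_F iF). Qed.

Lemma integrable_section2 F : m12.-integrable setT (EFin \o F) ->
  m2.-integrable setT (EFin \o (fun y => \int[m1]_x F (x, y))).
Proof. by move=> iF; have [] := integrable_fine (integrable_fubini_G iF). Qed.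

Lemma Rintegral_section1 F : m12.-integrable setT (EFin \o F) ->
  \int[m1]_x \int[m2]_y F (x, y) = \int[m12]_z F z.
Proof.
move=> iF; have [_] := integrable_fine (integrable_fubini_F iF).
by rewrite integral12_prod_meas1.
Qed.

Lemma Rintegral_section2 F : m12.-integrable setT (EFin \o F) ->
  \int[m2]_y \int[m1]_x F (x, y) = \int[m12]_z F z.
Proof.
move=> iF; have [_] := integrable_fine (integrable_fubini_G iF).
by rewrite integral21_prod_meas1.
Qed.

Lemma integrable_tensor (p : T1 -> R) (q : T2 -> R) :
  m1.-integrable setT (EFin \o p) -> m2.-integrable setT (EFin \o q) ->
  m12.-integrable setT (EFin \o (fun z => p z.1 * q z.2)).
Proof.
move=> ip iq.
have mp := integrable_meas ip; have mq := integrable_meas iq.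
have mpq : measurable_fun setT (fun z : T1 * T2 => p z.1 * q z.2).
  by apply: measurable_funM; exact: measurableT_comp.
apply/integrable12ltyP; first exact/measurable_EFinP.
rewrite (_ : (fun x => _) = fun x => (`|p x| * \int[m2]_y `|q y|)%:E).
  apply: (@integrable_lty _ _ _ m1 setT measurableT) => //.
  rewrite (_ : (fun x => _) =
    EFin \o (fun x => \int[m2]_y `|q y| * `|p x|)); last first.
    by apply/funext => x /=; rewrite mulrC.
  exact/integrable_scaleR/integrable_norm.
apply/funext => x /=.
under eq_integral do rewrite normrM EFinM.
rewrite ge0_integralZl//; last exact/measurable_EFinP/measurableT_comp.
rewrite EFinM; congr (_ * _)%E; rewrite fineK//.
by apply: integrable_fin_num => //; exact: integrable_norm.
Qed.

Lemma L2_tensor (p : T1 -> R) (q : T2 -> R) : L2 m1 p -> L2 m2 q ->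
  L2 m12 (fun z => p z.1 * q z.2).
Proof.
move=> [mp ip] [mq iq]; split.
  by apply: measurable_funM; exact: measurableT_comp.
rewrite (_ : (fun z => _) = fun z => p z.1 ^+ 2 * q z.2 ^+ 2).
  exact: (@integrable_tensor (fun x => p x ^+ 2) (fun y => q y ^+ 2) ip iq).
by apply/funext => z; rewrite exprMn.
Qed.

Section rank_inequality.
Variables (I J : finType) (e : I -> T1 -> R) (f : J -> T2 -> R).
Hypotheses (Le : forall i, L2 m1 (e i)) (Lf : forall j, L2 m2 (f j)).
Hypotheses (He : orthosystem m1 e) (Hf : orthosystem m2 f).
Variable Phi : T1 * T2 -> R.
Hypothesis LPhi : L2 m12 Phi.
Hypothesis LPhi1 : forall y, L2 m1 (fun t => Phi (t, y)).
Hypothesis LPhi2 : forall t, L2 m2 (fun y => Phi (t, y)).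

Let a i y := ip m1 (fun t => Phi (t, y)) (e i).
Let b j t := ip m2 (fun y => Phi (t, y)) (f j).

Let unit_le1 d (T : measurableType d) (m : {measure set T -> \bar R})
    (K : finType) (g : K -> T -> R) k : orthosystem m g -> ip m (g k) (g k) <= 1.
Proof. by move=> [_ /(_ k)[->//|->]]; rewrite ip0l. Qed.

(** Since [e i] has norm at most 1, Cauchy-Schwarz in each slice bounds a_i(y)^2 by the integral of
    Phi(t, y)^2 in t, which is integrable in y by Fubini. *)
Lemma L2_coef1 i : L2 m2 (a i).
Proof.
have ma : measurable_fun setT (a i).
  apply: (@measurable_section2 (fun z => Phi z * e i z.1)).
  apply: measurable_funM; first by case: LPhi.
  by apply: measurableT_comp => //; case: (Le i).
split=> //.
apply: (@integrable_le _ _ _ _ _ (fun y => \int[m1]_t (Phi (t, y) ^+ 2))).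
- exact: measurable_funX.
- by apply: (@integrable_section2 (fun z => Phi z ^+ 2)); case: LPhi.
- move=> y; rewrite ger0_norm ?sqr_ge0//.
  apply: le_trans (ip_CauchySchwarz (LPhi1 y) (Le i)) _.
  by rewrite -ip_sq ler_piMr ?ip_ge0// unit_le1.
Qed.

Lemma L2_coef2 j : L2 m1 (b j).
Proof.
have mb : measurable_fun setT (b j).
  apply: (@measurable_section1 (fun z => Phi z * f j z.2)).
  apply: measurable_funM; first by case: LPhi.
  by apply: measurableT_comp => //; case: (Lf j).
split=> //.
apply: (@integrable_le _ _ _ _ _ (fun t => \int[m2]_y (Phi (t, y) ^+ 2))).
- exact: measurable_funX.
- by apply: (@integrable_section1 (fun z => Phi z ^+ 2)); case: LPhi.
- move=> t; rewrite ger0_norm ?sqr_ge0//.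
  apply: le_trans (ip_CauchySchwarz (LPhi2 t) (Lf j)) _.
  by rewrite -ip_sq ler_piMr ?ip_ge0// unit_le1.
Qed.

Let mij i j := ip m12 Phi (fun z => e i z.1 * f j z.2).

Lemma ip_coef1 i j : ip m2 (a i) (f j) = mij i j.
Proof.
have iF := L2_integrableM LPhi (L2_tensor (Le i) (Lf j)).
rewrite /mij /ip -Rintegral_section2//; apply: eq_Rintegral => y _ /=.
rewrite /a /ip -RintegralZr//; last exact: L2_integrableM (LPhi1 y) (Le i).
by apply: eq_Rintegral => t _; rewrite mulrA.
Qed.

Lemma ip_coef2 i j : ip m1 (b j) (e i) = mij i j.
Proof.
have iF := L2_integrableM LPhi (L2_tensor (Le i) (Lf j)).
rewrite /mij /ip -Rintegral_section1//; apply: eq_Rintegral => t _ /=.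
rewrite /b /ip -RintegralZr//; last exact: L2_integrableM (LPhi2 t) (Lf j).
by apply: eq_Rintegral => y _; rewrite mulrAC mulrA mulrAC.
Qed.

(* The squared norm of [(1 - E) (1 - F) Phi] is nonnegative, with [E] and [F]
   the orthogonal projections on the spans of [e] and [f]. *)
Lemma rank_inequality :
  \sum_i ip m2 (a i) (a i) + \sum_j ip m1 (b j) (b j) <=
  ip m12 Phi Phi + \sum_j \sum_i mij i j ^+ 2.
Proof.
(* This is (1 - E) Phi; its norm follows from Bessel's identity in every slice. *)
pose chi z := Phi z - \sum_i e i z.1 * a i z.2.
have Lchi : L2 m12 chi.
  by apply: L2B => //; apply: L2_sum => i; apply: L2_tensor => //; exact: L2_coef1.
have Lsum t : L2 m2 (fun y => \sum_i e i t * a i y).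
  by apply: (@L2_sum _ _ _ _ _ _ _ (fun i y => e i t * a i y)) => i; exact/L2Z/L2_coef1.
have Lchi2 t : L2 m2 (fun y => chi (t, y)).
  rewrite (_ : (fun y => _) = fun y => Phi (t, y) - \sum_i e i t * a i y)//.
  exact: L2B.
have [mchi ichi] := Lchi; have [mPhi iPhi] := LPhi.
have Nchi : ip m12 chi chi = ip m12 Phi Phi - \sum_i ip m2 (a i) (a i).
  rewrite !ip_sq -(Rintegral_section2 ichi).
  have Ey y : \int[m1]_t (chi (t, y) ^+ 2) =
      \int[m1]_t (Phi (t, y) ^+ 2) - \sum_i a i y ^+ 2.
    rewrite -(ip_sq m1 (fun t => Phi (t, y))) -(bessel_id Le He (LPhi1 y)) ip_sq.
    apply: eq_Rintegral => t _; congr (_ ^+ 2); rewrite /chi/=; congr (_ - _).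
    by apply: eq_bigr => i _; rewrite mulrC.
  under eq_Rintegral do rewrite Ey.
  have ia i : m2.-integrable setT (EFin \o (fun y => a i y ^+ 2)).
    by case: (L2_coef1 i).
  rewrite RintegralB//; last exact: integrable_sumR.
    by rewrite (@Rintegral_section2 (fun z => Phi z ^+ 2))// Rintegral_sumR//;
      congr (_ - _); apply: eq_bigr => i _; rewrite ip_sq.
  exact: (@integrable_section2 (fun z => Phi z ^+ 2)).
(* The coefficient of [chi] on [f j]. It is also the residue of [b j] after projection on the span
   of [e], because the two projections commute; so Bessel's identity computes its norm. *)
pose beta j t := b j t - \sum_i ip m1 (b j) (e i) * e i t.
have Lbeta j : L2 m1 (beta j).
  by apply: L2B; [exact: L2_coef2|apply: L2_sum => i; exact: L2Z].
have betaE j t : ip m2 (fun y => chi (t, y)) (f j) = beta j t.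
  rewrite [LHS](@ipBl _ _ _ _ (fun y => Phi (t, y)) (fun y => \sum_i e i t * a i y))//.
  congr (_ - _).
  rewrite (@ip_suml _ _ _ _ _ _ (fun i y => e i t * a i y))//; last first.
    by move=> i; apply: L2Z; exact: L2_coef1.
  apply: eq_bigr => i _; rewrite ipZl//; last exact: L2_coef1.
  by rewrite ip_coef1 ip_coef2 mulrC.
have ibeta j : m1.-integrable setT (EFin \o (fun t => beta j t ^+ 2)).
  by case: (Lbeta j).
have sumbeta : \int[m1]_t (\sum_j beta j t ^+ 2) = \sum_j ip m1 (beta j) (beta j).
  by rewrite Rintegral_sumR//; apply: eq_bigr => j _; rewrite ip_sq.
have : \sum_j ip m1 (beta j) (beta j) <= ip m12 chi chi.
  rewrite -sumbeta ip_sq -(Rintegral_section1 ichi).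
  apply: le_Rintegral => //; first exact: integrable_sumR.
    exact: (@integrable_section1 (fun z => chi z ^+ 2)).
  move=> t _; have := bessel Lf Hf (Lchi2 t).
  by under eq_bigr do rewrite betaE; rewrite ip_sq.
rewrite Nchi.
have Eb j : ip m1 (beta j) (beta j) =
    ip m1 (b j) (b j) - \sum_i ip m1 (b j) (e i) ^+ 2 := bessel_id Le He (L2_coef2 j).
under eq_bigr do rewrite Eb.
rewrite sumrB => h.
have -> : \sum_j \sum_i mij i j ^+ 2 = \sum_j \sum_i ip m1 (b j) (e i) ^+ 2.
  by apply: eq_bigr => j _; apply: eq_bigr => i _; rewrite ip_coef2.
by lra.
Qed.

End rank_inequality.

End real_fubini.

(** * Euclidean space as an iterated product *)

Section rV_topology.
Context (R : realType).

(** Measurability refers to the coordinates and continuity to the max-norm topology. The link is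
    that an open set is the union of the countably many boxes with rational centre and radius that
    it contains. *)
Lemma measurable_fun_continuous_rV n (f : 'rV[R]_n -> R) : continuous f ->
  measurable_fun setT f.
Proof.
move=> cf; apply: (measurability _ (RGenOpens.measurableE R)).
move=> _ [_ [a [b ->] <-]]; rewrite setTI.
have : open (f @^-1` `]a, b[%classic).
  by apply: open_comp; [move=> x _; exact: cf|exact: interval_open].
set U := f @^-1` _ => oU.
pose box (qr : 'rV[rat]_n * rat) := [set x : 'rV[R]_n |
  forall i, `|x ord0 i - ratr (qr.1 ord0 i)| < ratr qr.2].
pose F qr := [set x | box qr x /\ box qr `<=` U].
have -> : U = \bigcup_qr F qr.
  apply/seteqP; split=> [x Ux|x [qr _ [xqr]]]; last exact.
  have /nbhs_ballP[e /= e0 eU] : nbhs x U by exact: open_nbhs_nbhs.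
  have [r] := @rat_in_itvoo R 0 (e / 2) (divr_gt0 e0 (ltr0Sn _ _)).
  rewrite in_itv/= => /andP[r0 re].
  have H (i : 'I_n) : exists q : rat, `|x ord0 i - ratr q| < ratr r.
    have xr : x ord0 i - ratr r < x ord0 i + ratr r by lra.
    have [q] := rat_in_itvoo xr; rewrite in_itv/= => /andP[q1 q2].
    by exists q; rewrite ltr_norml; apply/andP; split; lra.
  pose q := \row_i sval (cid (H i)).
  have xq i : `|x ord0 i - ratr (q ord0 i)| < ratr r by rewrite mxE; case: cid.
  exists (q, r) => //; split=> [i|y yq]; first exact: xq.
  apply: eU; split=> // i j; rewrite (ord1 i) /ball/=.
  have := xq j; have := yq j; rewrite /= !ltr_norml => /andP[? ?] /andP[? ?].
  by apply/andP; split; lra.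
apply: countable_bigcupT_measurable => [|qr]; first exact: countableP.
have [qrU|qrU] := pselect (box qr `<=` U); last first.
  by rewrite (_ : F qr = set0)//; apply/seteqP; split=> x //= [].
rewrite (_ : F qr = \bigcap_(i in [set: 'I_n])
    (coord_rV i @^-1` [set t : R | `|t - ratr (qr.1 ord0 i)| < ratr qr.2])).
  apply: fin_bigcap_measurable => // i _; rewrite -[X in measurable X]setTI.
  apply: measurable_coord_rV => //.
  rewrite (_ : [set t : R | _] = ball (ratr (qr.1 ord0 i) : R) (ratr qr.2)).
    exact: measurable_ball.
  by apply/seteqP; split=> t /=; rewrite /ball/= distrC.
apply/seteqP; split=> [x [xq _] i _ /=|x xq]; first exact: xq.
by split=> // i; exact: (xq i I).
Qed.

Lemma continuous_cons_rV1 n (y : 'rV[R]_n) :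
  continuous (fun t : R => cons_rV (t, y)).
Proof.
move=> t; apply/cvg_ballP => e e0.
have := @nbhsx_ballx _ R t e e0; apply: (@filterS _ (nbhs t)) => t' tt'.
split=> // i j; rewrite (ord1 i); case: (unliftP ord0 j) => [k ->|->].
  by rewrite !cons_rVS; exact: ballxx.
by rewrite !cons_rV0.
Qed.

Lemma continuous_cons_rV2 n (t : R) :
  continuous (fun y : 'rV[R]_n => cons_rV (t, y)).
Proof.
move=> y.
apply/(@cvg_ballP _ _ _ (nbhs y)) => e e0.
have := @nbhsx_ballx _ _ y e e0; apply: (@filterS _ (nbhs y)) => y' [_ yy'].
split=> // i j; rewrite (ord1 i); case: (unliftP ord0 j) => [k ->|->].
  by rewrite !cons_rVS/=; exact: yy'.
by rewrite !cons_rV0/=; exact: ballxx.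
Qed.

Lemma cons_rV_shift0 n (h t : R) (y : 'rV[R]_n) :
  h *: delta_mx ord0 ord0 + cons_rV (t, y) = cons_rV (h + t, y).
Proof.
apply/rowP => j; rewrite mxE [X in X + _]mxE [X in _ * X + _]mxE eqxx/=; case: (unliftP ord0 j) => [k ->|->].
  by rewrite !cons_rVS/= mulr0 add0r.
by rewrite !cons_rV0/= mulr1.
Qed.

Lemma cons_rV_shiftS n (h t : R) (y : 'rV[R]_n) (i : 'I_n) :
  h *: delta_mx ord0 (lift ord0 i) + cons_rV (t, y) =
  cons_rV (t, h *: delta_mx ord0 i + y).
Proof.
apply/rowP => j; rewrite mxE [X in X + _]mxE [X in _ * X + _]mxE eqxx/=; case: (unliftP ord0 j) => [k ->|->].
  by rewrite !cons_rVS/= mxE [X in _ = X + _]mxE mxE eqxx/= (inj_eq lift_inj).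
by rewrite !cons_rV0/= mulr0 add0r.
Qed.

(** The difference quotients of a slice and of the function coincide, so partial derivatives agree
    without any differentiability assumption. *)
Let slice_quotient n (i : 'I_n) (f : 'rV[R]_n.+1 -> R) t y :
  (fun h => h^-1 *: (((fun y => f (cons_rV (t, y))) \o shift y)
    (h *: delta_mx ord0 i) - f (cons_rV (t, y)))) =
  (fun h => h^-1 *: ((f \o shift (cons_rV (t, y)))
    (h *: delta_mx ord0 (lift ord0 i)) - f (cons_rV (t, y)))).
Proof. by apply/funext => h /=; rewrite cons_rV_shiftS. Qed.

Lemma partialS n (i : 'I_n) (f : 'rV[R]_n.+1 -> R) t y :
  partial i (fun y => f (cons_rV (t, y))) y =
  partial (lift ord0 i) f (cons_rV (t, y)).
Proof. by rewrite /partial /derive slice_quotient. Qed.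

Lemma derivableS n (i : 'I_n) (f : 'rV[R]_n.+1 -> R) t y :
  derivable f (cons_rV (t, y)) (delta_mx ord0 (lift ord0 i)) ->
  derivable (fun y => f (cons_rV (t, y))) y (delta_mx ord0 i).
Proof. by rewrite /derivable slice_quotient. Qed.

Lemma is_derive_slice n (f : 'rV[R]_n.+1 -> R) t y :
  derivable f (cons_rV (t, y)) (delta_mx ord0 ord0) ->
  is_derive (t : R) 1 (fun t => f (cons_rV (t, y)))
    (partial ord0 f (cons_rV (t, y))).
Proof.
move=> df; have E : (fun h => h^-1 *: (((fun t => f (cons_rV (t, y))) \o shift t)
    (h *: 1) - f (cons_rV (t, y)))) = (fun h =>
  h^-1 *: ((f \o shift (cons_rV (t, y))) (h *: delta_mx ord0 ord0)
  - f (cons_rV (t, y)))).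
  by apply/funext => h /=; rewrite cons_rV_shift0 /GRing.scale/= mulr1.
by split; rewrite /derivable /partial /derive E.
Qed.

End rV_topology.

Section smooth_box.
Context (R : realType).

Definition box_support n (s : 'I_n -> bool) (e N : R) (f : 'rV[R]_n -> R) :=
  forall x, f x != 0 -> forall i, `|x ord0 i| <= N /\ (s i -> e <= x ord0 i).

(** The class in which inductions on the dimension run. Here [s] marks the half-line directions; the
    explicit bounds [e] and [N], in place of a compact set in the orthant, pass unchanged to slices
    and to partial derivatives. *)
Fixpoint smooth_box (m : nat) n (s : 'I_n -> bool) (e N : R)
    (f : 'rV[R]_n -> R) : Prop :=
  [/\ continuous f, exists M, forall x, `|f x| <= M & box_support s e N f] /\
  if m is m'.+1 then forall i,
    (forall x, derivable f x (delta_mx ord0 i)) /\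
    smooth_box m' s e N (partial i f)
  else True.

Lemma smooth_box0 m n (s : 'I_n -> bool) e N f : smooth_box m s e N f ->
  smooth_box 0 s e N f.
Proof. by case: m => [//|m] [h _]. Qed.

Lemma smooth_boxW m n (s : 'I_n -> bool) e N f : smooth_box m.+1 s e N f ->
  smooth_box m s e N f.
Proof.
elim: m f => [f [h _]|m IH f [h1 h2]]; first by split.
by split=> // i; have [d /IH] := h2 i.
Qed.

Lemma smooth_box_slice m n (s : 'I_n.+1 -> bool) e N f (t : R) :
  smooth_box m s e N f ->
  smooth_box m (fun i => s (lift ord0 i)) e N (fun y => f (cons_rV (t, y))).
Proof.
elim: m f => [|m IH] f [[cf [M fM] sf] h2].
all: have base : [/\ continuous (fun y => f (cons_rV (t, y))),
    exists M, forall y, `|f (cons_rV (t, y))| <= M &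
    box_support (fun i => s (lift ord0 i)) e N (fun y => f (cons_rV (t, y)))].
all: try by split;
  [move=> y; apply: continuous_comp; [exact: continuous_cons_rV2|exact: cf]
  |by exists M
  |by move=> y /sf h i; have := h (lift ord0 i); rewrite cons_rVS].
all: split=> //.
move=> i; have [d sp] := h2 (lift ord0 i); split=> [y|].
  exact: derivableS.
rewrite (_ : partial i _ = fun y => partial (lift ord0 i) f (cons_rV (t, y))).
  exact: IH.
by apply/funext => y; exact: partialS.
Qed.

End smooth_box.

Section cons_fubini.
Context (R : realType).
Local Notation leb := (@lebesgue_measure R).
Local Notation mu n := (@lebesgue_rV R n).
Local Notation pm n := (leb \x mu n)%E.

Lemma integrable_cons n (F : 'rV[R]_n.+1 -> R) : measurable_fun setT F ->
  (pm n).-integrable setT (EFin \o (fun z => F (cons_rV z))) <->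
  (mu n.+1).-integrable setT (EFin \o F).
Proof.
move=> mF; have mE : measurable_fun setT (EFin \o F) by exact/measurable_EFinP.
split=> h.
  exact: (@integrable_pushforward _ _ _ _ R (@cons_rV R n) (@measurable_cons_rV R n)
    (pm n) setT (EFin \o F) mE h measurableT).
have mc := @measurable_cons_rV R n.
move/integrableP : h => [_ h]; apply/integrableP; split.
  by apply/measurable_EFinP; exact: measurableT_comp.
move: h; apply: le_lt_trans.
have := @ge0_integral_pushforward _ _ _ _ R (@cons_rV R n) mc (pm n) setT
  (fun x => `|(EFin \o F) x|%E) measurableT.
rewrite le_eqVlt => <-//; first by rewrite eqxx.
exact: measurableT_comp.
Qed.

Lemma Rintegral_cons n (F : 'rV[R]_n.+1 -> R) :
  (mu n.+1).-integrable setT (EFin \o F) ->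
  \int[mu n.+1]_x F x = \int[pm n]_z F (cons_rV z).
Proof.
move=> iF; have mF := integrable_meas iF.
have mE : measurable_fun setT (EFin \o F) by exact/measurable_EFinP.
congr fine.
exact: (@integral_pushforward _ _ _ _ R (@cons_rV R n) (@measurable_cons_rV R n)
    (pm n) setT (EFin \o F) mE ((integrable_cons mF).2 iF) measurableT).
Qed.

Lemma L2_cons n (F : 'rV[R]_n.+1 -> R) : L2 (mu n.+1) F ->
  L2 (pm n) (fun z => F (cons_rV z)).
Proof.
move=> [mF iF]; split; last exact: (integrable_cons (integrable_meas iF)).2.
by apply: measurableT_comp => //; exact: measurable_cons_rV.
Qed.

Lemma ip_cons n (F G : 'rV[R]_n.+1 -> R) : L2 (mu n.+1) F -> L2 (mu n.+1) G ->
  ip (mu n.+1) F G =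
  ip (pm n) (fun z => F (cons_rV z)) (fun z => G (cons_rV z)).
Proof. by move=> LF LG; exact: Rintegral_cons (L2_integrableM LF LG). Qed.

Definition tensor n (p : 'I_n -> R -> R) (x : 'rV[R]_n) : R :=
  \prod_i p i (x ord0 i).

Lemma tensor_cons n (p : 'I_n.+1 -> R -> R) z :
  tensor p (cons_rV z) = p ord0 z.1 * tensor (fun i => p (lift ord0 i)) z.2.
Proof.
rewrite /tensor big_ord_recl cons_rV0; congr (_ * _).
by apply: eq_bigr => i _; rewrite cons_rVS.
Qed.

Lemma measurable_tensor n (p : 'I_n -> R -> R) :
  (forall i, measurable_fun setT (p i)) -> measurable_fun setT (tensor p).
Proof.
move=> mp; apply: (@measurable_prod _ _ _ setT _ (index_enum 'I_n)
  (fun i (x : 'rV[R]_n) => p i (x ord0 i))) => i _.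
apply: (@measurableT_comp _ _ _ _ _ _ (p i)) => //.
exact: (@measurable_coord_rV R n i).
Qed.

Lemma L2_tensor_rV n (p : 'I_n -> R -> R) : (forall i, L2 leb (p i)) ->
  L2 (mu n) (tensor p).
Proof.
move=> Lp; have mt : measurable_fun setT (tensor p).
  by apply: measurable_tensor => i; case: (Lp i).
split=> //; elim: n p Lp mt => [|n IH] p Lp mt.
  rewrite (_ : EFin \o _ = cst 1%E).
    by apply/integrableP; split => //; under eq_integral do rewrite /= normr1;
      rewrite integral_cst//= diracT mule1 ltry.
  by apply/funext => x /=; rewrite /tensor big_ord0 expr1n.
apply: (iffLR (integrable_cons _)); first exact: measurable_funX.
rewrite (_ : (fun z => _) = fun z => p ord0 z.1 ^+ 2 *
    tensor (fun i => p (lift ord0 i)) z.2 ^+ 2); last first.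
  by apply/funext => z; rewrite tensor_cons exprMn.
apply: (@integrable_tensor _ _ _ _ R leb (mu n) (fun t => p ord0 t ^+ 2)
  (fun y => tensor (fun i => p (lift ord0 i)) y ^+ 2)); first by case: (Lp ord0).
apply: IH => //.
by apply: measurable_tensor => i; case: (Lp (lift ord0 i)).
Qed.

Lemma ip_tensor n (p q : 'I_n -> R -> R) : (forall i, L2 leb (p i)) ->
  (forall i, L2 leb (q i)) ->
  ip (mu n) (tensor p) (tensor q) = \prod_i ip leb (p i) (q i).
Proof.
elim: n p q => [|n IH] p q Lp Lq.
  rewrite big_ord0 /ip (_ : (fun x => _) = fun=> 1); last first.
    by apply/funext => x; rewrite /tensor !big_ord0 mulr1.
  rewrite Rintegral_cst// mul1r -[RHS]/(fine 1%E); congr fine.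
  exact: diracT.
rewrite big_ord_recl -IH//.
have Lp' := L2_tensor_rV (fun i => Lp (lift ord0 i)).
have Lq' := L2_tensor_rV (fun i => Lq (lift ord0 i)).
rewrite ip_cons; [|exact: L2_tensor_rV..].
rewrite [LHS](_ : _ = \int[pm n]_z ((p ord0 z.1 * q ord0 z.1) *
  (tensor (fun i => p (lift ord0 i)) z.2 * tensor (fun i => q (lift ord0 i)) z.2))); last first.
  by apply: eq_Rintegral => z _; rewrite !tensor_cons; ring.
rewrite -Rintegral_section1; last first.
  apply: (@integrable_tensor _ _ _ _ R leb (mu n) (fun t => p ord0 t * q ord0 t)
    (fun y => tensor (fun i => p (lift ord0 i)) y * tensor (fun i => q (lift ord0 i)) y)).
    exact: L2_integrableM.
  exact: L2_integrableM.
rewrite [ip leb _ _ in RHS]/ip -RintegralZr//; last exact: L2_integrableM.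
apply: eq_Rintegral => t _ /=.
by rewrite /ip -RintegralZl//; exact: L2_integrableM.
Qed.

Lemma L2_box n (s : 'I_n -> bool) e N M (f : 'rV[R]_n -> R) : continuous f ->
  (forall x, `|f x| <= M) -> box_support s e N f -> L2 (mu n) f.
Proof.
move=> cf fM sf; have mf := measurable_fun_continuous_rV cf.
split=> //.
pose B := [set x : 'rV[R]_n | forall i, x ord0 i \in `[- N, N]].
have mB : measurable B.
  rewrite (_ : B = \bigcap_(i in [set: 'I_n]) (coord_rV i @^-1` `[- N, N]%classic)).
    apply: fin_bigcap_measurable => // i _; rewrite -[X in measurable X]setTI.
    exact: measurable_coord_rV.
  by apply/seteqP; split=> x /= Bx i; [move=> _; exact: Bx|exact: Bx].
have Bfin : (mu n B < +oo)%E.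
  have := @lebesgue_rV_box R n (fun=> `[- N, N]%classic) (fun=> measurable_itv _).
  rewrite -/B => ->.
  have [q qE] : exists q : R, leb `[- N, N]%classic = q%:E.
    have := lebesgue_measure_itv `[- N, N]; rewrite -EFinB => ->.
    by case: ifP => _; [exists (N - - N)|exists 0].
  rewrite (eq_bigr (fun=> q%:E))//; have [r ->] : exists r : R,
      (\prod_(i < n) q%:E)%E = r%:E.
    elim/big_ind: _ => [|x y [r ->] [r' ->]|i _]; first by exists 1.
      by exists (r * r').
    by exists q.
  exact: ltry.
apply: (@integrable_le _ _ _ _ _ (fun x => M ^+ 2 * \1_B x)).
- exact: measurable_funX.
- apply: integrable_scaleR; apply/integrableP; split.
    exact/measurable_EFinP/measurable_indic.
  under eq_integral do rewrite /= ger0_norm//.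
  by rewrite integral_indic// setIT.
- move=> x; rewrite ger0_norm ?sqr_ge0//.
  have M0 : 0 <= M by exact: le_trans (fM x).
  have [->|/sf fx] := eqVneq (f x) 0.
    by rewrite expr0n mulr_ge0// sqr_ge0.
  rewrite indicE mem_set ?mulr1; last first.
    by move=> i; rewrite in_itv/= -ler_norml; have [] := fx i.
  by rewrite -real_normK ?num_real// ler_sqr ?nnegrE.
Qed.

End cons_fubini.

(** * Integration by parts and the weak eigenvalue equation in one dimension *)

Section green_identities_1D.
Context (R : realType).
Local Notation leb := (@lebesgue_measure R).

(** Every boundary term contains [f] or [f'], so [h] is free at the ends; it will be a level, and
    [f] a slice of a test function. *)
Lemma green_interval (a b : R) (h h' h'' f f' f'' : R -> R) : a < b ->
  {in `[a, b], forall x : R, is_derive x 1 h (h' x)} ->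
  {in `[a, b], forall x : R, is_derive x 1 h' (h'' x)} ->
  {in `[a, b], forall x : R, is_derive x 1 f (f' x)} ->
  {in `[a, b], forall x : R, is_derive x 1 f' (f'' x)} ->
  contin a b h'' -> contin a b f'' ->
  f a = 0 -> f b = 0 -> f' a = 0 -> f' b = 0 ->
  \int[leb]_(x in `[a, b]) (h x * f'' x) =
  \int[leb]_(x in `[a, b]) (h'' x * f x).
Proof.
move=> ab dh dh' df df' ch'' cf'' fa fb fa' fb'.
have ch := contin_derive dh; have ch' := contin_derive dh'.
have cf := contin_derive df; have cf' := contin_derive df'.
apply/eqP; rewrite -subr_eq0 -IntB; [|by contin..].
rewrite (@Rintegral_derive _ _ _ (fun x => h x * f' x - h' x * f x))//.
- by rewrite fa fb fa' fb' !mulr0 !subrr.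
- move=> x xab; have d1 := derM (dh _ xab) (df' _ xab).
  have d2 := derM (dh' _ xab) (df _ xab).
  by apply: (is_derive_eq (derD d1 (derN d2))); ring.
- by contin.
Qed.

Variables (b : bool) (e N : R).
Let supp (f : R -> R) := forall x, f x != 0 -> `|x| <= N /\ (b -> e <= x).

Lemma Rintegral_by_parts (g g' f f' : R -> R) :
  (forall x : R, is_derive x 1 g (g' x)) -> continuous g' ->
  (forall x : R, is_derive x 1 f (f' x)) -> continuous f' ->
  supp f -> supp f' -> L2 leb g -> L2 leb g' ->
  ip leb g f' = - ip leb g' f.
Proof.
move=> dg cg' df cf' sf sf' Lg Lg'.
have cf : continuous f by move=> x; exact: is_derive_cont (df x).
have cg : continuous g by move=> x; exact: is_derive_cont (dg x).
pose K := `|N| + 1.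
have KN : N < K by rewrite /K (le_lt_trans (ler_norm N))// ltrDl.
have K0 : 0 < K by rewrite /K ltr_wpDl.
have sK (h : R -> R) : supp h -> forall x, h x != 0 -> x \in `[- K, K].
  move=> sh x /sh[+ _]; rewrite in_itv/= -ler_norml => /le_trans; apply.
  exact: ltW.
have Lf := L2_support cf (sK _ sf); have Lf' := L2_support cf' (sK _ sf').
have f0 x : K <= `|x| -> f x = 0.
  move=> Kx; apply/eqP/negPn/negP => /sf[+ _].
  by rewrite leNgt (lt_le_trans KN).
apply/eqP; rewrite -subr_eq0 opprK; apply/eqP.
rewrite /ip -RintegralD//; [|exact: L2_integrableM..].
rewrite (@Rintegral_support _ _ (- K) K); last first.
  move=> x; have [fx|/(sK _ sf)//] := eqVneq (f x) 0.
  have [fx'|/(sK _ sf')//] := eqVneq (f' x) 0.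
  by rewrite fx fx' !mulr0 addr0 eqxx.
rewrite (@Rintegral_derive _ _ _ (fun x => g x * f x)).
- by rewrite !f0 ?normrN ?ger0_norm ?(ltW K0)// !mulr0 subrr.
- by rewrite gtrN.
- move=> x _; apply: (is_derive_eq (derM (dg x) (df x))).
  by rewrite addrC.
- have c1 : contin (- K) K g by move=> x _; exact: cg.
  have c2 : contin (- K) K g' by move=> x _; exact: cg'.
  have c3 : contin (- K) K f by move=> x _; exact: cf.
  have c4 : contin (- K) K f' by move=> x _; exact: cf'.
  by contin.
Qed.

(** The second derivative is put on the test function because the half-line level, extended by 0,
    has a corner at the origin. If [i] and [b] both hold, the level is zero. *)
Lemma level_eigen_weak (c : R) (i : bool) (f f' f'' : R -> R) : 0 < c ->
  0 < e ->
  (forall x : R, is_derive x 1 f (f' x)) -> (forall x : R, is_derive x 1 f' (f'' x)) ->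
  continuous f'' -> supp f -> supp f' -> supp f'' ->
  ip leb (level c i b) f'' = c ^+ 2 * ip leb (level c i b) (fun x => x ^+ 2 * f x)
    - c * (1 + 2 * b%:R + 2 * i%:R) * ip leb (level c i b) f.
Proof.
move=> c0 e0 df df' cf'' sf sf' sf''.
have [ib|ib] := boolP (i && b).
  move/andP : ib => [-> ->]; rewrite !ip0l; ring.
have cf' : continuous f' by move=> x; exact: is_derive_cont (df' x).
have cf : continuous f by move=> x; exact: is_derive_cont (df x).
pose K := `|N| + e + 1.
(* Positive, so that the level is smooth up to this end, and strictly below the support, so that [f]
   and [f'] vanish there. *)
pose lo := if b then e / 2 else - K.
have KN : N < K.
  by rewrite /K (le_lt_trans (ler_norm N))// -addrA ltrDl addr_gt0.
have K0 : 0 < K by rewrite /K ltr_wpDl// addr_ge0// ltW.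
have loK : lo < K.
  rewrite /lo; case: b => /=; last by rewrite gtrN.
  by rewrite /K; have := normr_ge0 N; lra.
have sK (h : R -> R) : supp h -> forall x, h x != 0 -> x \in `]lo, K[.
  move=> sh x /sh[]; rewrite in_itv/= ler_norml => /andP[x1 x2] ex.
  rewrite (le_lt_trans x2 KN) andbT /lo; case: b ex => [/(_ isT)|_].
    by apply: lt_le_trans; lra.
  by rewrite (lt_le_trans _ x1)// ltrN2.
have sK' (h : R -> R) : supp h -> forall x, h x != 0 -> x \in `[lo, K].
  by move=> /sK sh x /sh /subset_itv_oo_cc.
have end0 (h : R -> R) : supp h -> h lo = 0 /\ h K = 0.
  move=> sh; split; apply/eqP/negPn/negP => /(sK _ sh);
    by rewrite in_itv/= ltxx ?andbF.
have [flo fK] := end0 _ sf; have [flo' fK'] := end0 _ sf'.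
have Lf := L2_support cf (sK' _ sf); have Lf'' := L2_support cf'' (sK' _ sf'').
have Lx2f : L2 leb (fun x => x ^+ 2 * f x).
  apply: (@L2_support _ _ lo K).
    by move=> x; apply: (@continuousM R R (fun y => y ^+ 2) f);
      [exact: exprn_continuous|exact: cf].
  by move=> x; rewrite mulf_eq0 negb_or => /andP[_ /(sK' _ sf)].
have Ll : L2 leb (level c i b) by exact: L2_level.
rewrite -ipZr// -ipZr// -ipBr//; [|exact: L2Z..].
(* The ground state of the half-line and the first level of the line have the same formula and the
   same eigenvalue 3c. As [i && b] has been excluded, only [b || i] distinguishes the cases. *)
pose h x := if b || i then x * gauss c x else gauss c x.
pose h' x := if b || i then (1 - c * x ^+ 2) * gauss c x else - (c * x * gauss c x).
pose E := c * (1 + 2 * b%:R + 2 * i%:R).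
pose h'' x := (c ^+ 2 * x ^+ 2 - E) * h x.
have bi : b%:R + i%:R = (b || i)%:R :> R.
  by move: ib; case: (i); case: (b) => //= _; rewrite ?addr0 ?add0r.
have EE : E = c * (1 + 2 * (b || i)%:R).
  by rewrite /E -bi; ring.
have dh (x : R) : is_derive x 1 h (h' x).
  rewrite /h /h'; case: ifP => _; last exact: is_derive_gauss.
  apply: (is_derive_eq (derM (is_derive_id x 1) (is_derive_gauss c x))).
  by ring.
have dh' (x : R) : is_derive x 1 h' (h'' x).
  rewrite /h' /h'' EE /h; case: (b || i) => /=.
    have d1 := derD (is_derive_cst (1 : R) x (1 : R))
      (derN (derZ c (derM (is_derive_id x 1) (is_derive_id x 1)))).
    by apply: (is_derive_eq (derM d1 (is_derive_gauss c x))) => /=; ring.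
  have d1 := derM (derZ c (is_derive_id x 1)) (is_derive_gauss c x).
  by apply: (is_derive_eq (derN d1)); ring.
have [kap hkap] : exists kap : R, {in `[lo, K], forall x : R, level c i b x = kap * h x}.
  rewrite /h /lo /level; case: (i) (b) ib => [][]//= _.
  - exists (Num.sqrt (2 * c) / Num.sqrt (ip leb (ground c false) (ground c false))).
    by move=> x _; rewrite -[LHS]/(level1 c false x) level1E.
  - exists (Num.sqrt (ip leb (ground c true) (ground c true)))^-1 => x.
    rewrite in_itv/= => /andP[ex _].
    rewrite -[LHS]/(level0 c true x) level0E /ground.
    by rewrite (lt_le_trans _ ex)// divr_gt0.
  - exists (Num.sqrt (ip leb (ground c false) (ground c false)))^-1 => x _.
    by rewrite -[LHS]/(level0 c false x) level0E.
rewrite /ip (@Rintegral_support _ _ lo K); last first.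
  by move=> x; rewrite mulf_eq0 negb_or => /andP[_ /(sK' _ sf'')].
rewrite [RHS](@Rintegral_support _ _ lo K); last first.
  move=> x; have [->|/(sK' _ sf)//] := eqVneq (f x) 0.
  by rewrite !mulr0 subrr mulr0 eqxx.
have cg : contin lo K (gauss c) by move=> x _; exact: continuous_gauss.
have ch : contin lo K h by move=> x _; exact: is_derive_cont (dh x).
have ch'' : contin lo K h'' by rewrite /h''; contin.
have c1 : contin lo K f by move=> x _; exact: cf.
have c3 : contin lo K f'' by move=> x _; exact: cf''.
transitivity (kap * \int[leb]_(x in `[lo, K]) (h x * f'' x)).
  rewrite -IntZ; [|by contin]; apply: eq_Int => x xK; rewrite hkap//; ring.
rewrite (@green_interval lo K h h' h'' f f' f'')//; last first.
rewrite -IntZ; [|by contin]; apply: eq_Int => x xK; rewrite hkap// /h'' -/E; ring.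
Qed.

End green_identities_1D.

(** * Levels on the orthant and the spectral gap *)

Section slices.
Context (R : realType).
Local Notation leb := (@lebesgue_measure R).
Local Notation mu n := (@lebesgue_rV R n).
Implicit Types n : nat.

Lemma ip_slice1 n (F G : 'rV[R]_n.+1 -> R) : L2 (mu n.+1) F -> L2 (mu n.+1) G ->
  leb.-integrable setT (EFin \o (fun t =>
    ip (mu n) (fun y => F (cons_rV (t, y))) (fun y => G (cons_rV (t, y))))) /\
  ip (mu n.+1) F G = \int[leb]_t
    ip (mu n) (fun y => F (cons_rV (t, y))) (fun y => G (cons_rV (t, y))).
Proof.
move=> LF LG; rewrite ip_cons//.
have i := L2_integrableM (L2_cons LF) (L2_cons LG).
split; first exact: (integrable_section1 i).
by rewrite /ip -(Rintegral_section1 i).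
Qed.

Lemma ip_slice2 n (F G : 'rV[R]_n.+1 -> R) : L2 (mu n.+1) F -> L2 (mu n.+1) G ->
  (mu n).-integrable setT (EFin \o (fun y =>
    ip leb (fun t => F (cons_rV (t, y))) (fun t => G (cons_rV (t, y))))) /\
  ip (mu n.+1) F G = \int[mu n]_y
    ip leb (fun t => F (cons_rV (t, y))) (fun t => G (cons_rV (t, y))).
Proof.
move=> LF LG; rewrite ip_cons//.
have i := L2_integrableM (L2_cons LF) (L2_cons LG).
split; first exact: (integrable_section2 i).
by rewrite /ip -(Rintegral_section2 i).
Qed.

Section smooth_box_facts.
Variables (n : nat) (s : 'I_n -> bool) (e N : R).
Implicit Types f : 'rV[R]_n -> R.

Lemma smooth_box_L2 m f : smooth_box m s e N f -> L2 (mu n) f.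
Proof. by move=> /smooth_box0[[cf [M fM] sf] _]; exact: L2_box cf fM sf. Qed.

Lemma smooth_box_partial m f i : smooth_box m.+1 s e N f ->
  smooth_box m s e N (partial i f).
Proof. by move=> [_ /(_ i)[]]. Qed.

Lemma smooth_box_coordM f i : smooth_box 0 s e N f ->
  smooth_box 0 s e N (fun x => x ord0 i * f x).
Proof.
move=> [[cf [M fM] sf] _]; split=> //; split.
- by move=> x; apply: continuousM; [exact: coord_continuous|exact: cf].
- exists (`|N| * M) => x; have [->|fx] := eqVneq (f x) 0.
    by rewrite mulr0 normr0 mulr_ge0// (le_trans _ (fM x)).
  rewrite normrM ler_pM//; have [xN _] := sf x fx i.
  by rewrite (le_trans xN)// ler_norm.
- by move=> x; rewrite mulf_eq0 negb_or => /andP[_ /sf].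
Qed.

End smooth_box_facts.

Section smooth_box_slice2.
Variables (n : nat) (s : 'I_n.+1 -> bool) (e N : R) (f : 'rV[R]_n.+1 -> R).
Variable (y : 'rV[R]_n).
Local Notation fy := (fun t : R => f (cons_rV (t, y))).

Lemma slice2_support : box_support s e N f ->
  forall t, fy t != 0 -> `|t| <= N /\ (s ord0 -> e <= t).
Proof. by move=> sf t /sf /(_ ord0); rewrite cons_rV0. Qed.

Lemma slice2_continuous : continuous f -> continuous fy.
Proof.
by move=> cf t; apply: continuous_comp; [exact: continuous_cons_rV1|exact: cf].
Qed.

Lemma slice2_L2 m : smooth_box m s e N f -> L2 leb fy.
Proof.
move=> /smooth_box0[[cf _ sf] _].
apply: (@L2_support _ _ (- N) N); first exact: slice2_continuous.
by move=> t /(slice2_support sf)[+ _]; rewrite in_itv/= -ler_norml.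
Qed.

Lemma slice2_derive m : smooth_box m.+1 s e N f ->
  forall t : R, is_derive t 1 fy (partial ord0 f (cons_rV (t, y))).
Proof. by move=> [_ /(_ ord0)[df _]] t; exact: is_derive_slice (df _). Qed.

End smooth_box_slice2.

End slices.

Section levels_rV.
Context (R : realType) (c : R).
Hypothesis c_gt0 : 0 < c.
Local Notation leb := (@lebesgue_measure R).
Local Notation mu n := (@lebesgue_rV R n).

(* [None] is the ground state, [Some i] the first level in direction [i]. *)
Definition lev n (s : 'I_n -> bool) (k : option 'I_n) : 'rV[R]_n -> R :=
  tensor (fun i => level c (k == Some i) (s i)).

Lemma L2_lev n (s : 'I_n -> bool) k : L2 (mu n) (lev s k).
Proof. by apply: L2_tensor_rV => i; exact: L2_level. Qed.

(** Two different indices differ in some direction, whose factors are orthogonal. A product with a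
    zero factor is the zero function, and otherwise its norm is a product of ones. *)
Lemma lev_orthosystem n (s : 'I_n -> bool) : orthosystem (mu n) (lev s).
Proof.
have L i k : L2 leb (level c (k == Some i) (s i)) by exact: L2_level.
split=> [k k' kk'|k].
  rewrite ip_tensor//.
  have [i ki] : exists i, (k == Some i) != (k' == Some i).
    case: k kk' => [i|]; first by exists i; rewrite eqxx eq_sym eqb_id eq_sym.
    by case: k' => // i _; exists i; rewrite eqxx.
  rewrite (bigD1 i)//=; have [+ _] := level_orthosystem c_gt0 (s i).
  by move=> ->//; rewrite mul0r.
have [h|/existsNP[i h]] := pselect (forall i,
    ip leb (level c (k == Some i) (s i)) (level c (k == Some i) (s i)) = 1).
  by left; rewrite ip_tensor// big1.
right; apply/funext => x; rewrite /lev /tensor (bigD1 i)//=.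
have [_ /(_ (k == Some i))[//|->]] := level_orthosystem c_gt0 (s i).
by rewrite mul0r.
Qed.

Lemma lev_ground n (s : 'I_n -> bool) i k : 0 < k ->
  ip (mu n) (lev s (Some i)) (tensor (fun j => ground k (s j))) = 0.
Proof.
move=> k0; rewrite ip_tensor; [|by move=> j; exact: L2_level|
  by move=> j; exact: L2_ground].
by rewrite (bigD1 i)//= eqxx level1_ground// mul0r.
Qed.

Lemma lev_cons_None n (s : 'I_n.+1 -> bool) z :
  lev s None (cons_rV z) =
  level c false (s ord0) z.1 * lev (fun i => s (lift ord0 i)) None z.2.
Proof. by rewrite /lev tensor_cons. Qed.

Lemma lev_cons0 n (s : 'I_n.+1 -> bool) z :
  lev s (Some ord0) (cons_rV z) =
  level c true (s ord0) z.1 * lev (fun i => s (lift ord0 i)) None z.2.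
Proof. by rewrite /lev tensor_cons eqxx. Qed.

Lemma lev_consS n (s : 'I_n.+1 -> bool) j z :
  lev s (Some (lift ord0 j)) (cons_rV z) =
  level c false (s ord0) z.1 * lev (fun i => s (lift ord0 i)) (Some j) z.2.
Proof.
by rewrite /lev tensor_cons; congr (_ * _). Qed.

(** Only the factor in direction [i] has to be a level. The other factors are arbitrary, so
    coordinates before [i] can be sliced off until [i] comes first and the one-dimensional equation
    applies. *)
Lemma tensor_eigen_weak n (s : 'I_n -> bool) (e N : R) (p : 'I_n -> R -> R)
    (i : 'I_n) (j : bool) (f : 'rV[R]_n -> R) : 0 < e ->
  (forall i, L2 leb (p i)) -> p i = level c j (s i) -> smooth_box 2 s e N f ->
  ip (mu n) (tensor p) (fun x => partial i (partial i f) x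
    - c ^+ 2 * (x ord0 i * (x ord0 i * f x))
    + c * (1 + 2 * (s i)%:R + 2 * j%:R) * f x) = 0.
Proof.
elim: n s p i f => [|n IH] s p i f e0 Lp pi sf; first by case: i pi.
set H := fun x => _.
have sf1 := smooth_boxW sf; have sf0 := smooth_boxW sf1.
have sx := smooth_box_coordM i (smooth_box_coordM i sf0).
have sd := smooth_box_partial i (smooth_box_partial i sf).
have LH : L2 (mu n.+1) H.
  apply: L2D; first apply: L2B; [exact: smooth_box_L2 sd| |].
  - by apply: L2Z; exact: smooth_box_L2 sx.
  - by apply: L2Z; exact: smooth_box_L2 sf0.
have Lt : L2 (mu n.+1) (tensor p) by exact: L2_tensor_rV.
move: @H LH pi sx sd; case: (unliftP ord0 i) => [k ->|->] H LH pi sx sd.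
  have [_ ->] := ip_slice1 Lt LH.
  rewrite (_ : (fun t => _) = cst 0) ?Rintegral_cst ?mul0r//; apply/funext => t.
  pose g y := f (cons_rV (t, y)).
  have Eg : partial k g = fun y => partial (lift ord0 k) f (cons_rV (t, y)).
    by apply/funext => y; exact: partialS.
  have Egg y : partial k (partial k g) y =
      partial (lift ord0 k) (partial (lift ord0 k) f) (cons_rV (t, y)).
    by rewrite Eg partialS.
  rewrite (_ : (fun y => H _) = fun y => partial k (partial k g) y
    - c ^+ 2 * (y ord0 k * (y ord0 k * g y))
    + c * (1 + 2 * (s (lift ord0 k))%:R + 2 * j%:R) * g y); last first.
    by apply/funext => y; rewrite Egg /H cons_rVS.
  rewrite (_ : (fun y => tensor p _) =
    fun y => p ord0 t * tensor (fun i => p (lift ord0 i)) y); last first.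
    by apply/funext => y; rewrite tensor_cons.
  have sg := smooth_box_slice t sf.
  have sg1 := smooth_boxW sg; have sg0 := smooth_boxW sg1.
  rewrite ipZl; last 2 first.
  - by apply: L2_tensor_rV => l; exact: Lp.
  - apply: L2D; first apply: L2B.
    + exact: smooth_box_L2 (smooth_box_partial k (smooth_box_partial k sg)).
    + apply: L2Z; apply: smooth_box_L2 (smooth_box_coordM k (smooth_box_coordM k sg0)).
    + by apply: L2Z; exact: smooth_box_L2 sg0.
  rewrite (IH (fun i => s (lift ord0 i)) (fun i => p (lift ord0 i)) k g)//.
  by rewrite mulr0.
have [_ ->] := ip_slice2 Lt LH.
rewrite (_ : (fun y => _) = cst 0) ?Rintegral_cst ?mul0r//; apply/funext => y.
pose g t := f (cons_rV (t, y)).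
pose g'' t := partial ord0 (partial ord0 f) (cons_rV (t, y)).
rewrite (_ : (fun t => H _) = fun t => g'' t - c ^+ 2 * (t ^+ 2 * g t)
    + c * (1 + 2 * (s ord0)%:R + 2 * j%:R) * g t); last first.
  by apply/funext => t; rewrite /H cons_rV0 /= [t ^+ 2]expr2 -[t * t * _]mulrA.
rewrite (_ : (fun t => tensor p _) =
    fun t => tensor (fun i => p (lift ord0 i)) y * level c j (s ord0) t); last first.
  by apply/funext => t; rewrite tensor_cons pi mulrC.
have sd1 := smooth_box_partial ord0 sf.
have L1 : L2 leb (level c j (s ord0)) by exact: L2_level.
have L2' : L2 leb g'' by exact: slice2_L2 sd.
have L3 : L2 leb (fun t => t ^+ 2 * g t).
  rewrite (_ : (fun t => _) = fun t => cons_rV (t, y) ord0 ord0 *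
    (cons_rV (t, y) ord0 ord0 * f (cons_rV (t, y)))); last first.
    by apply/funext => t; rewrite cons_rV0 expr2 -mulrA.
  exact: slice2_L2 sx.
have L4 : L2 leb g by exact: slice2_L2 sf.
have [[_ _ b0] _] := smooth_box0 sf; have [[_ _ b1] _] := smooth_box0 sd1.
have [[cd _ b2] _] := smooth_box0 sd.
rewrite ipZl//; last by apply: L2D; [apply: L2B => //|]; exact: L2Z.
rewrite ipDr//; [|by apply: L2B => //; exact: L2Z|exact: L2Z].
rewrite ipBr//; last exact: L2Z.
rewrite !ipZr//.
have E : ip leb (level c j (s ord0)) g'' =
    c ^+ 2 * ip leb (level c j (s ord0)) (fun x => x ^+ 2 * g x)
    - c * (1 + 2 * (s ord0)%:R + 2 * j%:R) * ip leb (level c j (s ord0)) g.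
  apply: (@level_eigen_weak R (s ord0) e N c j g
    (fun t => partial ord0 f (cons_rV (t, y))) g'' c_gt0 e0).
  - by move=> t; exact: (slice2_derive y sf).
  - by move=> t; exact: (slice2_derive y sd1).
  - exact: slice2_continuous.
  - exact: slice2_support b0.
  - exact: slice2_support b1.
  - exact: slice2_support b2.
by rewrite E /=; ring.
Qed.

Lemma ip_partial n (s : 'I_n -> bool) (e N : R) (i : 'I_n)
    (f g : 'rV[R]_n -> R) : smooth_box 1 s e N f -> smooth_box 1 s e N g ->
  ip (mu n) g (partial i f) = - ip (mu n) (partial i g) f.
Proof.
move=> sf sg; apply/eqP; rewrite -subr_eq0 opprK; apply/eqP.
elim: n s i f g sf sg => [|n IH] s i f g sf sg; first by case: i.
have Lf := smooth_box_L2 sf; have Lg := smooth_box_L2 sg.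
have Ldf := smooth_box_L2 (smooth_box_partial i sf).
have Ldg := smooth_box_L2 (smooth_box_partial i sg).
move: Ldf Ldg; case: (unliftP ord0 i) => [k ->|->] Ldf Ldg.
  have [i1 ->] := ip_slice1 Lg Ldf; have [i2 ->] := ip_slice1 Ldg Lf.
  rewrite -RintegralD//.
  rewrite (_ : (fun t => _) = cst 0) ?Rintegral_cst ?mul0r//; apply/funext => t.
  have sf' := smooth_box_slice t sf; have sg' := smooth_box_slice t sg.
  have Ep h : (fun y => partial (lift ord0 k) h (cons_rV (t, y))) =
      partial k (fun y => h (cons_rV (t, y))).
    by apply/funext => y; rewrite partialS.
  by rewrite !Ep; exact: IH sf' sg'.
have [i1 ->] := ip_slice2 Lg Ldf; have [i2 ->] := ip_slice2 Ldg Lf.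
rewrite -RintegralD//.
rewrite (_ : (fun y => _) = cst 0) ?Rintegral_cst ?mul0r//; apply/funext => y.
have [[_ _ bf] _] := smooth_box0 sf.
have [[cdf _ bdf] _] := smooth_box0 (smooth_box_partial ord0 sf).
have [[cdg _ _] _] := smooth_box0 (smooth_box_partial ord0 sg).
have -> : ip leb (fun t => g (cons_rV (t, y)))
    (fun t => partial ord0 f (cons_rV (t, y))) =
    - ip leb (fun t => partial ord0 g (cons_rV (t, y))) (fun t => f (cons_rV (t, y))).
  apply: (@Rintegral_by_parts _ (s ord0) e N).
  - by move=> t; exact: (slice2_derive y sg).
  - exact: slice2_continuous.
  - by move=> t; exact: (slice2_derive y sf).
  - exact: slice2_continuous.
  - exact: slice2_support bf.
  - exact: slice2_support bdf.
  - exact: slice2_L2 sg.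
  - exact: slice2_L2 (smooth_box_partial ord0 sg).
by rewrite addNr.
Qed.

End levels_rV.

Section spectral_gap.
Context (R : realType) (c : R).
Hypothesis c_gt0 : 0 < c.
Local Notation leb := (@lebesgue_measure R).
Local Notation mu n := (@lebesgue_rV R n).
Local Notation lev := (lev c).
Local Notation level := (level c).

Lemma sum_option (I : finType) (F : option I -> R) :
  \sum_k F k = F None + \sum_i F (Some i).
Proof.
rewrite (bigD1 None)//=; congr (_ + _).
rewrite (reindex_omap Some id) => [|[]//].
by apply: eq_bigl => i; rewrite eqxx.
Qed.

Lemma sum_unit (F : unit -> R) : \sum_k F k = F tt.
Proof. by rewrite (bigD1 tt)//= big1 ?addr0// => -[]. Qed.

Lemma orthosystem_comp d (T : measurableType d) (m : {measure set T -> \bar R})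
    (I J : finType) (e : I -> T -> R) (g : J -> I) : injective g ->
  orthosystem m e -> orthosystem m (fun j => e (g j)).
Proof.
move=> gi [h1 h2]; split=> [i j ij|i]; last exact: h2.
by apply: h1; rewrite (inj_eq gi).
Qed.

(** Integrating the one-dimensional gap over the slices in the first variable, and the inductive gap
    over the slices in the others, produces norms of the coefficient functions [a] and [b] of the
    slices. These are then compared with the coefficients of [f] on the product levels. *)
Lemma spectral_gap_rV n (s : 'I_n -> bool) (e N : R) (f : 'rV[R]_n -> R) :
  0 < e -> smooth_box 1 s e N f ->
  4 * c * ip (mu n) f f - 4 * c * ip (mu n) f (lev s None) ^+ 2
    - 2 * c * \sum_i ip (mu n) f (lev s (Some i)) ^+ 2 <=
  \sum_i ip (mu n) (partial i f) (partial i f)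
    + c ^+ 2 * \sum_i ip (mu n) (fun x => x ord0 i * f x) (fun x => x ord0 i * f x)
    - c * (\sum_i (1 + 2 * (s i)%:R)) * ip (mu n) f f.
Proof.
move=> e0; elim: n s f => [|n IH] s f sf.
  (* On the one-point space the ground state is the constant 1 and [f] is a multiple of it, so both
     sides vanish. *)
  rewrite !big_ord0; have Llev := L2_lev c_gt0 s None.
  have -> : f = fun x => f 0 * lev s None x.
    apply/funext => x; rewrite (_ : lev s None x = 1); last exact: big_ord0.
    rewrite mulr1; congr f.
    by apply/rowP; case.
  have lev1 : ip (mu 0) (lev s None) (lev s None) = 1.
    by rewrite ip_tensor ?big_ord0// => -[].
  rewrite !ipZl ?ipZr//; last exact: L2Z.
  by rewrite lev1 !mulr0 mul0r; lra.
set s' := fun i => s (lift ord0 i).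
have Lf := smooth_box_L2 sf; have sf0 := smooth_boxW sf.
have LPhi := L2_cons Lf.
have Lf1 y : L2 leb (fun t => f (cons_rV (t, y))) by exact: slice2_L2 sf.
have Lf2 t : L2 (mu n) (fun y => f (cons_rV (t, y))).
  exact: smooth_box_L2 (smooth_box_slice t sf).
have Le i : L2 leb (level i (s ord0)) by exact: L2_level.
have Lg k : L2 (mu n) (lev s' k) by exact: L2_lev.
have He := level_orthosystem c_gt0 (s ord0).
have Hg := lev_orthosystem c_gt0 s'.
pose a i y := ip leb (fun t => f (cons_rV (t, y))) (level i (s ord0)).
pose b k t := ip (mu n) (fun y => f (cons_rV (t, y))) (lev s' k).
have La i : L2 (mu n) (a i) := L2_coef1 Le He LPhi Lf1 i.
have Lb k : L2 leb (b k) := L2_coef2 Lg Hg LPhi Lf2 k.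
have iN2 := ip_slice2 Lf Lf; have iN1 := ip_slice1 Lf Lf.
have sX i := smooth_box_coordM i sf0.
have LX i := smooth_box_L2 (sX i).
have LD i := smooth_box_L2 (smooth_box_partial i sf).
have gap1 : 0 <= ip (mu n.+1) (partial ord0 f) (partial ord0 f)
    + c ^+ 2 * ip (mu n.+1) (fun x => x ord0 ord0 * f x) (fun x => x ord0 ord0 * f x)
    - (c * (1 + 2 * (s ord0)%:R) + 4 * c) * ip (mu n.+1) f f
    + 4 * c * ip (mu n) (a false) (a false) + 2 * c * ip (mu n) (a true) (a true).
  have [i1 ->] := ip_slice2 (LD ord0) (LD ord0).
  have [i2 ->] := ip_slice2 (LX ord0) (LX ord0).
  have [i3 ->] := iN2; rewrite !ip_sq.
  have [_ i4] := La false; have [_ i5] := La true.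
  have := @Rintegral_lincomb_ge0 _ _ _ (mu n) [:: (1, _); (c ^+ 2, _);
    (- (c * (1 + 2 * (s ord0)%:R) + 4 * c), _); (4 * c, _); (2 * c, _)]
    (conj i1 (conj i2 (conj i3 (conj i4 (conj i5 I))))).
  rewrite /= !big_cons big_nil /= mul1r mulNr addr0 !addrA; apply => y.
  rewrite !big_cons big_nil /= mul1r mulNr addr0 !addrA.
  have [[_ _ b0] _] := sf0.
  have [[cd _ b1] _] := smooth_box_partial ord0 sf.
  have := @spectral_gap_1D R c c_gt0 (s ord0) (fun t => f (cons_rV (t, y)))
    (fun t => partial ord0 f (cons_rV (t, y))) e N (slice2_derive y sf)
    (slice2_continuous (y:=y) cd) e0 (slice2_support b0) (slice2_support b1).
  rewrite (_ : (fun t => cons_rV (t, y) ord0 ord0 * _) =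
    fun t => t * f (cons_rV (t, y))); last first.
    by apply/funext => t; rewrite cons_rV0.
  by rewrite -/(a false y) -/(a true y); lra.
have gap2 : 0 <= \sum_i ip (mu n.+1) (partial (lift ord0 i) f) (partial (lift ord0 i) f)
    + c ^+ 2 * \sum_i ip (mu n.+1) (fun x => x ord0 (lift ord0 i) * f x)
        (fun x => x ord0 (lift ord0 i) * f x)
    - (c * (\sum_i (1 + 2 * (s' i)%:R)) + 4 * c) * ip (mu n.+1) f f
    + 4 * c * ip leb (b None) (b None)
    + 2 * c * \sum_i ip leb (b (Some i)) (b (Some i)).
  have i1 i := (ip_slice1 (LD (lift ord0 i)) (LD (lift ord0 i))).1.
  have i2 i := (ip_slice1 (LX (lift ord0 i)) (LX (lift ord0 i))).1.
  have E1 i := (ip_slice1 (LD (lift ord0 i)) (LD (lift ord0 i))).2.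
  have E2 i := (ip_slice1 (LX (lift ord0 i)) (LX (lift ord0 i))).2.
  rewrite (eq_bigr _ (fun i _ => E1 i)) (eq_bigr _ (fun i _ => E2 i)).
  have [i3 ->] := iN1; rewrite !ip_sq.
  have [_ i4] := Lb None; have i5 i := (Lb (Some i)).2.
  rewrite (eq_bigr _ (fun i _ => ip_sq leb (b (Some i)))).
  rewrite -!Rintegral_sumR//.
  have := @Rintegral_lincomb_ge0 _ _ _ leb [:: (1, _); (c ^+ 2, _);
    (- (c * (\sum_i (1 + 2 * (s' i)%:R)) + 4 * c), _); (4 * c, _); (2 * c, _)]
    (conj (integrable_sumR (index_enum _) i1) (conj (integrable_sumR (index_enum _) i2) (conj i3 (conj i4
      (conj (integrable_sumR (index_enum _) i5) I))))).
  rewrite /= !big_cons big_nil /= mul1r mulNr addr0 !addrA; apply => t.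
  rewrite !big_cons big_nil /= mul1r mulNr addr0 !addrA.
  have := IH s' _ (smooth_box_slice t sf).
  have Ep h i : partial i (fun y => h (cons_rV (t, y))) =
      (fun y => partial (lift ord0 i) h (cons_rV (t, y))).
    by apply/funext => y; rewrite partialS.
  have Ex i : (fun y => cons_rV (t, y) ord0 (lift ord0 i) * f (cons_rV (t, y))) =
      fun y => y ord0 i * f (cons_rV (t, y)).
    by apply/funext => y; rewrite cons_rVS.
  under [X in _ <= X + _ - _]eq_bigr do rewrite Ep.
  under [X in _ -> 0 <= _ + _ * X - _ + _ + _]eq_bigr do rewrite Ex.
  rewrite -/(b None t).
  have -> : \sum_i ip (mu n) (fun y => f (cons_rV (t, y))) (lev s' (Some i)) ^+ 2 =
    \sum_i b (Some i) t ^+ 2 by [].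
  by lra.
have I1 : injective (fun _ : unit => None : option 'I_n) by case=> -[].
have I2 : injective (fun _ : unit => false) by case=> -[].
(* The sum of [gap1] and [gap2] contains 8c |f|^2 where 4c |f|^2 is wanted. The surplus pays for two
   rank inequalities of weight 2c: both levels of the first variable against the ground state of the
   others, and the ground state of the first against all levels of the others. The ground
   coefficients [a false] and [b None] occur in both, which accounts for their weight 4c. *)
have := @rank_inequality _ _ _ _ R leb (mu n) _ _ _ (fun _ : unit => lev s' None)
  Le (fun _ => Lg None) He (orthosystem_comp I1 Hg) _ LPhi Lf1 Lf2.
have := @rank_inequality _ _ _ _ R leb (mu n) _ _ (fun _ : unit => level false (s ord0)) _
  (fun _ => Le false) Lg (orthosystem_comp I2 He) Hg _ LPhi Lf1 Lf2.
have su (F : option 'I_n -> unit -> R) : \sum_k \sum_l F k l = \sum_k F k tt.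
  by apply: eq_bigr => k _; exact: sum_unit.
rewrite su !sum_unit !big_bool !sum_option /=.
have Eff : ip (mu n.+1) f f = ip (leb \x mu n)%E (fun z => f (cons_rV z)) (fun z => f (cons_rV z)).
  exact: ip_cons.
have Em k i k' : (forall z, lev s k (cons_rV z) = level i (s ord0) z.1 * lev s' k' z.2) ->
  ip (leb \x mu n)%E (fun z => f (cons_rV z)) (fun z => level i (s ord0) z.1 * lev s' k' z.2)
  = ip (mu n.+1) f (lev s k).
  move=> h; rewrite ip_cons//; last exact: L2_lev.
  by congr (ip _ _ _); apply/funext => z; rewrite h.
rewrite (Em None _ _ (lev_cons_None c s)) (Em (Some ord0) _ _ (lev_cons0 c s)).
have Es : \sum_i ip (leb \x mu n)%E (fun z => f (cons_rV z))
    (fun z => level false (s ord0) z.1 * lev s' (Some i) z.2) ^+ 2 =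
    \sum_i ip (mu n.+1) f (lev s (Some (lift ord0 i))) ^+ 2.
  by apply: eq_bigr => i _; rewrite (Em _ _ _ (lev_consS c s i)).
rewrite Es -Eff.
move=> RK2 RK1.
have {RK2} RK2 : ip (mu n) (a false) (a false) + (ip leb (b None) (b None)
    + \sum_i ip leb (b (Some i)) (b (Some i))) <= ip (mu n.+1) f f
    + (ip (mu n.+1) f (lev s None) ^+ 2
    + \sum_i ip (mu n.+1) f (lev s (Some (lift ord0 i))) ^+ 2) := RK2.
have {RK1} RK1 : ip (mu n) (a true) (a true) + ip (mu n) (a false) (a false)
    + ip leb (b None) (b None) <= ip (mu n.+1) f f
    + (ip (mu n.+1) f (lev s (Some ord0)) ^+ 2
    + ip (mu n.+1) f (lev s None) ^+ 2) := RK1.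
have c2 : 0 <= 2 * c by rewrite mulr_ge0// ltW.
have {RK1} RK1 := ler_wpM2l c2 RK1; have {RK2} RK2 := ler_wpM2l c2 RK2.
rewrite -/(mu n.+1) !big_ord_recl.
move: gap1 gap2 RK1 RK2; rewrite -/s'.
set F := ip _ f f; set D0 := ip _ (partial ord0 f) _.
set X0 := ip _ (fun x : 'rV[R]_n.+1 => x ord0 ord0 * f x) _.
set DS := \sum_i ip _ (partial _ f) _.
set XS := \sum_i ip _ (fun x : 'rV[R]_n.+1 => x ord0 (lift ord0 i) * f x) _.
set W := \sum_i (1 + _).
set A0 := ip _ (a false) _; set A1 := ip _ (a true) _.
set B0 := ip _ (b None) _; set BS := \sum_i ip _ (b _) _.
set M0 := ip _ _ (lev s None); set M1 := ip _ _ (lev s (Some ord0)).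
set MS := \sum_i ip _ _ (lev s _) ^+ 2.
by move=> *; lra.
Qed.

End spectral_gap.

(** * Test functions and the completion *)

Section test_functions.
Context (R : realType) (n k : nat).
Implicit Types f g : 'rV[R]_n -> R.

(** The directions in which the orthant is a half-line; this is the [s] of the preceding lemmas. *)
Definition half (i : 'I_n) : bool := (n - k <= i)%N.

(** Each half-line coordinate attains a positive minimum on the compact set, and there are finitely
    many directions. *)
Lemma compact_orthant_box (K : set 'rV[R]_n) : compact K -> K `<=` @orthant R n k ->
  exists e N : R, 0 < e /\ forall x, K x -> forall i : 'I_n,
    `|x ord0 i| <= N /\ (half i -> e <= x ord0 i).
Proof.
move=> cK KO; have [K0|K0] := pselect (K !=set0); last first.
  exists 1, 0; split=> // x Kx; exfalso; apply: K0; by exists x.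
have ccoord i : continuous (fun x : 'rV[R]_n => x ord0 i).
  exact: coord_continuous.
have HN (i : 'I_n) : exists M : R, forall x, K x -> `|x ord0 i| <= M.
  have [|z _ zM] := @compact_EVT_max _ R (fun x : 'rV[R]_n => `|x ord0 i|) K K0 cK.
    apply: continuous_subspaceT => x.
    apply: (@continuous_comp _ _ _ (fun x : 'rV[R]_n => x ord0 i) Num.norm).
      exact: ccoord.
    exact: norm_continuous.
  by exists `|z ord0 i| => x Kx; apply: zM; rewrite inE.
have He (i : 'I_n) : exists d : R, 0 < d /\ forall x, K x -> half i -> d <= x ord0 i.
  have [hi|hi] := boolP (half i); last by exists 1; split.
  have [|z zK zm] := @compact_EVT_min _ R (fun x : 'rV[R]_n => x ord0 i) K K0 cK.
    by apply: continuous_subspaceT; exact: ccoord.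
  exists (z ord0 i); split; first by apply: (KO z) => //; exact: set_mem.
  by move=> x Kx _; apply: zm; rewrite inE.
pose M i := sval (cid (HN i)); pose d i := sval (cid (He i)).
exists (\big[Num.min/1]_i d i), (\big[Num.max/0]_i M i); split.
  by apply: lt_bigmin => // i _; rewrite /d; case: cid => ? [].
move=> x Kx i; split.
  apply: le_trans (le_bigmax _ _ i); rewrite /M; case: cid => /= ?; exact.
move=> hi; apply: le_trans (bigmin_le _ i _) _.
by rewrite /d; case: cid => /= ? [_]; exact.
Qed.

Section compact_box.
Variables (K : set 'rV[R]_n) (e N : R).
Hypotheses (cK : compact K).
Hypothesis bK : forall x, K x -> forall i : 'I_n,
  `|x ord0 i| <= N /\ (half i -> e <= x ord0 i).

Let smooth_box0_compact f : continuous f -> (forall x, ~ K x -> f x = 0) ->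
  smooth_box 0 half e N f.
Proof.
move=> cf Kf; split=> //; split=> //; last first.
  move=> x fx; apply: bK; apply: contrapT => Kx.
  by move: fx; rewrite Kf// eqxx.
have [K0|K0] := pselect (K !=set0); last first.
  by exists 0 => x; rewrite Kf ?normr0// => Kx; apply: K0; exists x.
have [|z _ zM] := @compact_EVT_max _ R (fun x : 'rV[R]_n => `|f x|) K K0 cK.
  apply: continuous_subspaceT => x.
  apply: (@continuous_comp _ _ _ f Num.norm); first exact: cf.
  exact: norm_continuous.
exists `|f z| => x; have [Kx|Kx] := pselect (K x).
  by apply: zM; rewrite inE.
by rewrite Kf// normr0.
Qed.

Lemma smooth_box_of_class_C m f : of_class_C m f ->
  (forall x, ~ K x -> f x = 0) -> smooth_box m half e N f.
Proof.
elim: m f => [|m IH] f Cf Kf; first exact: smooth_box0_compact.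
have [cf H] := Cf; split; first by case: (smooth_box0_compact cf Kf).
move=> i; have [df Cp] := H i; split=> //; apply: IH => // x Kx.
(* Off [K] the function vanishes in a neighbourhood, so its derivatives vanish there too. *)
have oK : open (~` K).
  by apply: closed_openC; apply: compact_closed => //; exact: norm_hausdorff.
rewrite /partial (@near_eq_derive _ _ _ _ (cst 0)) ?derive_cst//.
have : nbhs x (~` K) by exact: open_nbhs_nbhs.
by apply: filterS => y /Kf.
Qed.

End compact_box.

Lemma test_function_smooth_box f : test_function (@orthant R n k) f ->
  exists e N : R, 0 < e /\ forall m, smooth_box m half e N f.
Proof.
move=> [Cf [K [cK KO Kf]]]; have [e [N [e0 bK]]] := compact_orthant_box cK KO.
by exists e, N; split=> // m; exact: (smooth_box_of_class_C cK bK (Cf m) Kf).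
Qed.

Lemma smooth_boxB e N e' N' f g : smooth_box 1 half e N f ->
  smooth_box 1 half e' N' g ->
  smooth_box 1 half (Num.min e e') (Num.max N N') (fun x => f x - g x) /\
  (forall i, partial i (fun x => f x - g x) =
     fun x => partial i f x - partial i g x).
Proof.
have base f1 g1 : smooth_box 0 half e N f1 -> smooth_box 0 half e' N' g1 ->
    smooth_box 0 half (Num.min e e') (Num.max N N') (fun x => f1 x - g1 x).
  move=> [[cf [M fM] sf] _] [[cg [M' gM] sg] _]; split=> //; split.
  - by move=> x; apply: continuousB; [exact: cf|exact: cg].
  - by exists (M + M') => x; rewrite (le_trans (ler_normB _ _))// lerD.
  - move=> x fgx i; have [fx|fx] := eqVneq (f1 x) 0.
      have gx : g1 x != 0 by move: fgx; rewrite fx sub0r oppr_eq0.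
      have [xN xe] := sg x gx i; rewrite le_max xN orbT; split=> // /xe.
      by apply: le_trans; rewrite ge_min lexx orbT.
    have [xN xe] := sf x fx i; rewrite le_max xN; split=> // /xe.
    by apply: le_trans; rewrite ge_min lexx.
move=> sf sg; have E i : partial i (fun x => f x - g x) =
    fun x => partial i f x - partial i g x.
  apply/funext => x; have [_ /(_ i)[df _]] := sf; have [_ /(_ i)[dg _]] := sg.
  exact: deriveB.
split=> //; split; first by case: (base f g (smooth_boxW sf) (smooth_boxW sg)).
move=> i; have [_ /(_ i)[df sfi]] := sf; have [_ /(_ i)[dg sgi]] := sg.
split; first by move=> x; exact: derivableB.
by rewrite E; exact: base.
Qed.

End test_functions.

(** * Limits of sequences in L2 *)

Section L2_sequences.
Context d (T : measurableType d) (R : realType) (mu : {measure set T -> \bar R}).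

Section limits.
Variables (f_ : nat -> T -> R) (f : T -> R).
Hypotheses (Lf_ : forall j, L2 mu (f_ j)) (Lf : L2 mu f).
Hypothesis f_f : ip mu (fun x => f_ j x - f x) (fun x => f_ j x - f x) @[j --> \oo] --> (0 : R).

Lemma cvg_ip w : L2 mu w -> ip mu (f_ j) w @[j --> \oo] --> ip mu f w.
Proof.
move=> Lw; apply/cvgrPdist_le => e e0.
have h : ip mu (fun x => f_ j x - f x) (fun x => f_ j x - f x) * ip mu w w
    @[j --> \oo] --> (0 : R).
  by rewrite -[X in _ --> X](mul0r (ip mu w w)); exact: cvgMr_tmp.
have e2 : 0 < e ^+ 2 by rewrite exprn_gt0.
move/cvgr_le : h => /(_ _ e2); apply: filterS => j hj.
rewrite distrC -ipBl// -ler_sqr ?nnegrE ?(ltW e0)//.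
rewrite real_normK ?num_real//.
exact: le_trans (ip_CauchySchwarz (L2B (Lf_ j) Lf) Lw) hj.
Qed.

Lemma cvg_ip_sq : ip mu (f_ j) (f_ j) @[j --> \oo] --> ip mu f f.
Proof.
rewrite (_ : (fun j => _) = fun j =>
    ip mu (fun x => f_ j x - f x) (fun x => f_ j x - f x)
    + (2 * ip mu (f_ j) f - ip mu f f)); last first.
  by apply/funext => j; rewrite ip_sqB//; ring.
rewrite -[X in _ --> X](_ : 0 + (2 * ip mu f f - ip mu f f) = _); last by ring.
by apply: cvgD => //; apply: cvgB; [apply: cvgMl_tmp; exact: cvg_ip|exact: cvg_cst].
Qed.

End limits.

Lemma L2_integral_sum (I : finType) (F : I -> T -> R) :
  (forall i, L2 mu (F i)) ->
  (\int[mu]_x (\sum_i F i x ^+ 2)%:E)%E = (\sum_i ip mu (F i) (F i))%:E.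
Proof.
move=> LF; rewrite -(fineK (x := integral _ _ _)); last first.
  by apply: integrable_fin_num => //; apply: integrable_sumR => i; case: (LF i).
congr EFin; rewrite -/(Rintegral _ _ _) Rintegral_sumR; last first.
  by move=> i; case: (LF i).
by apply: eq_bigr => i _; rewrite ip_sq.
Qed.

Lemma L2_integral_sum_lt (I : finType) (F : I -> T -> R) (e : R) :
  (forall i, measurable_fun setT (F i)) ->
  (\int[mu]_x (\sum_i F i x ^+ 2)%:E <= e%:E)%E -> forall i,
  L2 mu (F i) /\ ip mu (F i) (F i) <= e.
Proof.
move=> mF le_e i; have LF j : L2 mu (F j).
  split=> //; apply/integrableP; split.
    exact/measurable_EFinP/measurable_funX.
  apply: le_lt_trans (ltry e); apply: le_trans le_e.
  apply: ge0_le_integral => //.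
  - by apply: measurableT_comp => //; exact/measurable_EFinP/measurable_funX.
  - by apply/measurable_EFinP/measurable_sum => l; exact: measurable_funX.
  - move=> x _ /=; rewrite lee_fin ger0_norm ?sqr_ge0// (bigD1 j)//= lerDl.
    by apply: sumr_ge0 => l _; exact: sqr_ge0.
split=> //; move: le_e; rewrite L2_integral_sum// lee_fin; apply: le_trans.
rewrite (bigD1 i)//= lerDl; apply: sumr_ge0 => j _; exact: ip_ge0.
Qed.

(* Cauchy sequences in L2 that converge in a weighted L2 space, for a weight
   that may degenerate, converge to the same limit in L2. *)
Lemma cauchy_weighted_limit (f_ : nat -> T -> R) (f rho : T -> R) :
  (forall j, measurable_fun setT (f_ j)) -> measurable_fun setT f ->
  measurable_fun setT rho ->
  (forall x, 0 <= rho x) -> (forall x, rho x = 0 -> forall j, f_ j x = f x) ->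
  (forall e : R, 0 < e -> \forall J \near \oo, forall j m, (J <= j)%N -> (J <= m)%N ->
     (\int[mu]_x ((f_ j x - f_ m x) ^+ 2)%:E <= e%:E)%E) ->
  (forall e : R, 0 < e -> \forall j \near \oo,
     (\int[mu]_x (rho x * (f_ j x - f x) ^+ 2)%:E <= e%:E)%E) ->
  forall e : R, 0 < e -> \forall j \near \oo,
     (\int[mu]_x ((f_ j x - f x) ^+ 2)%:E <= e%:E)%E.
Proof.
move=> mf_ mf mrho rho0 rhof cauchy weighted e e0.
have e4 : 0 < e / 4 by rewrite divr_gt0.
have [J _ /(_ _ (leqnn J)) HJ] := cauchy _ e4.
exists J => // j /= Jj.
(* The truncated weight min(1, (N + 1) rho) increases to 1 where rho > 0, and where rho = 0 the
   functions agree. By monotone convergence a bound for each [g N] is enough. *)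
pose g (N : nat) x : \bar R :=
  (Num.min 1 (N.+1%:R * rho x) * (f_ j x - f x) ^+ 2)%:E.
have mg N : measurable_fun setT (g N).
  apply/measurable_EFinP; apply: measurable_funM.
    by apply: measurable_minr => //; exact: measurable_funM.
  by apply: measurable_funX; exact: measurable_funB.
have mn0 N x : 0 <= Num.min 1 (N.+1%:R * rho x).
  by rewrite le_min ler01 mulr_ge0.
have g0 N x : setT x -> (0 <= g N x)%E.
  by move=> _; rewrite lee_fin mulr_ge0// sqr_ge0.
have ndg x : setT x -> {homo g ^~ x : N M / (N <= M)%N >-> (N <= M)%E}.
  move=> _ N M NM; rewrite lee_fin ler_wpM2r ?sqr_ge0//.
  rewrite le_min ge_min lexx /= ge_min; apply/orP; right.
  by rewrite ler_wpM2r// ler_nat.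
have gE x : limn (g ^~ x) = ((f_ j x - f x) ^+ 2)%:E.
  apply: cvg_lim => //; apply: cvg_near_cst; have := rho0 x.
  rewrite le_eqVlt => /predU1P[/esym rx|rx].
    by apply: nearW => N; rewrite /g (rhof _ rx) subrr expr0n mulr0.
  near=> N; rewrite /g (min_idPl _) ?mul1r//.
  rewrite -ler_pdivrMr// mul1r (@le_trans _ _ N%:R) ?ler_nat//.
  by near: N; exact: nbhs_infty_ger.
have := cvg_monotone_convergence (mu := mu) measurableT mg g0 ndg.
rewrite (eq_integral (fun x => ((f_ j x - f x) ^+ 2)%:E)); last first.
  by move=> x _; exact: gE.
move=> h; apply: (cvge_le _ h); apply: nearW => N.
(* The index [m] may depend on [N]: the factor N + 1 of the truncated weight is compensated by this
   tolerance, and the two halves of the final bound are 2 (e / 4) each. *)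
have eN : 0 < e / (4 * N.+1%:R) by rewrite divr_gt0// mulr_gt0.
have [m Jm Hm] : exists2 m, (J <= m)%N &
    (\int[mu]_x (rho x * (f_ m x - f x) ^+ 2)%:E <= (e / (4 * N.+1%:R))%:E)%E.
  have [m0 _ /= hm0] := weighted _ eN.
  by exists (maxn J m0); [exact: leq_maxl|apply: hm0; exact: leq_maxr].
have HJm := HJ j m Jj Jm.
apply: (@le_trans _ _ (\int[mu]_x ((2%:E * ((f_ j x - f_ m x) ^+ 2)%:E) +
    ((2 * N.+1%:R)%:E * (rho x * (f_ m x - f x) ^+ 2)%:E)))%E).
  apply: ge0_le_integral => //.
  - by move=> x _; exact: g0.
  - apply: emeasurable_funD.
      apply/measurable_EFinP; apply: measurable_funM => //.
      by apply: measurable_funX; exact: measurable_funB.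
    apply/measurable_EFinP; apply: measurable_funM => //.
    apply: measurable_funM => //.
    by apply: measurable_funX; exact: measurable_funB.
  - move=> x _; rewrite -!EFinM -EFinD lee_fin.
    set t := Num.min _ _; set a := f_ j x - f_ m x; set w := f_ m x - f x.
    have -> : f_ j x - f x = a + w by rewrite /a /w; ring.
    have t0 : 0 <= t by exact: mn0.
    have t1 : t <= 1 by rewrite /t ge_min lexx.
    have t2 : t <= N.+1%:R * rho x by rewrite /t ge_min lexx orbT.
    have aw : (a + w) ^+ 2 <= 2 * a ^+ 2 + 2 * w ^+ 2.
      by rewrite -subr_ge0 (_ : _ - _ = (a - w) ^+ 2) ?sqr_ge0//; ring.
    apply: (le_trans (ler_wpM2l t0 aw)); rewrite mulrDr lerD//.
      by rewrite ler_piMl// mulr_ge0// sqr_ge0.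
    have w2 : 0 <= 2 * w ^+ 2 by rewrite mulr_ge0// sqr_ge0.
    have := ler_wpM2l w2 t2; congr (_ <= _); first by rewrite mulrC.
    by ring.
rewrite ge0_integralD//; last 4 first.
- by move=> x _; rewrite -EFinM lee_fin mulr_ge0// sqr_ge0.
- apply/measurable_EFinP; apply: measurable_funM => //.
  by apply: measurable_funX; exact: measurable_funB.
- by move=> x _; rewrite -EFinM lee_fin mulr_ge0// mulr_ge0// sqr_ge0.
- apply/measurable_EFinP; apply: measurable_funM => //; apply: measurable_funM => //.
  by apply: measurable_funX; exact: measurable_funB.
rewrite ge0_integralZl//; last 2 first.
- by apply/measurable_EFinP; apply: measurable_funX; exact: measurable_funB.
- by move=> x _; rewrite lee_fin sqr_ge0.
rewrite ge0_integralZl//; last 2 first.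
- apply/measurable_EFinP; apply: measurable_funM => //.
  by apply: measurable_funX; exact: measurable_funB.
- by move=> x _; rewrite lee_fin mulr_ge0// sqr_ge0.
have -> : e%:E = (2%:E * (e / 4)%:E + (2 * N.+1%:R)%:E * (e / (4 * N.+1%:R))%:E)%E.
  by rewrite -!EFinM -EFinD; congr EFin; field.
by apply: leeD; apply: lee_wpmul2l => //; rewrite lee_fin// mulr_ge0.
Unshelve. all: by end_near. Qed.

End L2_sequences.

Lemma cvg_sumR (R : realType) (I : Type) (r : seq I) (F : I -> nat -> R)
    (l : I -> R) : (forall i, F i j @[j --> \oo] --> l i) ->
  \sum_(i <- r) F i j @[j --> \oo] --> \sum_(i <- r) l i.
Proof.
move=> Fl; elim: r => [|i r IH].
  by under eq_fun do rewrite big_nil; rewrite big_nil; exact: cvg_cst.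
by under eq_fun do rewrite big_cons; rewrite big_cons; exact: cvgD.
Qed.

Lemma sum_doubleD (R : realType) n (p q : 'I_n -> R) :
  \sum_i (2 * p i + 2 * q i) = 2 * \sum_i p i + 2 * \sum_i q i.
Proof. by rewrite big_split /= !mulr_sumr. Qed.

Lemma add_le_of_eighths (R : realType) (p q r t x y d : R) : 0 < d ->
  p + r <= d / 8 -> q + t <= d / 8 -> x <= 2 * p + 2 * q ->
  y <= 2 * r + 2 * t -> x + y <= d.
Proof. by lra. Qed.

Section orthant_integrals.
Context (R : realType) (n k : nat).
Local Notation mu := (@lebesgue_rV R n).
Local Notation Omega := (@orthant R n k).
Local Notation half := (@half n k).
Implicit Types (u : 'rV[R]_n -> R) (G : 'rV[R]_n -> 'rV[R]_n).

Lemma measurable_orthant : measurable Omega.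
Proof.
rewrite (_ : Omega = \bigcap_(i in [set i | half i])
    (coord_rV i @^-1` `]0, +oo[%classic)).
  apply: fin_bigcap_measurable => // i _; rewrite -[X in measurable X]setTI.
  exact: measurable_coord_rV.
by apply/seteqP; split=> x /= h i hi; have := h i hi; rewrite /coord_rV/= in_itv/= andbT.
Qed.

Lemma measurable_patch u : measurable_fun Omega u ->
  measurable_fun setT (u \_ Omega).
Proof.
move=> mu_; apply/(measurable_restrict _ measurable_orthant measurableT).
by rewrite setTI.
Qed.

(** Extension by 0 turns integrals over the orthant into inner products on the whole space. *)
Definition gradient_patch G (i : 'I_n) : 'rV[R]_n -> R :=
  (fun x => G x ord0 i) \_ Omega.

Definition coord_patch u (i : 'I_n) : 'rV[R]_n -> R :=
  fun x : 'rV[R]_n => x ord0 i * (u \_ Omega) x.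

Lemma int_sq_patch u :
  int_sq k u = (\int[mu]_x ((u \_ Omega) x ^+ 2)%:E)%E.
Proof.
rewrite /int_sq integral_mkcond; apply: eq_integral => x _; rewrite !patchE.
by case: ifP => // _; rewrite expr0n.
Qed.

Lemma int_weight_sq_patch u :
  int_weight_sq k u = (\int[mu]_x (\sum_i coord_patch u i x ^+ 2)%:E)%E.
Proof.
rewrite /int_weight_sq integral_mkcond; apply: eq_integral => x _.
rewrite /coord_patch patchE; case: ifP => xO.
  rewrite /sqnorm mulr_suml; congr EFin; apply: eq_bigr => i _.
  by rewrite patchE xO exprMn.
rewrite big1// => i _.
by rewrite patchE xO mulr0 expr0n.
Qed.

Lemma int_sqnorm_patch G :
  int_sqnorm k G = (\int[mu]_x (\sum_i gradient_patch G i x ^+ 2)%:E)%E.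
Proof.
rewrite /int_sqnorm integral_mkcond; apply: eq_integral => x _.
rewrite patchE; case: ifP => xO.
  congr EFin; rewrite /sqnorm; apply: eq_bigr => i _.
  by rewrite /gradient_patch patchE xO.
by rewrite big1// => i _; rewrite /gradient_patch patchE xO expr0n.
Qed.

Lemma box_support_orthant (e N : R) u x : 0 < e -> box_support half e N u ->
  u x != 0 -> Omega x.
Proof.
move=> e0 su ux i hi; have [_ /(_ hi)] := su x ux i.
exact: lt_le_trans.
Qed.

Lemma patch_box_support (e N : R) u : 0 < e -> box_support half e N u ->
  u \_ Omega = u.
Proof.
move=> e0 su; apply/funext => x; rewrite patchE; case: ifPn => // xO.
apply/esym/eqP/negPn/negP => /(box_support_orthant e0 su) Ox.
by move: xO; rewrite mem_set.
Qed.

End orthant_integrals.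

Lemma sqrte_small (R : realType) (S_ A_ : nat -> \bar R) :
  S_ j @[j --> \oo] --> 0%E -> (forall j, 0 <= A_ j)%E ->
  (forall j, sqrte (A_ j) <= S_ j)%E ->
  forall e : R, 0 < e -> \forall j \near \oo, (A_ j <= e%:E)%E.
Proof.
move=> S0 A0 AS e e0.
have /fine_cvgP[fin_S cvg_S] := S0.
have se : 0 < Num.sqrt e by rewrite sqrtr_gt0.
move/cvgr_le : cvg_S => /(_ _ se) hS.
near=> j.
have Sj : S_ j \is a fin_num by near: j.
have Sje : fine (S_ j) <= Num.sqrt e by near: j.
have : (sqrte (A_ j) <= sqrte e%:E)%E.
  by apply: le_trans (AS j) _; rewrite -(fineK Sj) /= lee_fin.
by rewrite lee_sqrt// lee_fin ltW.
Unshelve. all: by end_near. Qed.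

(** * The completion is contained in L2 *)

Section completion.
Context (R : realType) (n k : nat) (u : 'rV[R]_n -> R).
Context (Du : 'rV[R]_n -> 'rV[R]_n).
Hypotheses (hn : (1 <= n)%N) (hk : (1 <= k <= n)%N) (hu : in_S k u Du).
Local Notation mu := (@lebesgue_rV R n).
Local Notation Omega := (@orthant R n k).
Local Notation half := (@half n k).
Local Notation ut := (u \_ Omega).
Local Notation Dt := (gradient_patch k Du).
Local Notation Xt := (coord_patch k u).
Local Notation cvg0 f g := (ip mu (fun x => f x - g x) (fun x => f x - g x)).

(** The spectral gap at c = 1, whose left-hand side is nonnegative by Bessel's inequality, together
    with the fact that the ground eigenvalue is at least 1. It makes Cauchy sequences for the norm
    of the completion Cauchy in L2. *)
Lemma ip_le_energy (e N : R) (f : 'rV[R]_n -> R) : 0 < e ->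
  smooth_box 1 half e N f ->
  ip mu f f <= \sum_i ip mu (partial i f) (partial i f)
    + \sum_i ip mu (fun x : 'rV[R]_n => x ord0 i * f x) (fun x : 'rV[R]_n => x ord0 i * f x).
Proof.
move=> e0 sf; have Lf := smooth_box_L2 sf.
have := spectral_gap_rV (ltr01 : 0 < 1 :> R) e0 sf.
have := bessel (L2_lev (ltr01 : 0 < 1 :> R) half)
  (lev_orthosystem (ltr01 : 0 < 1 :> R) half) Lf.
rewrite sum_option expr1n !mul1r !mulr1.
have s0 : 0 <= \sum_i ip mu f (lev 1 half (Some i)) ^+ 2.
  by apply: sumr_ge0 => i _; exact: sqr_ge0.
have w1 : 1 <= \sum_(i < n) (1 + 2 * (half i)%:R) :> R.
  case: (n) hn => // m _; rewrite big_ord_recl -[X in X <= _]addr0.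
  apply: lerD; first by rewrite lerDl mulr_ge0.
  by apply: sumr_ge0 => i _; rewrite addr_ge0// mulr_ge0.
have f0 := ip_ge0 mu f; have := ler_wpM2r f0 w1; rewrite mul1r.
by move=> h1 h2 h3; lra.
Qed.

(** The norm directly controls the gradients and the products x_i u. For u itself, the energy bound
    gives a Cauchy sequence in L2, and the convergence weighted by |x|^2 identifies its limit. *)
Lemma in_S_approximation : exists phi : nat -> 'rV[R]_n -> R,
  [/\ forall j, test_function Omega (phi j),
      L2 mu ut, forall i, L2 mu (Dt i) & forall i, L2 mu (Xt i)] /\
  [/\ cvg0 (phi j) ut @[j --> \oo] --> (0 : R),
      forall i, cvg0 (partial i (phi j)) (Dt i) @[j --> \oo] --> (0 : R) &
      forall i, cvg0 (fun x : 'rV[R]_n => x ord0 i * phi j x) (Xt i) @[j --> \oo] --> (0 : R)].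
Proof.
have [mu_ mDu [phi [tphi cvgS]]] := hu.
exists phi.
have sphi j := test_function_smooth_box (tphi j).
have L0 j : L2 mu (phi j).
  by have [e [N [_ /(_ 0%N)/smooth_box_L2]]] := sphi j.
have LD j i : L2 mu (partial i (phi j)).
  by have [e [N [_ /(_ 1%N)/(smooth_box_partial i)/smooth_box_L2]]] := sphi j.
have LX j i : L2 mu (fun x : 'rV[R]_n => x ord0 i * phi j x).
  by have [e [N [_ /(_ 0%N)/(smooth_box_coordM i)/smooth_box_L2]]] := sphi j.
have mut : measurable_fun setT ut by exact: measurable_patch.
have mDt i : measurable_fun setT (Dt i).
  apply: measurable_patch.
  by apply: (@measurableT_comp _ _ _ _ _ _ (coord_rV i)) => //; exact: measurable_coord_rV.
have mXt i : measurable_fun setT (Xt i).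
  apply: measurable_funM => //; exact: (@measurable_coord_rV R n i).
have pphi j : phi j \_ Omega = phi j.
  have [e [N [e0 /(_ 0%N)[[_ _ sf] _]]]] := sphi j; exact: patch_box_support sf.
have EA j : int_sqnorm k (grad (phi j) \- Du)%R =
    (\int[mu]_x (\sum_i (partial i (phi j) x - Dt i x) ^+ 2)%:E)%E.
  rewrite int_sqnorm_patch; apply: eq_integral => x _; congr EFin.
  apply: eq_bigr => i _; congr (_ ^+ 2).
  have [e [N [e0 /(_ 1%N)/(smooth_box_partial i)[[_ _ sf] _]]]] := sphi j.
  rewrite -(patch_box_support e0 sf) /gradient_patch !patchE.
  by case: ifP => // _; rewrite ?subr0// !mxE.
have EB j : int_weight_sq k (phi j \- u)%R =
    (\int[mu]_x (\sum_i (x ord0 i * phi j x - Xt i x) ^+ 2)%:E)%E.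
  rewrite int_weight_sq_patch; apply: eq_integral => x _; congr EFin.
  apply: eq_bigr => i _; congr (_ ^+ 2); rewrite /coord_patch -mulrBr; congr (_ * _).
  by rewrite -{2}(pphi j) !patchE; case: ifP => // _; rewrite subr0.
have A0 j : (0 <= int_sqnorm k (grad (phi j) \- Du)%R)%E.
  by rewrite EA integral_ge0// => x _; rewrite lee_fin sumr_ge0// => i _; exact: sqr_ge0.
have B0 j : (0 <= int_weight_sq k (phi j \- u)%R)%E.
  by rewrite EB integral_ge0// => x _; rewrite lee_fin sumr_ge0// => i _; exact: sqr_ge0.
have smallA := sqrte_small cvgS A0 (fun j => leeDl _ (sqrte_ge0 _)).
have smallB := sqrte_small cvgS B0 (fun j => leeDr _ (sqrte_ge0 _)).
have HA i e : 0 < e -> \forall j \near \oo,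
    L2 mu (fun x => partial i (phi j) x - Dt i x) /\ cvg0 (partial i (phi j)) (Dt i) <= e.
  move=> e0; have := smallA _ e0; apply: filterS => j; rewrite EA => h.
  apply: (@L2_integral_sum_lt _ _ _ _ _ (fun i x => partial i (phi j) x - Dt i x) e _ h i).
  by move=> l; apply: measurable_funB => //; case: (LD j l).
have HB i e : 0 < e -> \forall j \near \oo,
    L2 mu (fun x : 'rV[R]_n => x ord0 i * phi j x - Xt i x) /\
    cvg0 (fun x : 'rV[R]_n => x ord0 i * phi j x) (Xt i) <= e.
  move=> e0; have := smallB _ e0; apply: filterS => j; rewrite EB => h.
  apply: (@L2_integral_sum_lt _ _ _ _ _ (fun i (x : 'rV[R]_n) => x ord0 i * phi j x - Xt i x) e _ h i).
  by move=> l; apply: measurable_funB => //; case: (LX j l).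
have from_small (F_ : nat -> 'rV[R]_n -> R) F : (forall j, L2 mu (F_ j)) ->
    (forall e : R, 0 < e -> \forall j \near \oo,
      L2 mu (fun x => F_ j x - F x) /\ cvg0 (F_ j) F <= e) ->
    L2 mu F /\ cvg0 (F_ j) F @[j --> \oo] --> (0 : R).
  move=> LF_ h; split.
    have [j0 _ /(_ _ (leqnn j0))[LB _]] := h 1 ltr01.
    rewrite (_ : F = fun x => F_ j0 x - (F_ j0 x - F x)); first exact: L2B.
    by apply/funext => x; rewrite subKr.
  apply/cvgr0Pnorm_le => e e0; have := h e e0.
  by apply: filterS => j [_ hj]; rewrite ger0_norm ?ip_ge0.
have FD i := from_small (fun j => partial i (phi j)) (Dt i) (fun j => LD j i) (HA i).
have FX i := from_small (fun j (x : 'rV[R]_n) => x ord0 i * phi j x) (Xt i) (fun j => LX j i) (HB i).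
suff Hu e : 0 < e -> \forall j \near \oo,
    L2 mu (fun x => phi j x - ut x) /\ cvg0 (phi j) ut <= e.
  have [Lut cut] := from_small phi ut L0 Hu.
  split; split=> // i; [exact: (FD i).1|exact: (FX i).1|exact: (FD i).2|exact: (FX i).2].
move=> e0.
have mphi j : measurable_fun setT (phi j) by case: (L0 j).
have rho0 (x : 'rV[R]_n) : 0 <= sqnorm x by apply: sumr_ge0 => i _; exact: sqr_ge0.
have mrho : measurable_fun setT (@sqnorm R n).
  apply: measurable_sum => i; apply: measurable_funX.
  exact: (@measurable_coord_rV R n i).
(* The weight vanishes only at the origin. Since [1 <= k], the last coordinate is positive on the
   orthant, so the origin lies outside and both functions are 0 there. *)
have rhof (x : 'rV[R]_n) : sqnorm x = 0 -> forall j, phi j x = ut x.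
  move=> x0 j; have xO : ~ Omega x.
    have [m nm] : exists m, n = m.+1 by exists n.-1; rewrite prednK.
    have i0P : (n.-1 < n)%N by rewrite nm.
    pose i0 := Ordinal i0P.
    have hi0 : half i0.
      by case/andP: hk => k1 _; rewrite -[half _]/(n - k <= n.-1)%N -subn1 leq_sub2l.
    move=> /(_ i0 hi0).
    have : x ord0 i0 ^+ 2 <= 0.
      by rewrite -x0 /sqnorm (bigD1 i0)//= lerDl sumr_ge0// => i _; exact: sqr_ge0.
    by move=> h /(exprn_gt0 2) h2; have := lt_le_trans h2 h; rewrite ltxx.
  by rewrite -(pphi j) !patchE memNset.
have weighted d : 0 < d -> \forall j \near \oo,
    (\int[mu]_x (sqnorm x * (phi j x - ut x) ^+ 2)%:E <= d%:E)%E.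
  move=> d0; have := smallB _ d0; apply: filterS => j; rewrite EB.
  rewrite (eq_integral (fun x => (sqnorm x * (phi j x - ut x) ^+ 2)%:E))//.
  move=> x _; congr EFin; rewrite /sqnorm mulr_suml; apply: eq_bigr => i _.
  by rewrite -exprMn mulrBr.
pose aD j := \sum_i cvg0 (partial i (phi j)) (Dt i).
pose aX j := \sum_i cvg0 (fun x : 'rV[R]_n => x ord0 i * phi j x) (Xt i).
pose a j := aD j + aX j.
have a0 : a j @[j --> \oo] --> (0 : R).
  rewrite -[X in _ --> X](_ : \sum_(i < n) 0 + \sum_(i < n) 0 = _); last first.
    by rewrite !big1// addr0.
  by apply: cvgD; apply: cvg_sumR => i; [exact: (FD i).2|exact: (FX i).2].
(* The parallelogram law: the difference of the two sides is |F + G - 2 H|^2. *)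
have ip_tri F G H : L2 mu F -> L2 mu G -> L2 mu H ->
    cvg0 F G <= 2 * cvg0 F H + 2 * cvg0 G H.
  move=> LF LG LH; rewrite !ip_sqB//.
  have LS : L2 mu (fun x => F x + G x) by exact: L2D.
  have := ip_ge0 mu (fun x => (F x + G x) - 2 * H x).
  rewrite ip_sqB//; last exact: L2Z.
  rewrite ipZr// ipZr//; last exact: L2Z.
  rewrite ipZl// !ipDl// !ipDr// (ipC mu G F).
  by lra.
have cauchy d : 0 < d -> \forall J \near \oo, forall j m, (J <= j)%N -> (J <= m)%N ->
    (\int[mu]_x ((phi j x - phi m x) ^+ 2)%:E <= d%:E)%E.
  move=> d0; have d8 : 0 < d / 8 by rewrite divr_gt0.
  have [J0 _ HJ] := (cvgr_le _ a0) _ d8.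
  exists J0 => // J /= J0J j m Jj Jm.
  have aj : a j <= d / 8 by apply: HJ; exact: leq_trans Jj.
  have am : a m <= d / 8 by apply: HJ; exact: leq_trans Jm.
  have [e1 [N1 [e10 s1]]] := sphi j; have [e2 [N2 [e20 s2]]] := sphi m.
  have [sB EBp] := smooth_boxB (s1 1%N) (s2 1%N).
  have e12 : 0 < Num.min e1 e2 by rewrite lt_min e10.
  have := ip_le_energy e12 sB.
  have LB : L2 mu (fun x => phi j x - phi m x) by exact: L2B.
  have [_ iB] := LB.
  rewrite -[X in (X <= _)%E]fineK; last exact: integrable_fin_num.
  rewrite lee_fin -/(Rintegral _ _ _) -ip_sq => h.
  apply: le_trans h _.
  have SD : \sum_i ip mu (partial i (fun x => phi j x - phi m x))
      (partial i (fun x => phi j x - phi m x)) <=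
      2 * aD j + 2 * aD m.
    rewrite -sum_doubleD; apply: ler_sum => i _.
    by rewrite EBp; apply: ip_tri => //; exact: (FD i).1.
  have SX : \sum_i ip mu (fun x : 'rV[R]_n => x ord0 i * (phi j x - phi m x))
      (fun x : 'rV[R]_n => x ord0 i * (phi j x - phi m x)) <=
      2 * aX j + 2 * aX m.
    rewrite -sum_doubleD; apply: ler_sum => i _.
    rewrite (_ : (fun x => _ * (_ - _)) =
      fun x : 'rV[R]_n => x ord0 i * phi j x - x ord0 i * phi m x); last first.
      by apply/funext => x; rewrite mulrBr.
    by apply: ip_tri => //; exact: (FX i).1.
  exact: (add_le_of_eighths d0 aj am SD SX).
have := cauchy_weighted_limit mphi mut mrho rho0 rhof cauchy weighted e0.
apply: filterS => j hj.
apply: (@L2_integral_sum_lt _ _ _ _ _ (fun (i : 'I_1) x => phi j x - ut x) e _ _ ord0).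
  by move=> _; exact: measurable_funB.
by under eq_integral do rewrite big_ord1.
Qed.

End completion.

(** * Extremal functions and the equality case *)

Section extremals.
Context (R : realType) (n k : nat).
Local Notation mu := (@lebesgue_rV R n).
Local Notation Omega := (@orthant R n k).
Local Notation half := (@half n k).

Definition ground_rV (b : R) : 'rV[R]_n -> R := tensor (fun i => ground b (half i)).

Lemma ground_rVE b :
  ground_rV b = (fun x => last_prod k x * expR (- (b / 2 * sqnorm x))) \_ Omega.
Proof.
apply/funext => x; rewrite patchE; case: ifPn => [/set_mem xO|/negP xO].
  rewrite /ground_rV /tensor /last_prod /sqnorm mulr_sumr -sumrN expR_sum.
  rewrite [X in _ = X * _]big_mkcond -big_split; apply: eq_bigr => i _ /=.
  rewrite /ground -/(half i); case: ifPn => hi; last by rewrite mul1r.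
  by rewrite xO.
have /existsNP[i /not_implyP[hi xi]] : ~ (forall i, half i -> 0 < x ord0 i).
  by move=> h; apply: xO; rewrite inE.
by rewrite /ground_rV /tensor (bigD1 i)//= /ground hi (negbTE (introN idP xi)) mul0r.
Qed.

Lemma L2_ground_rV b : 0 < b -> L2 mu (ground_rV b).
Proof. by move=> b0; apply: L2_tensor_rV => i; exact: L2_ground. Qed.

Section levels.
Variable c : R.
Hypothesis c_gt0 : 0 < c.
Local Notation leb := (@lebesgue_measure R).

Definition lev_scale : R :=
  \prod_(i < n) (Num.sqrt (ip leb (ground c (half i)) (ground c (half i))))^-1.

Lemma lev_scale_neq0 : lev_scale != 0.
Proof.
apply/prodf_neq0 => i _; rewrite invr_eq0 gt_eqF// sqrtr_gt0.
exact: ip_ground_gt0.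
Qed.

Lemma lev_NoneE x : lev c half None x = lev_scale * ground_rV c x.
Proof.
rewrite /lev /tensor /lev_scale /ground_rV /tensor -big_split.
by apply: eq_bigr => i _ /=; rewrite level0E.
Qed.

Lemma lev_Some_half i x : half i -> lev c half (Some i) x = 0.
Proof.
by move=> hi; rewrite /lev /tensor (bigD1 i)//= eqxx/= /level1 hi mul0r.
Qed.

Lemma lev_SomeE i x : ~~ half i ->
  lev c half (Some i) x =
  Num.sqrt (2 * c) * lev_scale * (x ord0 i * ground_rV c x).
Proof.
move=> hi; transitivity (Num.sqrt (2 * c) * (x ord0 i * lev c half None x)).
  rewrite /lev /tensor (bigD1 i)//= [in RHS](bigD1 i)//= eqxx /= /level1 (negbTE hi).
  set P := \prod_(_ < n | _) _; set Q := \prod_(_ < n | _) _.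
  suff -> : P = Q by ring.
  apply: eq_bigr => j ji.
  by rewrite (inj_eq Some_inj) eq_sym (negbTE ji).
by rewrite lev_NoneE; ring.
Qed.

End levels.

(** The constant of the deficit is the sum of the one-dimensional ground eigenvalues at c = 1: 1 for
    a line, 3 for a half-line. *)
Lemma sum_half_weight : (k <= n)%N ->
  \sum_(i < n) (1 + 2 * (half i)%:R) = (n + 2 * k)%:R :> R.
Proof.
move=> kn; rewrite big_split/= -mulr_sumr sumr_const card_ord natrD natrM.
congr (_ + _ * _); rewrite -natr_sum; congr (_%:R).
rewrite -(big_mkord xpredT (fun i => (n - k <= i)%N : nat)).
rewrite (@big_cat_nat _ _ _ (n - k))//= ?leq_subr//.
rewrite big_nat_cond big1; last first.
  by move=> i /andP[/andP[_ ik] _]; rewrite leqNgt ik.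
rewrite add0n big_nat_cond (eq_bigr (fun=> 1%N)); last first.
  by move=> i /andP[/andP[-> _] _].
by rewrite -big_nat_cond sum_nat_const_nat muln1 subKn.
Qed.

End extremals.

Lemma smooth_box_mono (R : realType) m n (s : 'I_n -> bool) (e N e' N' : R)
    (f : 'rV[R]_n -> R) : e' <= e -> N <= N' ->
  smooth_box m s e N f -> smooth_box m s e' N' f.
Proof.
move=> ee NN; elim: m f => [|m IH] f [[cf bf sf] h]; split=> //.
- split=> // x /sf h1 i; have [h2 h3] := h1 i; split; first exact: le_trans NN.
  by move=> /h3; exact: le_trans.
- split=> // x /sf h1 i; have [h2 h3] := h1 i; split; first exact: le_trans NN.
  by move=> /h3; exact: le_trans.
- by move=> i; have [df /IH] := h i.
Qed.

(** * The gap and the energy identity in the completion *)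

Section energy.
Context (R : realType) (n k : nat) (u : 'rV[R]_n -> R).
Context (Du : 'rV[R]_n -> 'rV[R]_n).
Local Notation mu := (@lebesgue_rV R n).
Local Notation Omega := (@orthant R n k).
Local Notation half := (@half n k).
Local Notation ut := (u \_ Omega).
Local Notation Dt := (gradient_patch k Du).
Local Notation Xt := (coord_patch k u).
Local Notation cvg0 f g := (ip mu (fun x => f x - g x) (fun x => f x - g x)).

Variable phi : nat -> 'rV[R]_n -> R.
Hypothesis tphi : forall j, test_function Omega (phi j).
Hypotheses (Lut : L2 mu ut) (LDt : forall i, L2 mu (Dt i)) (LXt : forall i, L2 mu (Xt i)).
Hypothesis cut : cvg0 (phi j) ut @[j --> \oo] --> (0 : R).
Hypothesis cDt : forall i, cvg0 (partial i (phi j)) (Dt i) @[j --> \oo] --> (0 : R).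
Hypothesis cXt : forall i, cvg0 (fun x : 'rV[R]_n => x ord0 i * phi j x) (Xt i)
  @[j --> \oo] --> (0 : R).

Let Lphi j : L2 mu (phi j).
Proof.
by have [e [N [_ /(_ 0%N)/smooth_box_L2]]] := test_function_smooth_box (tphi j).
Qed.

Let LD j i : L2 mu (partial i (phi j)).
Proof.
by have [e [N [_ /(_ 1%N)/(smooth_box_partial i)/smooth_box_L2]]] :=
  test_function_smooth_box (tphi j).
Qed.

Let LDD j i : L2 mu (partial i (partial i (phi j))).
Proof.
by have [e [N [_ /(_ 2%N)/(smooth_box_partial i)/(smooth_box_partial i)/smooth_box_L2]]] :=
  test_function_smooth_box (tphi j).
Qed.

Let LX j i : L2 mu (fun x : 'rV[R]_n => x ord0 i * phi j x).
Proof.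
by have [e [N [_ /(_ 0%N)/(smooth_box_coordM i)/smooth_box_L2]]] :=
  test_function_smooth_box (tphi j).
Qed.

Let LXX j i : L2 mu (fun x : 'rV[R]_n => x ord0 i * (x ord0 i * phi j x)).
Proof.
by have [e [N [_ /(_ 0%N)/(smooth_box_coordM i)/(smooth_box_coordM i)/smooth_box_L2]]] :=
  test_function_smooth_box (tphi j).
Qed.

(** Both sides are continuous under the three L2 convergences [cut], [cDt] and [cXt]. *)
Lemma completion_gap c : 0 < c ->
  4 * c * ip mu ut ut - 4 * c * ip mu ut (lev c half None) ^+ 2
    - 2 * c * \sum_i ip mu ut (lev c half (Some i)) ^+ 2 <=
  \sum_i ip mu (Dt i) (Dt i) + c ^+ 2 * \sum_i ip mu (Xt i) (Xt i)
    - c * (\sum_i (1 + 2 * (half i)%:R)) * ip mu ut ut.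
Proof.
move=> c0; pose W := \sum_i (1 + 2 * (half i)%:R) : R.
have cU := cvg_ip_sq Lphi Lut cut.
have cm o : ip mu (phi j) (lev c half o) ^+ 2 @[j --> \oo] -->
    ip mu ut (lev c half o) ^+ 2.
  rewrite expr2; under eq_fun do rewrite expr2.
  by apply: cvgM; apply: cvg_ip => //; exact: L2_lev.
have cA : \sum_i ip mu (partial i (phi j)) (partial i (phi j)) @[j --> \oo] -->
    \sum_i ip mu (Dt i) (Dt i).
  apply: (@cvg_sumR R 'I_n _ (fun i j => ip mu (partial i (phi j)) (partial i (phi j)))).
  by move=> i; apply: (@cvg_ip_sq _ _ _ _ (fun j => partial i (phi j))).
have cX : \sum_i ip mu (fun x : 'rV[R]_n => x ord0 i * phi j x)
    (fun x : 'rV[R]_n => x ord0 i * phi j x) @[j --> \oo] -->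
    \sum_i ip mu (Xt i) (Xt i).
  apply: (@cvg_sumR R 'I_n _ (fun i j => ip mu (fun x : 'rV[R]_n => x ord0 i * phi j x)
    (fun x : 'rV[R]_n => x ord0 i * phi j x))).
  by move=> i; apply: (@cvg_ip_sq _ _ _ _ (fun j (x : 'rV[R]_n) => x ord0 i * phi j x)).
have cM : \sum_i ip mu (phi j) (lev c half (Some i)) ^+ 2 @[j --> \oo] -->
    \sum_i ip mu ut (lev c half (Some i)) ^+ 2.
  apply: (@cvg_sumR R 'I_n _ (fun i j => ip mu (phi j) (lev c half (Some i)) ^+ 2)).
  by move=> i; exact: cm.
have h1 := cvgB (cvgB (cvgMl_tmp (a := 4 * c) cU) (cvgMl_tmp (a := 4 * c) (cm None)))
  (cvgMl_tmp (a := 2 * c) cM).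
have h2 := cvgB (cvgD cA (cvgMl_tmp (a := c ^+ 2) cX)) (cvgMl_tmp (a := c * W) cU).
apply: (ler_cvg_to (h1 _ _ _ _ _) (h2 _ _ _ _)); apply: nearW => j.
have [e [N [e0 sf]]] := test_function_smooth_box (tphi j).
exact: (spectral_gap_rV c0 e0 (sf 1%N)).
Qed.

(** Integration by parts between [phi j] and [phi m], followed by the limit in j with m fixed. *)
Let weak_gradient i m : ip mu (Dt i) (partial i (phi m)) =
  - ip mu ut (partial i (partial i (phi m))).
Proof.
have h1 : ip mu (partial i (phi j)) (partial i (phi m)) @[j --> \oo] -->
    ip mu (Dt i) (partial i (phi m)).
  exact: (@cvg_ip _ _ _ _ (fun j => partial i (phi j))).
have h2 : - ip mu (phi j) (partial i (partial i (phi m))) @[j --> \oo] -->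
    - ip mu ut (partial i (partial i (phi m))).
  by apply: cvgN; apply: cvg_ip.
have E j : ip mu (partial i (phi j)) (partial i (phi m)) =
    - ip mu (phi j) (partial i (partial i (phi m))).
  have [e1 [N1 [e10 s1]]] := test_function_smooth_box (tphi j).
  have [e2 [N2 [e20 s2]]] := test_function_smooth_box (tphi m).
  have sj : smooth_box 1 half (Num.min e1 e2) (Num.max N1 N2) (phi j).
    by apply: smooth_box_mono (s1 1%N); rewrite ?ge_min ?le_max lexx.
  have sm : smooth_box 2 half (Num.min e1 e2) (Num.max N1 N2) (phi m).
    by apply: smooth_box_mono (s2 2%N); rewrite ?ge_min ?le_max lexx orbT.
  by rewrite (ip_partial i (smooth_box_partial i sm) sj) opprK.
move: h1; under eq_fun do rewrite E; move=> /(cvg_lim (@Rhausdorff R)) <-.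
exact: (cvg_lim (@Rhausdorff R) h2).
Qed.

Section combination.
Variables (c : R) (w : option 'I_n -> R).
Hypothesis c0 : 0 < c.
Hypothesis utE : {ae mu, forall x, ut x = \sum_o w o * lev c half o x}.

Let Ll o : L2 mu (lev c half o). Proof. exact: L2_lev. Qed.

Let ip_ut g : L2 mu g -> ip mu ut g = \sum_o w o * ip mu (lev c half o) g.
Proof.
move=> Lg; have LS : L2 mu (fun x => \sum_o w o * lev c half o x).
  by apply: L2_sum => o; exact: L2Z.
rewrite (@ae_eq_ip _ _ _ _ _ (fun x => \sum_o w o * lev c half o x)) //; last 3 first.
- by case: Lut.
- by case: LS.
- by case: Lg.
rewrite ip_suml//; last by move=> o; exact: L2Z.
by apply: eq_bigr => o _; rewrite ipZl.
Qed.

Let eigen i o m : ip mu (lev c half o) (partial i (partial i (phi m))) =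
  c ^+ 2 * ip mu (lev c half o) (fun x : 'rV[R]_n => x ord0 i * (x ord0 i * phi m x))
  - c * (1 + 2 * (half i)%:R + 2 * (o == Some i)%:R) * ip mu (lev c half o) (phi m).
Proof.
have [e [N [e0 sf]]] := test_function_smooth_box (tphi m).
have := @tensor_eigen_weak R c c0 n half e N (fun j => level c (o == Some j) (half j))
  i (o == Some i) (phi m) e0 (fun j => L2_level c0 _ _) erefl (sf 2%N).
rewrite -/(lev c half o).
rewrite ipDr//; [|by apply: L2B => //; exact: L2Z|exact: L2Z].
rewrite ipBr//; last exact: L2Z.
rewrite !ipZr// => /eqP; rewrite addr_eq0 subr_eq => /eqP ->.
by rewrite addrC.
Qed.

(** One factor u is replaced by [phi m], so that the oscillator in direction [i] can be moved onto
    [phi m] and evaluated on each level. The eigenvalues are the same for all levels except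
    [Some i], where the value is 2c higher. The limit in m restores u. *)
Lemma energy_coord i : ip mu (Dt i) (Dt i) + c ^+ 2 * ip mu (Xt i) (Xt i) =
  c * (1 + 2 * (half i)%:R) * ip mu ut ut
  + 2 * c * ip mu ut (lev c half (Some i)) ^+ 2.
Proof.
have E m : ip mu (partial i (phi m)) (Dt i)
    + c ^+ 2 * ip mu (fun x : 'rV[R]_n => x ord0 i * phi m x) (Xt i) =
  c * (1 + 2 * (half i)%:R) * ip mu (phi m) ut
  + 2 * c * w (Some i) * ip mu (phi m) (lev c half (Some i)).
  rewrite ipC weak_gradient ip_ut//.
  have -> : ip mu (fun x : 'rV[R]_n => x ord0 i * phi m x) (Xt i) =
      ip mu ut (fun x : 'rV[R]_n => x ord0 i * (x ord0 i * phi m x)).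
    by apply: eq_Rintegral => x _; rewrite /coord_patch; ring.
  rewrite (ipC mu (phi m) ut) !ip_ut//.
  pose P o := w o * ip mu (lev c half o)
    (fun x : 'rV[R]_n => x ord0 i * (x ord0 i * phi m x)).
  pose Q o := w o * ip mu (lev c half o) (phi m).
  rewrite (eq_bigr (fun o => c ^+ 2 * P o - c * (1 + 2 * (half i)%:R) * Q o
    - 2 * c * ((o == Some i)%:R * Q o))); last first.
    by move=> o _; rewrite eigen /P /Q; ring.
  rewrite !sumrB -!mulr_sumr.
  have -> : \sum_o (o == Some i)%:R * Q o = Q (Some i).
    rewrite (bigD1 (Some i))//= eqxx mul1r big1 ?addr0// => o oi.
    by rewrite (negbTE oi) mul0r.
  rewrite /Q (ipC mu (phi m)).
  by rewrite -/(P) -/(Q); ring.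
have l1 : ip mu (partial i (phi m)) (Dt i)
    + c ^+ 2 * ip mu (fun x : 'rV[R]_n => x ord0 i * phi m x) (Xt i) @[m --> \oo] -->
    ip mu (Dt i) (Dt i) + c ^+ 2 * ip mu (Xt i) (Xt i).
  apply: cvgD; first exact: (@cvg_ip _ _ _ _ (fun j => partial i (phi j))).
  apply: cvgMl_tmp.
  exact: (@cvg_ip _ _ _ _ (fun j (x : 'rV[R]_n) => x ord0 i * phi j x)).
have l2 : c * (1 + 2 * (half i)%:R) * ip mu (phi m) ut
  + 2 * c * w (Some i) * ip mu (phi m) (lev c half (Some i)) @[m --> \oo] -->
    c * (1 + 2 * (half i)%:R) * ip mu ut ut
  + 2 * c * w (Some i) * ip mu ut (lev c half (Some i)).
  by apply: cvgD; apply: cvgMl_tmp; exact: cvg_ip.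
move: l1; under eq_fun do rewrite E; move=> /(cvg_lim (@Rhausdorff R)) <-.
rewrite (cvg_lim (@Rhausdorff R) l2); congr (_ + _).
rewrite expr2 -!mulrA; congr (_ * (_ * _)).
(* The weight [w (Some i)] is the coefficient of u unless the level is the zero function, and then
   both sides are 0. *)
have [h1 h2] := lev_orthosystem c0 half.
have -> : ip mu ut (lev c half (Some i)) =
    w (Some i) * ip mu (lev c half (Some i)) (lev c half (Some i)).
  rewrite ip_ut// (bigD1 (Some i))//= big1 ?addr0// => o oi.
  by rewrite h1// mulr0.
by case: (h2 (Some i)) => ->; rewrite ?ip0l !(mulr1, mulr0).
Qed.

Lemma energy_identity :
  \sum_i ip mu (Dt i) (Dt i) + c ^+ 2 * \sum_i ip mu (Xt i) (Xt i) =
  c * (\sum_i (1 + 2 * (half i)%:R)) * ip mu ut ut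
  + 2 * c * \sum_i ip mu ut (lev c half (Some i)) ^+ 2.
Proof.
have E : \sum_i (ip mu (Dt i) (Dt i) + c ^+ 2 * ip mu (Xt i) (Xt i)) =
    \sum_i (c * (1 + 2 * (half i)%:R) * ip mu ut ut
      + 2 * c * ip mu ut (lev c half (Some i)) ^+ 2).
  by apply: eq_bigr => i _; exact: energy_coord.
have sumE (p q : 'I_n -> R) a : \sum_i (p i + a * q i) = \sum_i p i + a * \sum_i q i.
  by rewrite big_split/= mulr_sumr.
move: E; rewrite sumE => ->.
rewrite (sumE (fun i => c * (1 + 2 * (half i)%:R) * ip mu ut ut)
  (fun i => ip mu ut (lev c half (Some i)) ^+ 2)).
by rewrite -mulr_suml -mulr_sumr.
Qed.

End combination.

End energy.

(** * Distance to the Gaussians *)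

Section distance_to_extremals.
Context (R : realType) (n k : nat) (u : 'rV[R]_n -> R).
Local Notation mu := (@lebesgue_rV R n).
Local Notation Omega := (@orthant R n k).
Local Notation half := (@half n k).
Local Notation ut := (u \_ Omega).
Local Notation dist := (ereal_inf [set int_sq k (u \- v)%R | v in Etilde k]).
Local Notation defect a b :=
  (ip mu (fun x => ut x - a * ground_rV k b x) (fun x => ut x - a * ground_rV k b x)).

Hypothesis Lut : L2 mu ut.

Lemma int_sq_Etilde (v : 'rV[R]_n -> R) a b : 0 < b ->
  v = (fun x => last_prod k x * (a * expR (- (b / 2 * sqnorm x)))) ->
  int_sq k (u \- v)%R = (defect a b)%:E.
Proof.
move=> b0 ->; rewrite int_sq_patch ip_sq.
have LB : L2 mu (fun x => ut x - a * ground_rV k b x).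
  by apply: L2B => //; apply/L2Z/L2_ground_rV.
rewrite /Rintegral fineK; last by apply: integrable_fin_num => //; case: LB.
apply: eq_integral => x _; congr (_ ^+ 2)%:E.
rewrite ground_rVE !patchE; case: ifP => // _; last by rewrite mulr0 subrr.
by rewrite /= mulrCA.
Qed.

Lemma dist_le a b : 0 < b -> (dist <= (defect a b)%:E)%E.
Proof.
move=> b0; apply: ereal_inf_lbound.
exists (fun x => last_prod k x * (a * expR (- (b / 2 * sqnorm x)))).
  by exists a, (b / 2); rewrite divr_gt0.
exact: int_sq_Etilde.
Qed.

Lemma dist_ge y : (forall a b, 0 < b -> y <= defect a b) -> (y%:E <= dist)%E.
Proof.
move=> h; apply: le_ereal_inf_tmp => _ [v [a [b [b0 vE]]] <-].
have b20 : 0 < 2 * b by rewrite mulr_gt0.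
rewrite (@int_sq_Etilde v a (2 * b))//; first by rewrite lee_fin h.
by rewrite vE; apply/funext => x; rewrite (mulrC 2) mulfK.
Qed.

(** Subtracting a Gaussian of any scale leaves the first-level coefficients unchanged; Bessel's
    inequality is applied to the difference. *)
Lemma first_level_le_defect c a b : 0 < c -> 0 < b ->
  \sum_i ip mu ut (lev c half (Some i)) ^+ 2 <= defect a b.
Proof.
move=> c0 b0; have Lg : L2 mu (ground_rV k b) by exact: L2_ground_rV.
have LB : L2 mu (fun x => ut x - a * ground_rV k b x) by apply: L2B => //; exact: L2Z.
have Ll o : L2 mu (lev c half o) by exact: L2_lev.
apply: le_trans (bessel Ll (lev_orthosystem c0 half) LB).
rewrite sum_option -[X in X <= _]add0r lerD ?sqr_ge0//.
apply: ler_sum => i _; rewrite ipBl//; last exact: L2Z.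
by rewrite ipZl// (ipC mu (ground_rV k b)) /ground_rV lev_ground// mulr0 subr0.
Qed.

End distance_to_extremals.

Lemma sum_free (R : realType) n k (F : 'I_n -> R) :
  (forall i, half k i -> F i = 0) ->
  \sum_i F i = \sum_(j < n - k) F (widen_ord (leq_subr k n) j).
Proof.
move=> F0; rewrite -(@big_ord_narrow _ _ _ _ _ F (leq_subr k n)).
by rewrite [LHS]big_mkcond [RHS]big_mkcond; apply: eq_bigr => i _ /=;
  case: ltnP => // /F0.
Qed.

Section extremal_form.
Context (R : realType) (n k : nat).
Local Notation Omega := (@orthant R n k).
Local Notation half := (@half n k).
Local Notation free := (widen_ord (leq_subr k n)).

Lemma sum_levE c (w : option 'I_n -> R) :
  (fun x => \sum_o w o * lev c half o x) =
  (fun x => last_prod k x * expR (- (c / 2 * sqnorm x)) *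
    (\sum_(j < n - k) (w (Some (free j)) * (Num.sqrt (2 * c) * lev_scale n k c))
      * x ord0 (free j) + w None * lev_scale n k c)) \_ Omega.
Proof.
apply/funext => x; rewrite sum_option lev_NoneE.
rewrite (@sum_free R n k (fun i => w (Some i) * lev c half (Some i) x)); last first.
  by move=> i hi; rewrite lev_Some_half// mulr0.
rewrite (eq_bigr (fun j : 'I_(n - k) => ground_rV k c x *
  ((w (Some (free j)) * (Num.sqrt (2 * c) * lev_scale n k c)) * x ord0 (free j)))).
  rewrite -mulr_sumr ground_rVE !patchE; case: ifP => _; last by rewrite mul0r !mulr0 addr0.
  by ring.
move=> j _; rewrite lev_SomeE; last by rewrite -[half _]/(_ <= _)%N -ltnNge/=.
by ring.
Qed.

(** With B = c / 2 the exponents match. The levels in half-line directions are zero, so a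
    combination carries an affine factor in the free coordinates only, with coefficients rescaled by
    nonzero normalizations. *)
Lemma extremal_formP (u : 'rV[R]_n -> R) :
  (exists (b_ : 'I_(n - k) -> R) (b B : R), 0 < B /\
     {ae lebesgue_rV n, forall x, Omega x ->
       u x = last_prod k x * expR (- (B * sqnorm x)) *
             (\sum_(i < n - k) b_ i * x ord0 (free i) + b)}) <->
  exists c w, 0 < c /\ {ae lebesgue_rV n, forall x,
    (u \_ Omega) x = \sum_o w o * lev c half o x}.
Proof.
split=> [[b_ [b [B [B0 h]]]]|[c [w [c0 h]]]]; last first.
  exists (fun j => w (Some (free j)) * (Num.sqrt (2 * c) * lev_scale n k c)).
  exists (w None * lev_scale n k c), (c / 2); split; first by rewrite divr_gt0.
  apply: filterS h => x h xO; move: h.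
  by rewrite -[X in _ = X -> _]/((fun x => _) x) sum_levE !patchE mem_set.
have B20 : 0 < 2 * B by rewrite mulr_gt0.
pose s := lev_scale n k (2 * B); have s0 : s != 0 by exact: lev_scale_neq0.
have t0 : Num.sqrt (2 * (2 * B)) * s != 0.
  by rewrite mulf_neq0// gt_eqF// sqrtr_gt0 mulr_gt0.
(* [insub] fails exactly in the half-line directions; the weight is then 0. *)
pose w (o : option 'I_n) := if o is Some i then
  oapp b_ 0 (insub (val i)) / (Num.sqrt (2 * (2 * B)) * s) else b / s.
have wN : w None * s = b by rewrite /w divfK.
have wS j : w (Some (free j)) * (Num.sqrt (2 * (2 * B)) * s) = b_ j.
  by rewrite /w divfK// (valK j).
exists (2 * B), w; split=> //; apply: filterS h => x h.
rewrite -[X in _ = X]/((fun x => _) x) sum_levE !patchE.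
case: ifP => // /set_mem xO; rewrite -/s wN h// (mulrC 2) mulfK//.
by rewrite (mulrC B); under [in RHS]eq_bigr do rewrite wS.
Qed.

End extremal_form.

(** If A = 0, then V <= c X for all c, and a small c suffices; if X = 0, then V <= A / c, and a
    large one does. *)
Lemma vanishing_mass (R : realType) (A X V : R) : 0 <= A -> 0 <= X ->
  A = 0 \/ X = 0 -> (forall c, 0 < c -> c * V <= A + c ^+ 2 * X) -> V <= 0.
Proof.
move=> A0 X0 AX h; rewrite leNgt; apply/negP => V0.
case: AX => [AE|XE].
  have X1 : 0 < X + 1 by rewrite ltr_wpDl.
  have c0 : 0 < V / (X + 1) by rewrite divr_gt0.
  have := h _ c0; rewrite AE add0r expr2 -mulrA ler_pM2l// leNgt => /negP; apply.
  by rewrite mulrAC ltr_pdivrMr// ltr_pM2l// ltrDl.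
have c0 : 0 < (A + 1) / V by rewrite divr_gt0// ltr_wpDl.
by have := h _ c0; rewrite XE mulr0 addr0 divfK ?gt_eqF// gerDl ler10.
Qed.

(* The two hypotheses on [c] are the spectral gap and Bessel's inequality; they
   are compared at the balancing scale [c = sqrt (A / X)]. *)
Lemma gap_at_optimal_scale (R : realType) (A X U W : R) (m2 M : R -> R) :
    0 <= A -> 0 <= X -> 0 <= U -> 1 <= W -> (forall c, 0 <= M c) ->
    (forall c, 0 < c -> m2 c + M c <= U) ->
    (forall c, 0 < c -> 4 * c * U - 4 * c * m2 c - 2 * c * M c <=
      A + c ^+ 2 * X - c * W * U) ->
  (U = 0 /\ Num.sqrt A * Num.sqrt X = 0) \/
  exists2 c, 0 < c & 2 * U - 2 * m2 c - M c <= Num.sqrt A * Num.sqrt X - W / 2 * U.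
Proof.
move=> A0 X0 U0 W1 M0 bess gap.
(* There is no balancing scale here. The gap and Bessel's inequality give c W U <= A + c^2 X at
   every scale, which forces U = 0. *)
have degenerate : A = 0 \/ X = 0 -> U = 0 /\ Num.sqrt A * Num.sqrt X = 0.
  move=> AX; split; last by case: AX => ->; rewrite sqrtr0 ?mul0r ?mulr0.
  have WU : W * U <= 0.
    apply: (vanishing_mass A0 X0 AX) => c c0; rewrite mulrA -subr_ge0.
    apply: le_trans (gap c c0).
    have := ler_wpM2l (ltW c0) (bess c c0).
    have := mulr_ge0 (ltW c0) (M0 c).
    rewrite mulrDr -!mulrA; lra.
  apply/eqP; rewrite eq_le U0 andbT; apply: le_trans WU.
  by rewrite ler_peMl.
have [Ap|Ap] := ltP 0 A; have [Xp|Xp] := ltP 0 X.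
- right; set a := Num.sqrt A; set x := Num.sqrt X.
  have ap : 0 < a by rewrite sqrtr_gt0.
  have xp : 0 < x by rewrite sqrtr_gt0.
  have c0 : 0 < a / x by rewrite divr_gt0.
  exists (a / x) => //; have := gap _ c0.
  have -> : A = (a / x) * (a * x).
    by rewrite mulrCA -!mulrA mulVf ?gt_eqF// mulr1 -expr2 sqr_sqrtr.
  have -> : (a / x) ^+ 2 * X = (a / x) * (a * x).
    rewrite -(sqr_sqrtr X0) -/x !expr2; field; exact: lt0r_neq0.
  move: (a / x) c0 => c c0 h; rewrite -(ler_pM2l (x := 2 * c)) ?mulr_gt0//.
  rewrite (_ : 2 * c * _ = 4 * c * U - 4 * c * m2 c - 2 * c * M c); last by ring.
  by apply: le_trans h _; rewrite le_eqVlt; apply/orP; left; apply/eqP; field.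
- by left; apply: degenerate; right; apply/eqP; rewrite eq_le Xp X0.
- by left; apply: degenerate; left; apply/eqP; rewrite eq_le Ap A0.
- by left; apply: degenerate; left; apply/eqP; rewrite eq_le Ap A0.
Qed.

(** The inequality 2c sqrt A sqrt X <= A + c^2 X holds at every scale, so [c] need not be the
    balancing one. *)
Lemma young_deficit (R : realType) (A X U W M c : R) : 0 <= A -> 0 <= X -> 0 < c ->
  A + c ^+ 2 * X = c * W * U + 2 * c * M ->
  Num.sqrt A * Num.sqrt X - W / 2 * U <= M.
Proof.
move=> A0 X0 c0 h; set a := Num.sqrt A; set x := Num.sqrt X.
have AE : A = a ^+ 2 by rewrite sqr_sqrtr.
have XE : X = x ^+ 2 by rewrite sqr_sqrtr.
have := sqr_ge0 (a - c * x); rewrite sqrrB exprMn -AE -XE => {}s.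
rewrite -(ler_pM2l (x := 2 * c)) ?mulr_gt0//.
have -> : 2 * c * (a * x - W / 2 * U) = 2 * (a * (c * x)) - c * W * U by field.
rewrite mulr2n in s; move: h s; rewrite -/a -/x; lra.
Qed.

Theorem theorem1p3 (R : realType) (n k : nat) (hn : (1 <= n)%N)
    (hk : (1 <= k <= n)%N)
    (u : 'rV[R]_n -> R) (Du : 'rV[R]_n -> 'rV[R]_n) (hu : in_S k u Du) :
  (ereal_inf [set int_sq k (u \- v)%R | v in Etilde k] <= rho1 k u Du)%E /\
  (rho1 k u Du = ereal_inf [set int_sq k (u \- v)%R | v in Etilde k] <->
   exists (b_ : 'I_(n - k) -> R) (b B : R), 0 < B /\
     {ae lebesgue_rV n, forall x, orthant k x ->
       u x = last_prod k x * expR (- (B * sqnorm x)) *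
             (\sum_(i < n - k) b_ i * x ord0 (widen_ord (leq_subr k n) i) + b)}).
Proof.
have [phi [[tphi Lut LDt LXt] [cut cDt cXt]]] := in_S_approximation hn hk hu.
pose ut := u \_ (orthant k).
pose mu := @lebesgue_rV R n.
pose U := ip mu ut ut.
pose A := \sum_i ip mu (gradient_patch k Du i) (gradient_patch k Du i).
pose X := \sum_i ip mu (coord_patch k u i) (coord_patch k u i).
pose W := (n + 2 * k)%:R : R.
pose m c o := ip mu ut (lev c (@half n k) o).
pose M c := \sum_i m c (Some i) ^+ 2.
have kn : (k <= n)%N by case/andP: hk.
have W1 : 1 <= W by rewrite ler1n addn_gt0 hn.
have A0 : 0 <= A by apply: sumr_ge0 => i _; exact: ip_ge0.
have X0 : 0 <= X by apply: sumr_ge0 => i _; exact: ip_ge0.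
have U0 : 0 <= U by exact: ip_ge0.
have gap c : 0 < c -> 4 * c * U - 4 * c * m c None ^+ 2 - 2 * c * M c <=
    A + c ^+ 2 * X - c * W * U.
  move=> c0; rewrite /W -(sum_half_weight R kn).
  exact: (completion_gap tphi Lut LDt LXt cut cDt cXt c0).
have Ll c (c0 : 0 < c) o : L2 mu (lev c (@half n k) o) by exact: L2_lev.
have bess c : 0 < c -> m c None ^+ 2 + M c <= U.
  move=> c0; have := bessel (Ll c c0) (lev_orthosystem c0 (@half n k)) Lut.
  by rewrite sum_option.
have M0 c : 0 <= M c by apply: sumr_ge0 => i _; exact: sqr_ge0.
pose r := Num.sqrt A * Num.sqrt X - W / 2 * U.
have rhoE : rho1 k u Du = r%:E.
  rewrite /rho1 int_sqnorm_patch int_weight_sq_patch int_sq_patch.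
  rewrite !L2_integral_sum// -/A -/X /=.
  have -> : (\int[lebesgue_rV n]_x (ut x ^+ 2)%:E)%E = U%:E.
    rewrite /U ip_sq /Rintegral fineK//; apply: integrable_fin_num => //.
    by case: Lut.
  by [].
(* The factor [lev_scale] converts the coefficient on the normalized ground state into one on the
   Gaussian, so that what is subtracted is the orthogonal projection of [ut]. *)
have defect0 c : 0 < c -> ip mu (fun x => ut x - m c None * lev_scale n k c * ground_rV k c x)
    (fun x => ut x - m c None * lev_scale n k c * ground_rV k c x) = U - m c None ^+ 2.
  move=> c0; rewrite (_ : (fun x => _) = fun x => ut x - m c None * lev c (@half n k) None x).
    rewrite ip_sqB//; last exact: L2Z (Ll c c0 _).
    rewrite ipZr//; last exact: Ll.
    rewrite ipZr; [|exact: Ll|exact: L2Z (Ll c c0 _)].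
    rewrite ipZl; [|exact: Ll|exact: Ll].
    have := orthosystem_coef (lev_orthosystem c0 (@half n k)) ut None None.
    by rewrite eqxx -/(m c None) => ->; rewrite -/U -/(m c None); ring.
  by apply/funext => x; rewrite lev_NoneE mulrA.
have distle : (ereal_inf [set int_sq k (u \- v)%R | v in Etilde k] <= r%:E)%E.
  have [[UE SE]|[c c0 h]] := gap_at_optimal_scale A0 X0 U0 W1 M0 bess gap.
    apply: le_trans (dist_le Lut 0 ltr01) _; rewrite lee_fin.
    have -> : (fun x => (u \_ (orthant k)) x - 0 * ground_rV k 1 x) = ut.
      by apply/funext => x; rewrite mul0r subr0.
    by rewrite [X in X <= _]UE /r SE UE mulr0 subrr.
  apply: le_trans (dist_le Lut (m c None * lev_scale n k c) c0) _.
  rewrite lee_fin defect0//; apply: le_trans h.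
  have := bess c c0; have := M0 c; lra.
rewrite rhoE; split=> //; rewrite extremal_formP; split=> [rE|[c [w [c0 utE]]]]; last first.
  apply/eqP; rewrite eq_le distle andbT.
  apply: le_trans (_ : (M c)%:E <= _)%E; last first.
    by apply: dist_ge => // a b b0; exact: first_level_le_defect.
  rewrite lee_fin.
  have := energy_identity tphi Lut LDt LXt cut cDt cXt c0 utE.
  rewrite sum_half_weight// -/A -/X -/W -/U -/(M c) => h.
  exact: (young_deficit A0 X0 c0 h).
have [[UE SE]|[c c0 h]] := gap_at_optimal_scale A0 X0 U0 W1 M0 bess gap.
  (* In the degenerate case u vanishes almost everywhere, and any scale with zero coefficients
     represents it. *)
  exists 1, (fun=> 0); split => //.
  have : {ae mu, forall x, ut x = 0} by exact: ip_eq0_ae.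
  apply: filterS => x; rewrite -/ut big1 => // o _; exact: mul0r.
exists c, (m c); split => //.
have e0 := lev_orthosystem c0 (@half n k).
have LP : L2 mu (fun x => \sum_o m c o * lev c (@half n k) o x).
  by apply: L2_sum => o; exact/L2Z/Ll.
suff : ip mu (fun x => ut x - \sum_o m c o * lev c (@half n k) o x)
    (fun x => ut x - \sum_o m c o * lev c (@half n k) o x) = 0.
  move/(ip_eq0_ae (L2B Lut LP)); apply: filterS => x /eqP.
  by rewrite subr_eq0 => /eqP.
apply/eqP; rewrite eq_le ip_ge0 andbT (bessel_id (Ll c c0) e0 Lut) sum_option.
(* Equality yields 2U - 2 m0^2 - M <= rho_1 = dist <= U - m0^2, hence U - m0^2 - M <= 0. The
   left-hand side is the squared norm of the residue of u off the first two levels. *)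
have := dist_le Lut (m c None * lev_scale n k c) c0.
rewrite defect0// -rE lee_fin => /(le_trans h).
change (2 * U - 2 * m c None ^+ 2 - M c <= U - m c None ^+ 2 ->
  U - (m c None ^+ 2 + M c) <= 0).
move: (U) (m c None ^+ 2) (M c) => a b d; lra.
Qed.
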